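(* Let $\mathcal{L}$ be an oriented link in $S^3$ with $L\ge 1$ components, let $W_{(R_1,\dots,R_L)}(q,\lambda)$ be its quantum-group invariants (rational functions of $q^{\pm 1/2},\lambda^{\pm 1/2}$, as in the context), and let $$Z(V_1,\dots,V_L)=1+\sum_{\{\vec k^{(\alpha)}\}} W_{(\vec k^{(1)},\dots,\vec k^{(L)})}\prod_{\alpha=1}^L\frac{|C(\vec k^{(\alpha)})|}{\ell_\alpha!}\,\Upsilon_{\vec k^{(\alpha)}}(V_\alpha),\qquad F=\log Z,$$ be the generating functional and free energy defined in the context. Then there is exactly one family of rational functions $f_{(R_1,\dots,R_L)}(q,\lambda)$ of $q^{\pm1/2},\lambda^{\pm1/2}$, indexed by $L$-tuples of Young diagrams $(R_1,\dots,R_L)$ that are not all empty, such that $$F(V_1,\dots,V_L)=\sum_{d=1}^\infty\ \sum_{\{R_\alpha\}}\frac1d\, f_{(R_1,\dots,R_L)}(q^d,\lambda^d)\prod_{\alpha=1}^L \mathrm{Tr}_{R_\alpha}V_\alpha^d ,$$ and it is given explicitly by $$f_{(R_1,\dots,R_L)}(q,\lambda)=\sum_{d,m=1}^{\infty}(-1)^{m-1}\frac{\mu(d)}{d\,m}\sum_{\{\vec k^{(\alpha\,j)},\,R_{\alpha j}\}}\ \prod_{\alpha=1}^L\chi_{R_\alpha}\Bigl(C\Bigl(\bigl(\textstyle\sum_{j=1}^m\vec k^{(\alpha\,j)}\bigr)_d\Bigr)\Bigr)\ \prod_{j=1}^m\left[\left(\prod_{\alpha=1}^L\frac{|C(\vec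 k^{(\alpha\,j)})|}{\ell_{\alpha j}!}\,\chi_{R_{\alpha j}}\bigl(C(\vec k^{(\alpha\,j)})\bigr)\right)W_{(R_{1j},\dots,R_{Lj})}(q^d,\lambda^d)\right].$$ Here $\mu$ is the Moebius function, and the inner sum runs over all vectors $\vec k^{(\alpha\,j)}$ ($\alpha=1,\dots,L$, $j=1,\dots,m$) such that $\sum_{\alpha=1}^L|\vec k^{(\alpha\,j)}|>0$ for every $j$, and over all Young diagrams $R_{\alpha j}$ with $\ell_{\alpha j}=\sum_i i\,k^{(\alpha\,j)}_i$ boxes. (For fixed $(R_1,\dots,R_L)$ only finitely many terms are nonzero.)
   Context: **Vectors and conjugacy classes.** A vector $\vec k=(k_1,k_2,\dots)$ is a finitely supported sequence of nonnegative integers (the zero vector is allowed). Put $\ell=\sum_j j\,k_j$ and $|\vec k|=\sum_j k_j$. $C(\vec k)$ is the conjugacy class of the symmetric group $S_\ell$ consisting of permutations with $k_j$ cycles of length $j$; its number of elements is $|C(\vec k)|=\ell!/(\prod_j k_j!\prod_j j^{k_j})$. For the zero vector, $\ell=0$ and $|C(\vec k)|/\ell!=1$. For a positive integer $d$, $\vec k_d$ is the vector with $(\vec k_d)_{di}=k_i$ for all $i\geq 1$ and all other entries $0$. Sums of vectors are componentwise. **Characters.** Irreducible representations $R$ are labelled by Young diagrams, including the empty diagram, which is the trivial representation. $\chi_R$ is the character of the irreducible representation of the symmetric group on (number of boxes of $R$) letters labelled by $R$; $\chi_R(C(\vec k))$ is set to $0$ if the number of boxes of $R$ is not $\sum_j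 j\,k_j$, and $\chi_R(C(\vec 0))=1$ for $R$ empty. **Symmetric functions.** For each $\alpha=1,\dots,L$, $V_\alpha$ stands for a formal element of $SU(\infty)$ with eigenvalues $x^{(\alpha)}_1,x^{(\alpha)}_2,\dots$, treated as independent variables. Thus $\mathrm{Tr}\,V_\alpha^j=\sum_i (x_i^{(\alpha)})^j$ is the power sum, $\Upsilon_{\vec k}(V_\alpha)=\prod_j(\mathrm{Tr}\,V_\alpha^j)^{k_j}$, and $\mathrm{Tr}_R V_\alpha$ is the Schur function $s_R(x^{(\alpha)}_1,x^{(\alpha)}_2,\dots)$ (equal to $1$ for $R$ empty). $\mathrm{Tr}_R V_\alpha^d$ means $s_R((x^{(\alpha)}_1)^d,(x^{(\alpha)}_2)^d,\dots)$. All identities are between formal power series symmetric in each set of variables, with coefficients rational functions of $q^{\pm1/2},\lambda^{\pm1/2}$ ($q^{1/2}$ and $\lambda^{1/2}$ being independent variables). For a rational function $g(q,\lambda)$ of these variables, $g(q^d,\lambda^d)$ is obtained by the substitution $q^{1/2}\mapsto q^{d/2}$, $\lambda^{1/2}\mapsto\lambda^{d/2}$. **Quantum-group invariants.** Let $\mathcal{L}$ have components $\mathcal{K}_1,\dots,\mathcal{K}_L$, and present it as the closure of a braid $\xi$ on $\mathcal{N}$ strands. To $\mathcal{K}_\alpha$ attach the irreducible $U_q(\mathrm{sl}(N,\mathbf{C}))$-module $V_{\Lambda_\alpha}$ with highest weight $\Lambda_\alpha$ corresponding to a nonempty Young diagram $R_\alpha$ with $\ell_\alpha$ boxes; let $V$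 be the tensor product over the strands of the modules attached to them. The universal $\mathcal{R}$-matrix is $$\mathcal{R}=q^{\frac12\sum_{i,j}C^{-1}_{ij}H_i\otimes H_j}\prod_\beta\exp_q[(1-q^{-1})X_\beta^+\otimes X_\beta^-],$$ with $C_{ij}$ the Cartan matrix, $\beta$ running over positive roots, $X^\pm_\beta$ the standard root vectors, $\exp_q(x)=\sum_{k\ge0}q^{k(k+1)/4}x^k/[k]_q!$ and $[n]_q=(q^{n/2}-q^{-n/2})/(q^{1/2}-q^{-1/2})$. Set $\check{\mathcal{R}}=P_{12}\mathcal{R}$ with $P_{12}$ the exchange of factors; $\pi(\xi)$ is the operator on $V$ obtained by letting each elementary braid $\sigma_i^{\pm1}$ act by $\check{\mathcal{R}}^{\pm1}$ on the $i$-th and $(i+1)$-th factors. Let $\mu_{\rm enh}=q^{\rho^*}$, where $\rho^*$ is the Cartan element corresponding to the Weyl vector $\rho$ under the Killing form. Then $$W_{(R_1,\dots,R_L)}(\mathcal{L})=q^{d(\mathcal{L})}\,\mathrm{Tr}_V\bigl(\mu_{\rm enh}^{\otimes\mathcal{N}}\pi(\xi)\bigr),$$ $$d(\mathcal{L})=-\tfrac12\sum_\alpha w(\mathcal{K}_\alpha)(\Lambda_\alpha,\Lambda_\alpha+2\rho)+\tfrac1N\sum_{\alpha<\beta}\mathrm{lk}(\mathcal{K}_\alpha,\mathcal{K}_\beta)\,\ell_\alpha\ell_\beta,$$ where $w$ is the writhe and $\mathrm{lk}$ the linking number. It is a standing fact that this is an invariant of $\mathcal{L}$ and that, with $\lambda=q^N$,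 it is given by a rational function $W_{(R_1,\dots,R_L)}(q,\lambda)$ of $q^{\pm1/2},\lambda^{\pm1/2}$. If some, but not all, of the $R_\alpha$ are empty, $W_{(R_1,\dots,R_L)}(\mathcal{L})$ is defined as the invariant of the sublink of components with nonempty diagrams, labelled by those diagrams. **Generating functional.** For vectors $\vec k^{(1)},\dots,\vec k^{(L)}$, not all zero, $$W_{(\vec k^{(1)},\dots,\vec k^{(L)})}=\sum_{\{R_\alpha\}}\prod_{\alpha=1}^L\chi_{R_\alpha}(C(\vec k^{(\alpha)}))\,W_{(R_1,\dots,R_L)}(q,\lambda),$$ where $R_\alpha$ runs over Young diagrams with $\ell_\alpha=\sum_j j\,k^{(\alpha)}_j$ boxes. In the definition of $Z$ the sum is over all $L$-tuples of vectors with $\sum_\alpha|\vec k^{(\alpha)}|>0$, and $\log Z$ is the formal logarithm. In the expansion of $F$ in terms of the $f_{(R_1,\dots,R_L)}$, the sum over $\{R_\alpha\}$ is over all $L$-tuples of Young diagrams not all empty. *)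

(* Defs.v *)
From HB Require Import structures.
From mathcomp Require Import all_boot all_order all_algebra all_fingroup.
From mathcomp Require Import all_field all_character generic_quotient.
From mathcomp Require Import finmap monalg mxtens.
From mathcomp Require Import boolp classical_sets functions cardinality fsbigop.

Set Implicit Arguments.
Unset Strict Implicit.
Unset Printing Implicit Defensive.

Import Order.TTheory GRing.Theory Num.Theory.
Local Open Scope ring_scope.

(* Formal power series in the (possibly infinitely many) variables indexed by
   I, given by their coefficients on the monomials {cmonom I}.  The set of
   factorizations of a monomial is finite, so the sum in fps_mul is a genuine
   finite sum. *)
Record fps (I : choiceType) (A : Type) := Fps { coef : {cmonom I} -> A }.

HB.instance Definition _ (I : choiceType) (A : Type) := [isNew for @coef I A].
HB.instance Definition _ (I : choiceType) (A : choiceType) :=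
  [Choice of fps I A by <:].

Section FpsRing.
Variables (I : choiceType) (A : comNzRingType).
Implicit Types (f g h : fps I A) (m : {cmonom I}).

Definition fps_add f g : fps I A := Fps (fun m => coef f m + coef g m).
Definition fps_opp f : fps I A := Fps (fun m => - coef f m).
Definition fps_zero : fps I A := Fps (fun=> 0).
Definition fps_one : fps I A := Fps (fun m => (m == mone)%:R).
Definition fps_mul f g : fps I A := Fps (fun m =>
  \sum_(p \in [set p : {cmonom I} * {cmonom I} | mmul p.1 p.2 = m]%classic)
     coef f p.1 * coef g p.2).
Definition fps_scale (c : A) f : fps I A := Fps (fun m => c * coef f m).

Lemma fpsP f g : coef f =1 coef g -> f = g.
Proof. by case: f g => [f] [g] /= fg; congr Fps; apply/funext. Qed.

Lemma fps_addA : associative fps_add.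
Proof. by move=> f g h; apply: fpsP => m /=; rewrite addrA. Qed.
Lemma fps_addC : commutative fps_add.
Proof. by move=> f g; apply: fpsP => m /=; rewrite addrC. Qed.
Lemma fps_add0 : left_id fps_zero fps_add.
Proof. by move=> f; apply: fpsP => m /=; rewrite add0r. Qed.
Lemma fps_addN : left_inverse fps_zero fps_opp fps_add.
Proof. by move=> f; apply: fpsP => m /=; rewrite addNr. Qed.

HB.instance Definition _ :=
  GRing.isZmodule.Build (fps I A) fps_addA fps_addC fps_add0 fps_addN.

Definition divisors_cm m : seq {cmonom I} :=
  undup [seq [cmonom (f i : nat) | i : finsupp m]%M
           | f : {ffun finsupp m -> 'I_(mdeg m).+1}].

Lemma divisors_cmP m a b : mmul a b = m -> a \in divisors_cm m.
Proof.
move=> abm; rewrite mem_undup; apply/mapP.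
have abE i : m i = (a i + b i)%N by rewrite -abm mulcmE.
exists [ffun i : finsupp m => inord (a (val i))]; first by rewrite mem_enum.
apply/eqP/cmP => i; rewrite cmE fsfun_ffun.
case: insubP => /= [u iu <-|].
  rewrite ffunE inordK // ltnS.
  apply: leq_trans (leq_addr (b (val u)) _) _; rewrite -abE /mdeg.
  by rewrite (big_fsetD1 (val u)) ?fsvalP //= leq_addr.
by rewrite memNfinsupp abE addn_eq0 => /andP[/eqP].
Qed.

Lemma divisors_cmPr m a b : mmul a b = m -> b \in divisors_cm m.
Proof. by rewrite mulmC; exact: divisors_cmP. Qed.

Lemma coef_mul m f g n : (exists c, mmul n c = m) ->
  coef (fps_mul f g) n = \sum_(a <- divisors_cm m) \sum_(b <- divisors_cm m)
                    (coef f a * coef g b) *+ (mmul a b == n).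
Proof.
case=> c ncm; set D := divisors_cm m.
have inD a b : mmul a b = n -> a \in D /\ b \in D.
  move=> abn; split.
    by apply: (@divisors_cmP m a (mmul b c)); rewrite mulmA abn.
  by apply: (@divisors_cmP m b (mmul a c)); rewrite mulmA (mulmC b) abn.
pose r := [seq p <- [seq (a, b) | a <- D, b <- D] | mmul p.1 p.2 == n].
have uD : uniq D by exact: undup_uniq.
rewrite /= (fsbigE r).
- rewrite big_filter_cond big_mkcond /= big_allpairs /=.
  apply: eq_bigr => a _; apply: eq_bigr => b _.
  case: eqP => [abn|_] /=; last by rewrite mulr0n.
  by rewrite ifT ?mulr1n //; apply/mem_set.
- by rewrite filter_uniq // allpairs_uniq // => -[? ?] [? ?].
- by move=> p /=; rewrite mem_filter => /andP[/eqP].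
- move=> [a b] /= abn; rewrite mem_filter /= abn eqxx /= => /negP[].
  by have [aD bD] := inD _ _ abn; apply/allpairsP; exists (a, b).
Qed.

Lemma fps_mulC : commutative fps_mul.
Proof.
move=> f g; apply: fpsP => m.
have m1 : exists c, mmul m c = m by exists mone; rewrite mulm1.
rewrite !(coef_mul _ _ m1) exchange_big; apply: eq_bigr => a _.
by apply: eq_bigr => b _; rewrite mulrC mulmC.
Qed.

Lemma fps_mul1 : left_id fps_one fps_mul.
Proof.
move=> f; apply: fpsP => m.
have m1 : exists c, mmul m c = m by exists mone; rewrite mulm1.
rewrite (coef_mul _ _ m1) exchange_big /=.
rewrite (bigD1_seq m) ?undup_uniq //=; last first.
  by apply: (@divisors_cmP _ _ mone); rewrite mulm1.
rewrite (bigD1_seq mone) ?undup_uniq //=; last first.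
  by apply: (@divisors_cmP _ _ m); rewrite mul1m.
rewrite eqxx mul1r mul1m eqxx mulr1n big1 ?big1 ?addr0 //.
  move=> b bm; rewrite big1_seq // => a /= _.
  case: eqP => [->|]; last by rewrite mul0r mul0rn.
  by rewrite mul1m (negPf bm) mulr0n.
by move=> a /negPf->; rewrite mul0r mul0rn.
Qed.

Lemma fps_mulDl : left_distributive fps_mul fps_add.
Proof.
move=> f g h; apply: fpsP => m.
have m1 : exists c, mmul m c = m by exists mone; rewrite mulm1.
rewrite -[RHS]/(coef (fps_mul f h) m + coef (fps_mul g h) m).
rewrite !(coef_mul _ _ m1) -big_split; apply: eq_bigr => a _.
by rewrite -big_split; apply: eq_bigr => b _ /=; rewrite mulrDl mulrnDl.
Qed.

Lemma fps_mulA : associative fps_mul.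
Proof.
move=> f g h; apply: fpsP => m.
have m1 : exists c, mmul m c = m by exists mone; rewrite mulm1.
rewrite !(coef_mul _ _ m1).
set D := divisors_cm m; have uD : uniq D by exact: undup_uniq.
transitivity (\sum_(a <- D) \sum_(b <- D) \sum_(c <- D)
   (coef f a * coef g b * coef h c) *+ (mmul (mmul a b) c == m)).
  apply: eq_bigr => a _.
  transitivity (\sum_(e <- D) \sum_(b <- D) \sum_(c <- D)
     (coef f a * coef g b * coef h c) *+ ((mmul b c == e) && (mmul a e == m))).
    apply: eq_bigr => e _; case: eqP => [aem|_]; last first.
      by rewrite mulr0n big1 // => b _; rewrite big1 // => c _; rewrite andbF.
    rewrite mulr1n (@coef_mul m); last by exists a; rewrite mulmC.
    rewrite mulr_sumr; apply: eq_bigr => b _; rewrite mulr_sumr.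
    by apply: eq_bigr => c _; rewrite andbT mulrnAr mulrA.
  rewrite exchange_big; apply: eq_bigr => b _.
  rewrite exchange_big; apply: eq_bigr => c _ /=.
  rewrite -mulmA; have [abcm|abcm] := eqVneq (mmul a (mmul b c)) m.
    rewrite (bigD1_seq (mmul b c)) //=; last exact: (divisors_cmPr abcm).
    rewrite eqxx abcm eqxx mulr1n big1 ?addr0 // => e /negPf ne.
    by rewrite eq_sym ne mulr0n.
  rewrite mulr0n big1 // => e _.
  by case: eqP => [<-|]; rewrite ?(negPf abcm) mulr0n.
transitivity (\sum_(c <- D) \sum_(a <- D) \sum_(b <- D)
   (coef f a * coef g b * coef h c) *+ (mmul (mmul a b) c == m)).
  under eq_bigr do rewrite exchange_big; rewrite exchange_big /=.
  by apply: eq_bigr.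
rewrite [RHS]exchange_big; apply: eq_bigr => c _.
transitivity (\sum_(e <- D) \sum_(a <- D) \sum_(b <- D)
   (coef f a * coef g b * coef h c) *+ ((mmul a b == e) && (mmul e c == m))).
  rewrite [RHS]exchange_big; apply: eq_bigr => a _.
  rewrite [RHS]exchange_big; apply: eq_bigr => b _ /=.
  have [abcm|abcm] := eqVneq (mmul (mmul a b) c) m.
    rewrite [RHS](bigD1_seq (mmul a b)) //=; last exact: (divisors_cmP abcm).
    rewrite eqxx abcm eqxx mulr1n big1 ?addr0 // => e /negPf ne.
    by rewrite eq_sym ne mulr0n.
  rewrite mulr0n big1 // => e _.
  by case: eqP => [<-|]; rewrite ?(negPf abcm) mulr0n.
apply: eq_bigr => e _; case: eqP => [ecm|_]; last first.
  by rewrite mulr0n big1 // => a _; rewrite big1 // => b _; rewrite andbF.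
rewrite mulr1n (@coef_mul m); last by exists c.
rewrite mulr_suml; apply: eq_bigr => a _; rewrite mulr_suml.
by apply: eq_bigr => b _; rewrite andbT mulrnAl.
Qed.

Lemma fps_1neq0 : fps_one != (0 : fps I A).
Proof.
apply/eqP => /(congr1 (fun f => coef f mone))/eqP.
by rewrite /= eqxx oner_eq0.
Qed.

HB.instance Definition _ :=
  GRing.Zmodule_isComNzRing.Build (fps I A)
    fps_mulA fps_mulC fps_mul1 fps_mulDl fps_1neq0.

Fact fps_scaleA (a b : A) f :
  fps_scale a (fps_scale b f) = fps_scale (a * b) f.
Proof. by apply: fpsP => m /=; rewrite mulrA. Qed.
Fact fps_scale1 : left_id 1 fps_scale.
Proof. by move=> f; apply: fpsP => m /=; rewrite mul1r. Qed.
Fact fps_scaleDr : right_distributive fps_scale +%R.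
Proof. by move=> a f g; apply: fpsP => m /=; rewrite mulrDr. Qed.
Fact fps_scaleDl f : {morph fps_scale^~ f : a b / a + b}.
Proof. by move=> a b; apply: fpsP => m /=; rewrite mulrDl. Qed.

HB.instance Definition _ := GRing.Zmodule_isLmodule.Build A (fps I A)
  fps_scaleA fps_scale1 fps_scaleDr fps_scaleDl.
End FpsRing.

Section FpsOps.
Variables (I : choiceType) (K : fieldType).

Definition fps_mon (m : {cmonom I}) : fps I K := Fps (fun n => (n == m)%:R).

(* Coefficientwise sum of a family.  The finitely supported sum \sum_(_ \in _)
   is 0 by convention on infinite supports; every family summed below is
   locally finite (each monomial occurs in finitely many members), for degree
   reasons, so this convention never comes into play. *)
Definition fps_sum (T : choiceType) (D : set T) (F : T -> fps I K) : fps I K :=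
  Fps (fun m => \sum_(x \in D) coef (F x) m).

(* Meaningful for series with constant term 1. *)
Definition fps_log (Z : fps I K) : fps I K :=
  fps_sum [set n : nat | (0 < n)%N]%classic
    (fun n => ((-1) ^+ n.-1 / n%:R) *: (Z - 1) ^+ n).
End FpsOps.

Local Notation "x %:F" := (@FracField.tofrac _ x).

(* The inner polynomial variable is q^{1/2}, the outer one lambda^{1/2}. *)
Definition ratfun (C : fieldType) := {fraction {poly {poly C}}}.

HB.instance Definition _ (C : fieldType) := GRing.Field.on (ratfun C).

(* p(q^{1/2}, lambda^{1/2}) |-> p(q^{d/2}, lambda^{d/2}) *)
Definition poly_dil (C : fieldType) (d : nat) (p : {poly {poly C}}) :
  {poly {poly C}} := map_poly (comp_poly 'X^d) p \Po 'X^d.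

(* g(q, lambda) |-> g(q^d, lambda^d); for d > 0 this does not depend on the
   chosen fraction since poly_dil d is an injective ring morphism. *)
Definition dilate (C : fieldType) (d : nat) (g : ratfun C) : ratfun C :=
  (poly_dil d \n_(generic_quotient.repr g))%:F /
  (poly_dil d \d_(generic_quotient.repr g))%:F.

Definition is_diagram (s : seq nat) := sorted geq s && (0%N \notin s).

Definition diagram := {s : seq nat | is_diagram s}.

Definition boxes (R : diagram) : nat := sumn (val R).

(* The vector (k_1, k_2, ...) is the element k of {cmonom nat} with
   k i = k_(i+1).  The monoid law mmul of {cmonom nat} is the componentwise
   sum, and mdeg k is |k|. *)
Definition vec := {cmonom nat}.

HB.instance Definition _ := Choice.on vec.

Definition vsize (k : vec) : nat := (\sum_(i <- finsupp k) i.+1 * k i)%N.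

Definition vdil (d : nat) (k : vec) : vec :=
  \big[mmul/mone]_(i <- finsupp k) expcmn (ucm (d * i.+1).-1%N) (k i).

Definition vsum (m : nat) (k : 'I_m -> vec) : vec :=
  \big[mmul/mone]_(j < m) k j.

Definition conj_class (k : vec) : {set 'S_(vsize k)} :=
  [set s : 'S_(vsize k) | [forall i : 'I_(vsize k),
     #|[set c in porbits s | #|c| == i.+1]| == k i]].

Definition class_weight (K : fieldType) (k : vec) : K :=
  #|conj_class k|%:R / ((vsize k)`!)%:R.

(* The boxes of R are numbered from 0 in reading order, row by row;
   reshape_index and reshape_offset give the row and the column of a box. *)
Definition row_group n (R : seq nat) : {set 'S_n} :=
  [set s : 'S_n | [forall x, reshape_index R (s x) == reshape_index R x]].

Definition col_group n (R : seq nat) : {set 'S_n} :=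
  [set s : 'S_n | [forall x, reshape_offset R (s x) == reshape_offset R x]].

(* The irreducible complex character of S_n labelled by a Young diagram R with
   n boxes: the unique one whose representation contains both a nonzero
   invariant of the row group and a nonzero sign-alternating vector of the
   column group, that is, the common irreducible constituent of the induced
   trivial character of the former and the induced sign character of the
   latter.  The two sums are the corresponding multiplicities, up to the order
   of the group.  The one-row diagram labels the trivial character. *)
Definition Iirr_diagram n (R : seq nat) : Iirr [set: 'S_n] :=
  odflt 0 [pick i : Iirr [set: 'S_n] |
    (\sum_(s in row_group n R) 'chi_i s != 0) &&
    (\sum_(s in col_group n R) (-1) ^+ odd_perm s * 'chi_i s != 0)].

(* chi_R(C(k)); the characters of symmetric groups are integer valued, so
   taking the floor only changes the type. *)
Definition chi (R : diagram) (k : vec) : int :=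
  if boxes R == vsize k
  then Num.floor
         ('chi_(Iirr_diagram (vsize k) (val R)) (fingroup.repr (conj_class k)))
  else 0.

(* The variable x^(alpha)_i is indexed by (alpha, i), with i counted from 0. *)
Section SymmetricFunctions.
Variables (L : nat) (K : fieldType).
Implicit Types (alpha : 'I_L).
Local Notation PS := (fps ('I_L * nat)%type K).

Definition xpow alpha (i d : nat) : {cmonom ('I_L * nat)%type} :=
  expcmn (ucm (alpha, i)) d.

(* Tr V_alpha^j, for j > 0 *)
Definition power_sum alpha (j : nat) : PS :=
  fps_sum [set: nat]%classic (fun i => fps_mon K (xpow alpha i j)).

Definition Upsilon (k : vec) alpha : PS :=
  \prod_(i <- finsupp k) power_sum alpha i.+1 ^+ k i.

(* Semistandard tableaux of shape R, as lists of rows. *)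
Definition ssyt (R : seq nat) (T : seq (seq nat)) : bool :=
  [&& map size T == R, all (sorted leq) T &
      sorted (fun r s => all (fun p => p.1 < p.2)%N (zip r s)) T].

(* Tr_R V_alpha^d: the Schur function s_R = \sum_T x^T evaluated at the d-th
   powers of the variables. *)
Definition schur (R : diagram) alpha (d : nat) : PS :=
  fps_sum [set T | ssyt (val R) T]%classic
    (fun T => fps_mon K (\big[mmul/mone]_(e <- flatten T) xpow alpha e d)).
End SymmetricFunctions.

Section Braids.
Variable (I : eqType).
Implicit Types (cs : seq I) (w : seq (nat * bool)) (k : nat).

(* A braid word w is a list of letters (k, e): e = true stands for the
   elementary braid on the strands in positions k and k+1 (counted from 0), and
   e = false for its inverse.  The list cs gives the component to which the
   strand entering the braid in each position belongs; the strands meet the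
   letters of w in the order of the list. *)
Definition swap_at k cs : seq I :=
  if drop k cs is x :: y :: r then take k cs ++ y :: x :: r else cs.

(* \sum_(crossings of alpha with beta) sign: the writhe if alpha = beta, and
   twice the linking number otherwise. *)
Fixpoint crossings (alpha beta : I) cs w : int :=
  if w is (k, e) :: w' then
    (if drop k cs is x :: y :: _ then
       if ((x == alpha) && (y == beta)) || ((x == beta) && (y == alpha))
       then if e then 1 else -1 else 0
     else 0) + crossings alpha beta (swap_at k cs) w'
  else 0.

(* The braid left after removing all strands whose component does not satisfy
   keep; positions are renumbered among the remaining strands. *)
Fixpoint sub_braid (keep : pred I) cs w : seq (nat * bool) :=
  if w is (k, e) :: w' then
    let w'' := sub_braid keep (swap_at k cs) w' in
    if drop k cs is x :: y :: _ then
      if keep x && keep y then (count keep (take k cs), e) :: w'' else w''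
    else w''
  else [::].
End Braids.

Definition braid_perm n (w : seq ('I_n * bool)) : 'S_n.+1 :=
  (\prod_(g <- w) tperm (inord g.1) (inord g.1.+1))%g.

(* An oriented link in S^3 with components numbered by 'I_L, presented as the
   closure of a braid (every oriented link is of this form, by Alexander's
   theorem): two strands belong to the same component iff their entry positions
   are in the same cycle of the permutation of the braid. *)
Record link (L : nat) := Link {
  strands : nat;
  word : seq ('I_strands * bool);
  component : 'I_strands.+1 -> 'I_L;
  component_surj : forall alpha, exists i, component i = alpha;
  component_orbit : forall i j,
    (component i == component j) = (i \in porbit (braid_perm word) j) }.

Definition link_word L (K : link L) : seq (nat * bool) :=
  [seq (val g.1, g.2) | g <- word K].

Definition link_colors L (K : link L) : seq 'I_L :=
  [seq component i | i <- enum 'I_(strands K).+1].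

Section QuantumGroup.
Variables (C : fieldType) (N : nat).

(* All the powers of q^{1/2} below are integral powers of t = q^{1/(2N)}. *)
Local Notation A := {fraction {poly C}}.
Let t : A := ('X : {poly C})%:F.
Let v : A := t ^+ N. (* q^{1/2} *)

(* The simple roots are numbered from 0 to N - 2. *)
Definition cartan (i j : nat) : int :=
  if i == j then 2 else if (i == j.+1) || (j == i.+1) then -1 else 0.

(* N times the inverse Cartan matrix of sl(N). *)
Definition cartan_inv (i j : nat) : int :=
  (minn i.+1 j.+1)%:Z * (N%:Z - (maxn i.+1 j.+1)%:Z).

(* N (a, b), for weights a and b given by their Dynkin labels. *)
Definition pairing (a b : nat -> int) : int :=
  \sum_(i < N.-1) \sum_(j < N.-1) cartan_inv i j * a i * b j.

(* Weights are given by their Dynkin labels; only those at i < N - 1 matter. *)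
Definition weyl : nat -> int := fun=> 1.
Definition hw (R : seq nat) : nat -> int :=
  fun i => (nth 0 R i)%:Z - (nth 0 R i.+1)%:Z.

(* A finite-dimensional module, given by its operators acting on column vectors
   in a weight basis: H_i acts on the b-th basis vector by wt b i. *)
Record qmodule := QModule {
  qdim : nat;
  wt : 'I_qdim -> nat -> int;
  Xp : nat -> 'M[A]_qdim;
  Xm : nat -> 'M[A]_qdim }.

Section Module.
Variable M : qmodule.

Definition Hmx i : 'M[A]_(qdim M) := diag_mx (\row_b (wt b i)%:~R).
(* q^{s H_i / 2} *)
Definition vpow (s : int) i : 'M[A]_(qdim M) :=
  diag_mx (\row_b v ^ (s * wt b i)).

Definition qserre (X : nat -> 'M[A]_(qdim M)) i j : 'M[A]_(qdim M) :=
  if cartan i j == 0 then X i *m X j - X j *m X i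
  else X i *m X i *m X j - (v + v^-1) *: (X i *m X j *m X i)
         + X j *m X i *m X i.

Definition is_Uq_module := forall i j, (i < N.-1)%N -> (j < N.-1)%N ->
  [/\ Hmx i *m Xp M j - Xp M j *m Hmx i = (cartan i j)%:~R *: Xp M j,
      Hmx i *m Xm M j - Xm M j *m Hmx i = - (cartan i j)%:~R *: Xm M j,
      Xp M i *m Xm M j - Xm M j *m Xp M i =
        (if i == j then (v - v^-1)^-1 *: (vpow 1 i - vpow (-1) i) else 0) &
      i != j -> qserre (Xp M) i j = 0 /\ qserre (Xm M) i j = 0].

(* The transposes are there because stablemx is about row spaces. *)
Definition irreducible_module := (0 < qdim M)%N /\
  forall U : 'M[A]_(qdim M),
    (forall i, (i < N.-1)%N ->
       [/\ stablemx U (Hmx i)^T, stablemx U (Xp M i)^T &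
           stablemx U (Xm M i)^T]) ->
    U = 0 \/ row_full U.

Definition has_highest_weight (Lambda : nat -> int) :=
  exists2 u : 'cV[A]_(qdim M), u != 0 & forall i, (i < N.-1)%N ->
    Xp M i *m u = 0 /\ Hmx i *m u = (Lambda i)%:~R *: u.

(* Root vectors of alpha_i + ... + alpha_(i+l) and its opposite, obtained from
   Lusztig's braid group action for the reduced word
   (s_0 s_1 ... s_(N-2)) (s_0 ... s_(N-3)) ... s_0 of the longest element. *)
Fixpoint root_p i l : 'M[A]_(qdim M) :=
  if l is l'.+1
  then v^-1 *: (Xp M (i + l)%N *m root_p i l') - root_p i l' *m Xp M (i + l)%N
  else Xp M i.

Fixpoint root_m i l : 'M[A]_(qdim M) :=
  if l is l'.+1
  then v *: (root_m i l' *m Xm M (i + l)%N) - Xm M (i + l)%N *m root_m i l'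
  else Xm M i.
End Module.

Definition qint (n : nat) : A := (v ^+ n - v ^- n) / (v - v^-1).
Definition qfact (n : nat) : A := \prod_(1 <= i < n.+1) qint i.

(* The convex order of the positive roots given by the same reduced word. *)
Definition pos_roots : seq (nat * nat) :=
  [seq (i, l) | i <- iota 0 N.-1, l <- iota 0 (N.-1 - i)].

(* The universal R-matrix acting on the tensor product of M and M', for the
   coproduct X_i^+ |-> X_i^+ (x) q^{H_i/2} + 1 (x) X_i^+,
   X_i^- |-> X_i^- (x) 1 + q^{-H_i/2} (x) X_i^-.  Root vectors are nilpotent, so
   the exponential series stops; q^{k(k+1)/4} is v^{k(k+1)/2}. *)
Definition Rmatrix (M M' : qmodule) : 'M[A]_(qdim M * qdim M') :=
  diag_mx (\row_b t ^ pairing (wt (mxtens_unindex b).1)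
                              (wt (mxtens_unindex b).2)) *m
  \prod_(r <- pos_roots)
     \sum_(k < (qdim M).+1)
        (v ^+ 'C(k.+1, 2) * (1 - v ^- 2) ^+ k / qfact k) *:
        (root_p M r.1 r.2 ^+ k *t root_m M' r.1 r.2 ^+ k).

Section Trace.
Variables (L : nat) (M : 'I_L -> qmodule).

(* Basis vectors of the modules M alpha.  A vector of the tensor product over
   the strands is a function on lists of basis vectors. *)
Definition qbasis := {alpha : 'I_L & 'I_(qdim (M alpha))}.
Implicit Types (x y : qbasis).

(* Coefficient of x (x) y in the image of y' (x) x' by P R (if e) or its inverse
   (otherwise). *)
Definition Rcheck (e : bool) x y y' x' : A :=
  if (tag x' == tag x) && (tag y' == tag y) then
    if e then
      Rmatrix (M (tag y)) (M (tag x))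
        (mxtens_index (tagged y, tagged x))
        (mxtens_index (tagged_as y y', tagged_as x x'))
    else
      invmx (Rmatrix (M (tag x)) (M (tag y)))
        (mxtens_index (tagged x, tagged y))
        (mxtens_index (tagged_as x x', tagged_as y y'))
  else 0.

Definition letter_act (psi : seq qbasis -> A) (g : nat * bool) :
    seq qbasis -> A := fun s =>
  if drop g.1 s is x :: y :: r then
    \sum_(p : qbasis * qbasis)
       Rcheck g.2 x y p.1 p.2 * psi (take g.1 s ++ p.1 :: p.2 :: r)
  else 0.

Definition braid_act (w : seq (nat * bool)) (psi : seq qbasis -> A) :=
  foldl letter_act psi w.

(* Tr_V(mu^{(x) n} pi(w)), V being the tensor product of the M alpha for alpha
   in cs; mu acts on a vector of weight a by q^{(rho, a)} = t^{2 N (rho, a)}. *)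
Definition quantum_trace (cs : seq 'I_L) (w : seq (nat * bool)) : A :=
  \sum_(s : (size cs).-tuple qbasis | map tag s == cs)
     (\prod_(x <- s) t ^ (2 * pairing weyl (wt (tagged x)))) *
     braid_act w (fun s' => (s' == s)%:R) s.

(* q^{d(L)} Tr_V(mu^{(x) n} pi(w)), for the closure of the braid w *)
Definition quantum_invariant (R : 'I_L -> diagram) cs w : A :=
  t ^ (- (\sum_(alpha < L) crossings alpha alpha cs w *
            pairing (hw (val (R alpha)))
              (fun i => hw (val (R alpha)) i + 2 * weyl i))
       + \sum_(alpha < L) \sum_(beta < L | (alpha < beta)%N)
            crossings alpha beta cs w *
            (boxes (R alpha) * boxes (R beta))%N%:Z) *
  quantum_trace cs w.
End Trace.

(* u is the value of g at q^{1/2} = t^N, lambda^{1/2} = q^{N/2} = t^(N * N). *)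
Definition specializes (g : ratfun C) (u : A) :=
  let ev (p : {poly {poly C}}) : {poly C} :=
    (map_poly (comp_poly 'X^N) p).['X^(N * N)%N] in
  exists n d : {poly {poly C}},
    [/\ ev d != 0, g = n%:F / d%:F & u = (ev n)%:F / (ev d)%:F].
End QuantumGroup.

Definition diagrams (L : nat) := {ffun 'I_L -> diagram}.

Definition ne_diagrams (L : nat) :=
  {R : diagrams L | [exists alpha, val (R alpha) != [::]]}.

(* W is the family of quantum-group invariants of K: for every N and all
   diagrams labelling irreducible representations of sl(N), W_R at
   lambda = q^N is the invariant of the sublink of the components labelled by
   nonempty diagrams.  The value of W at the tuple of empty diagrams is left
   unspecified (and never used). *)
Definition is_quantum_invariant (C : fieldType) L (K : link L)
    (W : diagrams L -> ratfun C) :=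
  forall (R : ne_diagrams L) (N : nat), (1 < N)%N ->
    (forall alpha, size (val (val R alpha)) < N)%N ->
  forall M : 'I_L -> qmodule C,
    (forall alpha, [/\ is_Uq_module N (M alpha),
        irreducible_module N (M alpha) &
        has_highest_weight N (M alpha) (hw (val (val R alpha)))]) ->
  let keep alpha := val (val R alpha) != [::] in
  specializes N (W (val R))
    (quantum_invariant N M (val R)
       (filter keep (link_colors K))
       (sub_braid keep (link_colors K) (link_word K))).

Definition mobius (n : nat) : int :=
  if all (fun p => logn p n == 1%N) (primes n)
  then (-1) ^+ size (primes n) else 0.

Section FreeEnergy.
Variables (C : fieldType) (L : nat) (W : diagrams L -> ratfun C).
Local Notation K := (ratfun C).
Local Notation PS := (fps ('I_L * nat)%type K).
Local Notation vecs := {ffun 'I_L -> vec}.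

Definition nonzero_vecs (k : vecs) := (0 < \sum_alpha mdeg (k alpha))%N.

Definition W_vec (k : vecs) : K :=
  \sum_(R \in [set R : diagrams L |
                 forall alpha, boxes (R alpha) = vsize (k alpha)]%classic)
     (\prod_alpha (chi (R alpha) (k alpha))%:~R) * W R.

Definition partition_function : PS :=
  1 + fps_sum [set k | nonzero_vecs k]%classic (fun k =>
        W_vec k *:
        \prod_alpha (class_weight K (k alpha) *: Upsilon K (k alpha) alpha)).

Definition free_energy : PS := fps_log partition_function.

Definition free_energy_expansion (f : ne_diagrams L -> K) : Prop :=
  free_energy =
  fps_sum [set d : nat | (0 < d)%N]%classic (fun d =>
    fps_sum [set: ne_diagrams L]%classic (fun R =>
      (d%:R^-1 * dilate d (f R)) *:
      \prod_alpha schur K (val R alpha) alpha d)).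

(* The families k^(alpha j) and R_(alpha j). *)
Definition summation_index (m : nat) :=
  ({ffun 'I_m -> vecs} * {ffun 'I_m -> diagrams L})%type.

HB.instance Definition _ m := Choice.on (summation_index m).

Definition admissible m (x : summation_index m) : Prop :=
  (forall j, nonzero_vecs (x.1 j)) /\
  (forall j alpha, boxes (x.2 j alpha) = vsize (x.1 j alpha)).

Definition explicit_term (R : ne_diagrams L) (d m : nat)
    (x : summation_index m) : K :=
  (\prod_alpha
     (chi (val R alpha) (vdil d (vsum (fun j => x.1 j alpha))))%:~R) *
  \prod_j
     ((\prod_alpha (class_weight K (x.1 j alpha) *
                    (chi (x.2 j alpha) (x.1 j alpha))%:~R)) *
      dilate d (W (x.2 j))).

Definition explicit_f (R : ne_diagrams L) : K :=
  \sum_(p \in [set p : nat * nat | (0 < p.1)%N /\ (0 < p.2)%N]%classic)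
    let d := p.1 in let m := p.2 in
    (-1) ^+ m.-1 * ((mobius d)%:~R / (d%:R * m%:R)) *
    \sum_(x \in [set x : summation_index m | admissible x]%classic)
       explicit_term R d x.

(* The triples (d, m, x) giving a nonzero term in explicit_f. *)
Definition explicit_support (R : ne_diagrams L) :
    set {p : nat * nat & summation_index p.2} :=
  fun y => let: existT p x := y in
    [/\ (0 < p.1)%N, (0 < p.2)%N, admissible x & explicit_term R p.1 x != 0].
End FreeEnergy.

(* Main.v *)
(** The formula for f is an inversion of Frobenius' formula
    [Upsilon_k(V^e) = \sum_R chi_R(C(k)) Tr_R V^e].  Expanding log Z in the
    [Upsilon_k] and substituting, the explicit f turns the right-hand side into
    [\sum_k F_k(q^D, lambda^D) Upsilon_k(V^D) \sum_(d | D) mu(d) / D], which only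
    keeps D = 1.  Conversely f is determined by induction on the number of boxes,
    because the terms with d >= 2 involve smaller diagrams only and the Schur
    functions are unitriangular in the monomials.

    Frobenius' formula is Young's rule in disguise: the coefficient of x^mu in
    [Upsilon_k] is the value on C(k) of the permutation character phi_mu of the
    symmetric group on words of content mu.  By Burnside's lemma <phi_mu, phi_nu>
    counts the matrices over nat with row sums mu and column sums nu, and the
    local rule for horizontal strips (the commutation relation behind RSK) shows
    that this number is [\sum_l K_(l,mu) K_(l,nu)], K being the Kostka numbers.
    As K is unitriangular for the dominance order, subtracting from phi_l the
    irreducible characters already found leaves a character of norm 1, whence
    phi_mu = [\sum_l K_(l,mu) chi_l].  The sign-alternating sum of phi_mu over the
    column group of l vanishes unless mu is dominated by l, so chi_l is the only
    common constituent used to define [Iirr_diagram]. *)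
From HB Require Import structures.
From mathcomp Require Import all_boot all_order all_algebra all_fingroup.
From mathcomp Require Import all_field all_character generic_quotient zify ring.
Require Import Defs.

Set Implicit Arguments.
Unset Strict Implicit.
Unset Printing Implicit Defensive.

(** * Shapes, horizontal strips and the local rule *)

Section YoungShapes.
Definition psum (f : nat -> nat) j := \sum_(i < j) f i.

Lemma psumS f j : psum f j.+1 = psum f j + f j.
Proof. by rewrite /psum big_ord_recr. Qed.

Lemma psum0 f : psum f 0 = 0.
Proof. by rewrite /psum big_ord0. Qed.

Lemma psum_recl f j : psum f j.+1 = f 0 + psum (fun i => f i.+1) j.
Proof. by rewrite /psum big_ord_recl. Qed.

Lemma eq_psum f g j : (forall i, i < j -> f i = g i) -> psum f j = psum g j.
Proof. by move=> fg; apply: eq_bigr => i _; apply: fg. Qed.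

Lemma leq_psum f g j : (forall i, i < j -> f i <= g i) -> psum f j <= psum g j.
Proof. by move=> fg; apply: leq_sum => i _; apply: fg. Qed.

Lemma psumD f g j : psum (fun i => f i + g i) j = psum f j + psum g j.
Proof. by rewrite /psum big_split. Qed.

Lemma leq_psum_widen f j k : j <= k -> psum f j <= psum f k.
Proof.
elim: k => [|k IH]; first by rewrite leqn0 => /eqP->.
rewrite leq_eqVlt ltnS => /orP[/eqP->//|/IH/leq_trans]; apply.
by rewrite psumS leq_addr.
Qed.

Lemma leq_psum1 f i j : i < j -> f i <= psum f j.
Proof.
by move=> ij; apply: leq_trans (leq_psum_widen f ij); rewrite psumS leq_addl.
Qed.

Lemma psum_const0 f j k : j <= k -> (forall i, j <= i -> f i = 0) ->
  psum f k = psum f j.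
Proof.
elim: k => [|k IH]; first by rewrite leqn0 => /eqP->.
rewrite leq_eqVlt ltnS => /orP[/eqP->//|jk] f0.
by rewrite psumS IH // f0 // addn0.
Qed.

(* The Young diagrams with at most n boxes, padded with zeros to n.+1 rows, are
   elements of this type: the last row is then always empty. *)
Definition yshape n := {ffun 'I_n.+1 -> 'I_n.+1}.

Definition row n (l : yshape n) (i : nat) : nat :=
  if insub i is Some j then l j else 0.

Definition mkshape n (f : nat -> nat) : yshape n := [ffun i : 'I__ => inord (f i)].

Definition ssize n (l : yshape n) := psum (row l) n.+1.

Section Shapes.
Variable n : nat.
Implicit Types (l m v k : yshape n).

Lemma row_ord l (i : 'I_n.+1) : row l i = l i.
Proof. by rewrite /row valK. Qed.

Lemma row_out l i : n < i -> row l i = 0.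
Proof. by rewrite /row => ni; rewrite insubF // ltnS leqNgt ni. Qed.

Lemma row_mkshape f : (forall i, f i <= n) -> (forall i, n < i -> f i = 0) ->
  row (mkshape n f) =1 f.
Proof.
move=> fn f0 i; have [ni|ni] := leqP i n; last by rewrite row_out ?f0.
by rewrite /row insubT ?ffunE /= ?inordK // ltnS.
Qed.

Lemma shapeP l m : row l =1 row m -> l = m.
Proof.
by move=> lm; apply/ffunP => i; apply: val_inj; rewrite /= -!row_ord.
Qed.

Lemma ssize_psum l j : n < j -> psum (row l) j = ssize l.
Proof. by move=> nj; apply: psum_const0 => // i; apply: row_out. Qed.

(** Interlacing of the rows says that the skew shape l/m has at most one box in each column; it
    forces both shapes to be partitions. *)
Definition hstrip a l m :=
  [forall i : 'I_n.+1, (row m i <= row l i) && (row l i.+1 <= row m i)]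
  && (ssize l == ssize m + a).

Lemma hstripP a l m : reflect
  [/\ forall i, row m i <= row l i, forall i, row l i.+1 <= row m i &
      ssize l = ssize m + a] (hstrip a l m).
Proof.
apply: (iffP andP) => [[/forallP h /eqP ->]|[h1 h2 ->]]; last first.
  by split=> //; apply/forallP => i; rewrite h1 h2.
have {}h i : (row m i <= row l i) && (row l i.+1 <= row m i).
  have [ni|ni] := leqP i n; first by have := h (Ordinal (ni : i < n.+1)).
  by rewrite !row_out // ltnS ltnW.
by split=> // i; case/andP: (h i).
Qed.

Definition antitone l := [forall i : 'I_n.+1, row l i.+1 <= row l i].

Lemma antitoneP l : reflect (forall i, row l i.+1 <= row l i) (antitone l).
Proof.
apply: (iffP forallP) => h i; last exact: h.
have [ni|ni] := leqP i n; first by have := h (Ordinal (ni : i < n.+1)).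
by rewrite !row_out // ltnS ltnW.
Qed.

Lemma antitone_leq l i j : antitone l -> i <= j -> row l j <= row l i.
Proof.
move=> /antitoneP al; elim: j => [|j IH]; first by rewrite leqn0 => /eqP->.
by rewrite leq_eqVlt ltnS => /orP[/eqP->//|/IH]; apply: leq_trans.
Qed.

Lemma hstrip_antitone a l m : hstrip a l m -> antitone l && antitone m.
Proof.
case/hstripP => h1 h2 _; apply/andP; split; apply/antitoneP => i.
  exact: leq_trans (h2 i) (h1 i).
exact: leq_trans (h1 _) (h2 i).
Qed.

(** A nonzero last row would make all [n.+1] rows nonzero, hence give more than n boxes. *)
Lemma antitone_last l : antitone l -> ssize l <= n -> row l n = 0.
Proof.
move=> al; apply: contraTeq; rewrite -lt0n -ltnNge => ln.
suff: psum (fun=> 1) n.+1 <= ssize l by rewrite /psum sum1_card card_ord.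
by apply: leq_psum => i; rewrite ltnS => /(antitone_leq al); apply: leq_trans.
Qed.

Lemma row_leq_ssize l i : row l i <= ssize l.
Proof.
have [ni|ni] := leqP i n; last by rewrite row_out.
exact: leq_psum1.
Qed.

Section LocalRule.
Variables l m : yshape n.
Let lo i := minn (row l i) (row m i).
Let hi i := maxn (row l i) (row m i).

(** In every row [lo i + hi i] is the sum of the two rows, and the reflection pairs [lo] with [hi]
    shifted by one row, so only boundary terms survive the summation. This identity supplies the
    sizes of the strips on both sides of the bijection. *)
Lemma psum_reflect (v k : nat -> nat) : v n.+1 = 0 ->
  (forall i, i <= n -> k i + v i.+1 = lo i + hi i.+1) ->
  psum k n.+1 + psum v n.+1 + hi 0 = ssize l + ssize m + v 0.
Proof.
move=> v0 kv.
have hi0 : hi n.+1 = 0 by rewrite /hi !row_out.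
have E1 : psum v n.+1 = v 0 + psum (fun i => v i.+1) n.+1.
  by have := psum_recl v n.+1; rewrite psumS v0 addn0.
have E2 : psum hi n.+1 = hi 0 + psum (fun i => hi i.+1) n.+1.
  by have := psum_recl hi n.+1; rewrite psumS hi0 addn0.
have E3 : psum k n.+1 + psum (fun i => v i.+1) n.+1 =
          psum lo n.+1 + psum (fun i => hi i.+1) n.+1.
  by rewrite -!psumD; apply: eq_psum => i; rewrite ltnS; apply: kv.
have E4 : psum lo n.+1 + psum hi n.+1 = ssize l + ssize m.
  by rewrite -!psumD; apply: eq_psum => i _; rewrite /lo /hi addn_min_max.
lia.
Qed.

(* The rows v_(i+1) and k_i determine each other by reflection in the interval
   [hi_(i+1), lo_i]; the excess v_0 - hi_0 is the remaining parameter c. *)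
Definition reflect_up (p : 'I_n.+1 * yshape n) : yshape n :=
  mkshape n (fun j => if j is i.+1 then lo i + hi i.+1 - row p.2 i
                      else hi 0 + p.1).

Definition reflect_down v : 'I_n.+1 * yshape n :=
  (inord (row v 0 - hi 0), mkshape n (fun i => lo i + hi i.+1 - row v i.+1)).

Variables a b : nat.
Hypothesis size_la : ssize l + a <= n.

(** Interlacing places row i+1 of v between [hi i.+1] and [lo i], so its reflection interlaces with
    l and m from below. The excess of row 0 over [hi 0] consists of boxes of both strips, whence the
    bounds by a and b. By [size_la] no row exceeds n, so [inord] alters nothing. *)
Lemma reflect_downP v : hstrip a v l && hstrip b v m ->
  let p := reflect_down v in
  [/\ p.1 <= a, p.1 <= b, hstrip (b - p.1) l p.2, hstrip (a - p.1) m p.2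
    & reflect_up p = v].
Proof.
case/andP => /hstripP[lv vl sv] /hstripP[mv vm sv'] p.
have hv i : hi i <= row v i by rewrite /hi geq_max lv mv.
have vlo i : row v i.+1 <= lo i by rewrite /lo leq_min vl vm.
have lol i : lo i <= row l i by rewrite /lo geq_minl.
have lom i : lo i <= row m i by rewrite /lo geq_minr.
have lhi i : row l i <= hi i by rewrite /hi leq_maxl.
have mhi i : row m i <= hi i by rewrite /hi leq_maxr.
have vn i : row v i <= n by apply: leq_trans (row_leq_ssize v i) _; rewrite sv.
have rk i : row p.2 i = lo i + hi i.+1 - row v i.+1.
  rewrite row_mkshape // => {}i.
    by have := hv i.+1; have := vn i; have := lol i; have := lv i; lia.
  move=> ni; have := vlo i; have := hv i.+1.
  by rewrite /lo /hi !row_out //; lia.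
have p1 : p.1 = row v 0 - hi 0 :> nat.
  by rewrite /= inordK //; have := vn 0; lia.
have key : ssize p.2 + ssize v + hi 0 = ssize l + ssize m + row v 0.
  apply: psum_reflect; first by rewrite row_out.
  by move=> i _; rewrite rk; have := hv i.+1; have := vlo i; lia.
have v0a : row v 0 - hi 0 <= a.
  have : ssize l + (row v 0 - row l 0) <= ssize v.
    rewrite /ssize !psum_recl.
    have := @leq_psum (fun i => row l i.+1) (fun i => row v i.+1) n.
    by move=> /(_ (fun i _ => lv _)); have := lv 0; lia.
  have := lhi 0; lia.
have v0b : row v 0 - hi 0 <= b.
  have : ssize m + (row v 0 - row m 0) <= ssize v.
    rewrite /ssize !psum_recl.
    have := @leq_psum (fun i => row m i.+1) (fun i => row v i.+1) n.
    by move=> /(_ (fun i _ => mv _)); have := mv 0; lia.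
  have := mhi 0; lia.
have h0 := hv 0.
split; rewrite ?p1 //.
- apply/hstripP; split => [i|i|]; last lia.
    by rewrite rk; have := hv i.+1; have := lol i; have := vlo i; lia.
  by rewrite rk; have := vlo i; have := lhi i.+1; lia.
- apply/hstripP; split => [i|i|]; last lia.
    by rewrite rk; have := hv i.+1; have := lom i; have := vlo i; lia.
  by rewrite rk; have := vlo i; have := mhi i.+1; lia.
- apply: shapeP => j.
  have E i : (if i is i'.+1 then lo i' + hi i'.+1 - row p.2 i'
                      else hi 0 + p.1) = row v i.
    case: i => [|i]; first by rewrite p1; lia.
    by rewrite rk; have := vlo i; have := hv i.+1; lia.
  rewrite /reflect_up row_mkshape ?E // => i; rewrite E //; exact: row_out.
Qed.

Lemma reflect_upP (p : 'I_n.+1 * yshape n) :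
  [&& p.1 <= a, p.1 <= b, hstrip (b - p.1) l p.2 & hstrip (a - p.1) m p.2] ->
  [/\ hstrip a (reflect_up p) l, hstrip b (reflect_up p) m &
      reflect_down (reflect_up p) = p].
Proof.
case: p => c k /= /and4P[ca cb hl hm].
have /andP[al _] := hstrip_antitone hl; have /andP[am _] := hstrip_antitone hm.
have /hstripP[kl lk sk] := hl; have /hstripP[km mk sk'] := hm.
have kk i : k i = row k i :> nat by rewrite row_ord.
have hk i : hi i.+1 <= row k i by rewrite /hi geq_max lk mk.
have klo i : row k i <= lo i by rewrite /lo leq_min kl km.
have lol i : lo i <= row l i by rewrite /lo geq_minl.
have lom i : lo i <= row m i by rewrite /lo geq_minr.
have lhi i : row l i <= hi i by rewrite /hi leq_maxl.
have mhi i : row m i <= hi i by rewrite /hi leq_maxr.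
pose f j := if j is i.+1 then lo i + hi i.+1 - row k i else hi 0 + c.
(* Row [n.+1] of the new shape would be [lo n - row k n]; it vanishes because row n of l is
   empty. *)
have ln : row l n = 0 by apply: antitone_last => //; lia.
have f0 i : n < i -> f i = 0.
  case: i => // i; rewrite ltnS /f leq_eqVlt => /orP[/eqP<-|ni].
    have : row l n = 0 := ln.
    by have := klo n; have := lol n; rewrite /hi !(row_out _ (ltnSn n)); lia.
  by rewrite /lo /hi !row_out // ltnS ltnW.
have key : ssize k + psum f n.+1 + hi 0 = ssize l + ssize m + (hi 0 + c).
  apply: psum_reflect; first exact: f0.
  by move=> i _; rewrite /f; have := hk i; have := klo i; lia.
have fn i : f i <= n.
  have [ni|ni] := leqP i n; last by rewrite f0.
  by apply: leq_trans (leq_psum1 f (ni : i < n.+1)) _; lia.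
have fr : row (reflect_up (c, k)) =1 f by apply: row_mkshape.
have fs : ssize (reflect_up (c, k)) = psum f n.+1.
  by apply: eq_psum => i _; exact: fr.
split.
- apply/hstripP; split=> [i|i|]; rewrite ?fr ?fs.
  + case: i => [|i]; rewrite /f; first by have := lhi 0; lia.
    by have := klo i; have := lhi i.+1; lia.
  + by rewrite /f; have := hk i; have := lol i; lia.
  + lia.
- apply/hstripP; split=> [i|i|]; rewrite ?fr ?fs.
  + case: i => [|i]; rewrite /f; first by have := mhi 0; lia.
    by have := klo i; have := mhi i.+1; lia.
  + by rewrite /f; have := hk i; have := lom i; lia.
  + lia.
- congr (_, _).
    by apply: val_inj; rewrite /= fr /f addnC addnK inordK.
  apply: shapeP => j.
  have E i : lo i + hi i.+1 - row (reflect_up (c, k)) i.+1 = row k i.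
    by rewrite fr /f; have := klo i; have := hk i; lia.
  rewrite row_mkshape ?E // => i; rewrite E; last exact: row_out.
  by apply: leq_trans (row_leq_ssize _ _) _; lia.
Qed.

(** For symmetric functions this is the commutation of multiplication by h_a with the adjoint of
    multiplication by h_b: the latter composed with the former is the sum over c of h_(a-c) times
    the adjoint of h_(b-c). The parameter c counts the boxes of the first row of v beyond both l and
    m. *)
Lemma hstrip_local_rule :
  \sum_(v | hstrip a v l && hstrip b v m) 1 =
  \sum_(c < n.+1 | (c <= a) && (c <= b))
     \sum_(k | hstrip (b - c) l k && hstrip (a - c) m k) 1.
Proof.
rewrite (reindex_onto reflect_up reflect_down) => [|v]; last first.
  by case/reflect_downP.
rewrite pair_big_dep /=; apply: eq_bigl => p; rewrite -[RHS]andbA.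
apply/idP/idP => [/andP[hp /eqP E]|hp].
  by have := reflect_downP hp; cbv zeta; rewrite E => -[-> -> -> ->].
by have [-> -> ->] := reflect_upP hp; rewrite eqxx.
Qed.
End LocalRule.
End Shapes.
End YoungShapes.

(** * Kostka numbers and Cauchy's identity *)

Section KostkaNumbers.
Lemma widen_lift r (j : 'I_r) : widen_ord (leqnSn r) j = lift ord_max j.
Proof. by apply: val_inj; rewrite /= /bump leqNgt ltn_ord. Qed.

Section FfunSnoc.
Variables (T : finType) (r : nat).

Definition fsnoc (g : {ffun 'I_r -> T}) (t : T) : {ffun 'I_r.+1 -> T} :=
  [ffun i => if unlift ord_max i is Some j then g j else t].

Lemma fsnoc_max g t : fsnoc g t ord_max = t.
Proof. by rewrite ffunE unlift_none. Qed.

Lemma fsnoc_lift g t j : fsnoc g t (widen_ord (leqnSn r) j) = g j.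
Proof.
by rewrite widen_lift ffunE liftK.
Qed.

Lemma sum_ffun_recr (P : pred {ffun 'I_r.+1 -> T}) (F : _ -> nat) :
  \sum_(f | P f) F f = \sum_t \sum_(g | P (fsnoc g t)) F (fsnoc g t).
Proof.
pose h (p : T * {ffun 'I_r -> T}) := fsnoc p.2 p.1.
pose h' (f : {ffun 'I_r.+1 -> T}) := (f ord_max, [ffun j => f (lift ord_max j)]).
rewrite pair_big_dep (reindex h); last first.
  exists h' => [[t g] _|f _]; rewrite /h /h' /=.
    rewrite ffunE unlift_none; congr (_, _); apply/ffunP => j.
    by rewrite !ffunE liftK.
  apply/ffunP => i; rewrite ffunE; case: unliftP => [j|] -> //.
  by rewrite ffunE.
by apply: eq_bigr => -[].
Qed.
End FfunSnoc.

Definition ext n r (f : {ffun 'I_r -> 'I_n.+1}) (i : nat) : nat :=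
  if insub i is Some j then f j else 0.

Section Kostka.
Variable n : nat.
Implicit Types (l m k : yshape n) (mu nu : nat -> nat).

Lemma ext_ord r (f : {ffun 'I_r -> 'I_n.+1}) (i : 'I_r) : ext f i = f i.
Proof. by rewrite /ext valK. Qed.

Lemma ext_snoc r (g : {ffun 'I_r -> 'I_n.+1}) t i :
  i < r -> ext (fsnoc g t) i = ext g i.
Proof.
move=> ir; have := ext_ord (fsnoc g t) (widen_ord (leqnSn r) (Ordinal ir)).
by rewrite fsnoc_lift -ext_ord /=.
Qed.

Lemma ext_snoc_max r (g : {ffun 'I_r -> 'I_n.+1}) t : ext (fsnoc g t) r = t.
Proof. by have := ext_ord (fsnoc g t) ord_max; rewrite fsnoc_max. Qed.

Definition shape0 : yshape n := [ffun=> ord0].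

Lemma row_shape0 i : row shape0 i = 0.
Proof. by rewrite /row; case: insub => // j; rewrite ffunE. Qed.

Lemma ssize_shape0 : ssize shape0 = 0.
Proof. by rewrite /ssize /psum big1 // => i _; apply: row_shape0. Qed.

(* The number of semistandard tableaux of shape l with entries smaller than r
   and mu i entries equal to i, counted by removing the largest entries. *)
Fixpoint kostka (r : nat) mu l : nat :=
  if r is r'.+1 then \sum_(k | hstrip (mu r') l k) kostka r' mu k
  else l == shape0.

Lemma eq_kostka r mu nu l : (forall i, i < r -> mu i = nu i) ->
  kostka r mu l = kostka r nu l.
Proof.
elim: r l => // r IH l mn /=; rewrite mn //.
by apply: eq_bigr => k _; apply: IH => i ir; apply: mn; rewrite ltnS ltnW.
Qed.

Lemma kostka_ssize r mu l : kostka r mu l != 0 -> ssize l = psum mu r.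
Proof.
elim: r l => [|r IH] l /=.
  by rewrite eqb0 negbK => /eqP->; rewrite ssize_shape0 psum0.
rewrite sum_nat_eq0 => /forallPn[k]; rewrite negb_imply => /andP[].
by case/hstripP => _ _ ->; rewrite psumS => /IH->.
Qed.

Lemma hstrip_shape0 a k : hstrip a shape0 k = (k == shape0) && (a == 0).
Proof.
apply/hstripP/andP => [[k0 _]|[/eqP-> /eqP->]].
  rewrite ssize_shape0 => /esym/eqP; rewrite addn_eq0 => /andP[_ ->]; split=> //.
  apply/eqP/shapeP => i; apply/eqP; rewrite row_shape0 -leqn0.
  by apply: leq_trans (k0 i) _; rewrite row_shape0.
by rewrite addn0; split=> // i; rewrite !row_shape0.
Qed.

Lemma kostka_shape0 r mu : kostka r mu shape0 = [forall i : 'I_r, mu i == 0].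
Proof.
elim: r => [|r IH] /=; first by rewrite eqxx; case: forallP => // -[] [].
under eq_bigl do rewrite hstrip_shape0.
have [r0|r0] := boolP (mu r == 0).
  under eq_bigl do rewrite andbT.
  rewrite big_pred1_eq IH; congr nat_of_bool.
  apply/forallP/forallP => h i; last exact: (h (widen_ord (leqnSn r) i)).
  have [ir|ri] := ltnP i r; first exact: (h (Ordinal ir)).
  by have /eqP-> : i == r :> nat by rewrite eqn_leq ri -ltnS ltn_ord.
rewrite big_pred0 ?(rwP eqP); last by move=> k; rewrite andbF.
by case: forallP => // /(_ ord_max); rewrite (negPf r0).
Qed.

Definition subcontent r mu b (beta : {ffun 'I_r -> 'I_n.+1}) :=
  [forall i : 'I_r, beta i <= mu i] && (\sum_i beta i == b :> nat).

Lemma subcontent_snoc r mu b (g : {ffun 'I_r -> 'I_n.+1}) (t : 'I_n.+1) :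
  subcontent mu b (fsnoc g t) =
  [&& t <= mu r, t <= b & subcontent mu (b - t) g].
Proof.
rewrite /subcontent; have -> : \sum_i fsnoc g t i = \sum_i g i + t :> nat.
  rewrite big_ord_recr fsnoc_max /=; congr (_ + _).
  by apply: eq_bigr => i _; rewrite fsnoc_lift.
have -> : [forall i : 'I_r.+1, fsnoc g t i <= mu i] =
          [forall i : 'I_r, g i <= mu i] && (t <= mu r).
  apply/forallP/andP => [h|[/forallP h tr] i].
    split; last by have := h ord_max; rewrite fsnoc_max.
    by apply/forallP => i; have := h (widen_ord (leqnSn r) i); rewrite fsnoc_lift.
  rewrite ffunE; case: unliftP => [j|] -> //.
  by rewrite -widen_lift; apply: h.
case: (t <= mu r); rewrite ?andbF ?andbT //=.
rewrite [RHS]andbCA; congr andb.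
have [tb|tb] := leqP t b; first by rewrite -{1}(subnK tb) eqn_add2r.
by rewrite gtn_eqF // (leq_trans tb) // leq_addl.
Qed.

(** The adjoint of multiplication by h_b, applied to the product of the h_(mu i), lowers mu by every
    vector beta of sum b. In the induction the local rule moves the strip of size b past the strip
    of the last letter, and its parameter c becomes the last entry of beta. *)
Lemma kostka_pieri r mu k b : psum mu r <= n ->
  \sum_(l | hstrip b l k) kostka r mu l =
  \sum_(beta : {ffun 'I_r -> 'I_n.+1} | subcontent mu b beta)
     kostka r (fun i => mu i - ext beta i) k.
Proof.
elim: r mu k b => [|r IH] mu k b mun.
  have P0 (beta : {ffun 'I_0 -> 'I_n.+1}) : subcontent mu b beta = (b == 0).
    by rewrite /subcontent big_ord0 eq_sym; case: forallP => // -[] [].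
  under [RHS]eq_bigl do rewrite P0.
  rewrite big_mkcond (bigD1 shape0) //= eqxx big1 ?addn0; last first.
    by move=> l /negPf->; case: ifP.
  rewrite hstrip_shape0.
  have [b0 /=|_ /=] := eqVneq b 0; last by rewrite andbF big_pred0.
  rewrite andbT sum_nat_const.
  rewrite (_ : #|_| = 1) ?mul1n; first by case: eqP.
  by rewrite (eq_card (B := predT)) // card_ffun !card_ord expn0.
have munr : psum mu r + mu r <= n by rewrite -psumS.
rewrite [RHS]sum_ffun_recr /=.
transitivity (\sum_(k' : yshape n) kostka r mu k' *
    \sum_(l | hstrip (mu r) l k' && hstrip b l k) 1).
  rewrite (exchange_big_dep xpredT) //=; apply: eq_bigr => k' _.
  rewrite big_distrr /=; under [RHS]eq_bigr do rewrite muln1.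
  by apply: eq_bigl => l; rewrite andbC.
transitivity (\sum_(k' : yshape n) kostka r mu k' *
  \sum_(t < n.+1 | (t <= mu r) && (t <= b))
     \sum_(j | hstrip (b - t) k' j && hstrip (mu r - t) k j) 1).
  apply: eq_bigr => k' _; have [->//|/kostka_ssize k's] := eqVneq (kostka r mu k') 0.
  by rewrite (@hstrip_local_rule n k' k (mu r) b) // k's.
under [LHS]eq_bigr do rewrite big_distrr /=.
rewrite (exchange_big_dep xpredT) //=.
apply: eq_bigr => t _; under [RHS]eq_bigl do rewrite subcontent_snoc.
have [/andP[tr tb]|/negPf ntb] := boolP ((t <= mu r) && (t <= b)); last first.
  by rewrite !big_pred0 // => g; rewrite andbA ntb.
under [LHS]eq_bigr do rewrite big_distrr /=.
rewrite (exchange_big_dep (fun j => hstrip (mu r - t) k j)) /=; last first.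
  by move=> ? ? _ /andP[].
rewrite tr tb /= [RHS](exchange_big_dep (fun j => hstrip (mu r - t) k j)) /=; last first.
  by move=> g j _; rewrite ext_snoc_max.
apply: eq_bigr => j kj; under eq_bigl do rewrite kj andbT.
under eq_bigr do rewrite muln1.
rewrite IH; last lia.
apply: eq_big => [g|g _]; first by rewrite ext_snoc_max kj andbT.
by apply: eq_kostka => i ir; rewrite ext_snoc.
Qed.

Definition is_content_matrix r p mu nu
    (M : {ffun 'I_p -> {ffun 'I_r -> 'I_n.+1}}) :=
  [forall i : 'I_r, \sum_j M j i == mu i :> nat] &&
  [forall j : 'I_p, \sum_i M j i == nu j :> nat].

(** Cauchy's identity, coefficient by coefficient. Removing the last letter of nu by [kostka_pieri]
    produces a vector beta, which is the last column of M; what it leaves of mu is the content of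
    the other columns. *)
Lemma kostka_cauchy r p mu nu : psum mu r <= n ->
  \sum_l kostka r mu l * kostka p nu l =
  \sum_(M : {ffun 'I_p -> {ffun 'I_r -> 'I_n.+1}} | is_content_matrix mu nu M) 1.
Proof.
elim: p r mu => [|p IH] r mu mun.
  rewrite (bigD1 shape0) //= eqxx muln1 big1 ?addn0; last first.
    by move=> l /negPf->; rewrite muln0.
  have P0 (M : {ffun 'I_0 -> {ffun 'I_r -> 'I_n.+1}}) :
      is_content_matrix mu nu M = [forall i : 'I_r, mu i == 0].
    rewrite /is_content_matrix andbC.
    have -> /= : [forall j : 'I_0, \sum_i M j i == nu j :> nat].
      by apply/forallP => -[].
    by apply: eq_forallb => i; rewrite big_ord0 eq_sym.
  under eq_bigl do rewrite P0.
  rewrite kostka_shape0; case: forallP => _; last by rewrite big_pred0.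
  by rewrite sum1_card (eq_card (B := predT)) // card_ffun !card_ord expn0.
rewrite [RHS]sum_ffun_recr /=.
under [LHS]eq_bigr do rewrite big_distrr /=.
rewrite (exchange_big_dep xpredT) //=.
transitivity (\sum_k kostka p nu k *
   \sum_(beta : {ffun 'I_r -> 'I_n.+1} | subcontent mu (nu p) beta)
     kostka r (fun i => mu i - ext beta i) k).
  apply: eq_bigr => k _; rewrite -kostka_pieri // big_distrr /=.
  by apply: eq_bigr => l _; rewrite mulnC.
under [LHS]eq_bigr do rewrite big_distrr /=.
rewrite (exchange_big_dep xpredT) //=; apply: eq_bigr => t _.
have csum i (M : {ffun 'I_p -> {ffun 'I_r -> 'I_n.+1}}) :
    \sum_j fsnoc M t j i = \sum_j M j i + t i :> nat.
  rewrite big_ord_recr fsnoc_max /=; congr (_ + _).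
  by apply: eq_bigr => j _; rewrite fsnoc_lift.
have E (M : {ffun 'I_p -> {ffun 'I_r -> 'I_n.+1}}) :
    is_content_matrix mu nu (fsnoc M t) = subcontent mu (nu p) t &&
    is_content_matrix (fun i => mu i - ext t i) nu M.
  apply/andP/andP => [[/forallP h1 /forallP h2]|
                     [/andP[/forallP h1 h2] /andP[/forallP h3 /forallP h4]]].
    split; apply/andP; split.
    - by apply/forallP => i; rewrite -(eqP (h1 i)) csum leq_addl.
    - by have := h2 ord_max; under eq_bigr do rewrite fsnoc_max.
    - by apply/forallP => i; rewrite -(eqP (h1 i)) csum ext_ord addnK.
    - apply/forallP => j; have := h2 (widen_ord (leqnSn p) j).
      by under eq_bigr do rewrite fsnoc_lift.
  split; apply/forallP => i.
    by rewrite csum (eqP (h3 i)) ext_ord subnK.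
  have [j ->|->] := unliftP ord_max i.
    rewrite -widen_lift.
    by under eq_bigr do rewrite fsnoc_lift.
  by under eq_bigr do rewrite fsnoc_max.
under [RHS]eq_bigl do rewrite E.
have [st /=|_] := boolP (subcontent mu (nu p) t); last by rewrite !big_pred0.
rewrite -IH.
  by apply: eq_bigr => l _; rewrite mulnC.
by apply: leq_trans mun; apply: leq_psum => i _; apply: leq_subr.
Qed.
End Kostka.
End KostkaNumbers.

(** * Unitriangularity for the dominance order *)

Section DominanceOrder.
Lemma psum_eq_leq f g j : (forall i, i < j -> f i <= g i) ->
  psum g j <= psum f j -> forall i, i < j -> f i = g i.
Proof.
elim: j => // j IH fg; rewrite !psumS => sgf i.
have fgj : forall i, i < j -> f i <= g i by move=> ? /ltnW; apply: fg.
have := leq_psum fgj; have := fg j (ltnSn j) => fgj1 s.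
rewrite ltnS leq_eqVlt => /orP[/eqP->|]; first lia.
by apply: IH => //; lia.
Qed.

Section Dominance.
Variable n : nat.
Implicit Types (l m k : yshape n) (mu nu : nat -> nat).

(** The letters smaller than j fill a subshape with at most j rows. *)
Lemma kostka_dom r mu k : kostka r mu k != 0 ->
  (forall i, r <= i -> row k i = 0) /\
  (forall j, j <= r -> psum mu j <= psum (row k) j).
Proof.
elim: r k => [|r IH] k kn.
  move: kn; rewrite /= eqb0 negbK => /eqP->; split=> [i _|j].
    exact: row_shape0.
  by rewrite leqn0 => /eqP->; rewrite !psum0.
have sk := kostka_ssize kn; move: kn => /=.
rewrite sum_nat_eq0 => /forallPn[m]; rewrite negb_imply => /andP[].
case/hstripP => mk km _ /IH[m0 mum]; have k0 i : r.+1 <= i -> row k i = 0.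
  by case: i => // i; rewrite ltnS => /m0 mi; have := km i; rewrite mi leqn0 => /eqP.
split=> // j; rewrite leq_eqVlt ltnS => /orP[/eqP->|jr].
  rewrite -sk; have [rn|rn] := leqP r n.
    by rewrite /ssize (@psum_const0 _ r.+1).
  by rewrite ssize_psum // ltnW.
by apply: leq_trans (mum _ jr) _; apply: leq_psum => i _; apply: mk.
Qed.

(** The only filling puts the letter i throughout row i: after removal of the largest letter, the
    rows are bounded by the first r entries of mu and have the same sum, so the remaining shape must
    be [k0], that is l without its last row. *)
Lemma kostka_diag r mu l : (forall i, mu i.+1 <= mu i) ->
  (forall i, row l i = if i < r then mu i else 0) -> kostka r mu l = 1.
Proof.
move=> amu; elim: r l => [|r IH] l rl /=.
  by rewrite (_ : l = shape0 n) ?eqxx //; apply: shapeP => i; rewrite rl row_shape0.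
pose k0 := mkshape n (fun i => if i < r then mu i else 0).
have rk0 i : row k0 i = if i < r then mu i else 0.
  have H j : (if j < r then mu j else 0) = if j < r then row l j else 0.
    by case: ifP => // jr; rewrite rl ltnS (ltnW jr).
  rewrite /k0 row_mkshape //= => j; rewrite H; case: ifP => // _.
    by have [jn|jn] := leqP j n; [rewrite /row insubT -ltnS ltn_ord|rewrite row_out].
  by move=> jn; rewrite row_out.
have sl : ssize l = psum mu r + mu r.
  have [rn|rn] := leqP r n.
    rewrite -psumS /ssize (@psum_const0 _ r.+1) //; last first.
      by move=> i ri; rewrite rl ltnNge ri.
    by apply: eq_psum => i ir; rewrite rl ir.
  rewrite -(@ssize_psum _ l r.+1) 1?ltnW // psumS rl ltnSn; congr addn.
  by apply: eq_psum => i ir; rewrite rl ltnS (ltnW ir).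
have sk : ssize k0 = psum mu r.
  have [rn|rn] := leqP r n.+1.
    rewrite /ssize (@psum_const0 _ r) //; last first.
      by move=> i ri; rewrite rk0 ltnNge ri.
    by apply: eq_psum => i ir; rewrite rk0 ir.
  rewrite -(@ssize_psum _ k0 r) 1?ltnW //.
  by apply: eq_psum => i ir; rewrite rk0 ir.
rewrite (bigD1 k0) /=; last first.
  apply/hstripP; split=> [i|i|]; last by rewrite sk.
    by rewrite rl rk0; case: (ltnP i r) => // ir; rewrite ltnS (ltnW ir).
  by rewrite rl rk0 ltnS; case: ifP.
rewrite IH // big1 // => k /andP[/hstripP[kl _ _]]; apply: contraNeq => kn.
have sk' := kostka_ssize kn; have [k0r _] := kostka_dom kn.
apply/eqP/shapeP => i; rewrite rk0; case: ltnP => [ir|]; last exact: k0r.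
apply: (@psum_eq_leq (row k) mu r) => // [j jr|].
  by have := kl j; rewrite rl ltnS (ltnW jr).
rewrite -sk'; have [rn|rn] := leqP r n.+1.
  by rewrite /ssize (@psum_const0 _ r).
by rewrite (ssize_psum k) // ltnW.
Qed.

(* Strictly decreasing along the dominance order, hence a height function for
   inductions over it. *)
Definition shape_key l := psum (fun j => n - psum (row l) j) n.+2.

(** Every summand of the key decreases in the corresponding partial sum, so keys in the wrong order
    force equality of all partial sums. The bound on [ssize k] prevents the subtractions from
    truncating. *)
Lemma dominance_key k l : ssize k <= n ->
  (forall j, j <= n.+1 -> psum (row l) j <= psum (row k) j) ->
  k = l \/ shape_key k < shape_key l.
Proof.
move=> kn kl; have [|klk] := ltnP (shape_key k) (shape_key l); first by right.
left; have E j : j < n.+2 -> psum (row k) j = psum (row l) j.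
  move=> jn; have h : n - psum (row k) j = n - psum (row l) j.
    apply: (@psum_eq_leq (fun j => n - psum (row k) j)
                         (fun j => n - psum (row l) j) n.+2) => // i ni.
    exact/leq_sub2l/kl.
  have := kl j jn; have := leq_psum_widen (row k) (jn : j <= n.+1).
  by rewrite -/(ssize k); lia.
apply: shapeP => i; have [ni|ni] := leqP i n; last by rewrite !row_out.
have e1 : psum (row k) i = psum (row l) i by apply: E; lia.
by have := E i.+1; rewrite !psumS e1 => /(_ ni)/eqP; rewrite eqn_add2l => /eqP.
Qed.

Lemma kostka_key k l : ssize l <= n -> kostka n.+1 (row l) k != 0 ->
  k = l \/ shape_key k < shape_key l.
Proof.
move=> ln kn; apply: dominance_key; first by rewrite (kostka_ssize kn).
by case: (kostka_dom kn).
Qed.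

Lemma kostka_row l : antitone l -> kostka n.+1 (row l) l = 1.
Proof.
move=> /antitoneP al; apply: kostka_diag => // i; rewrite ltnS.
by case: leqP => // ni; rewrite row_out.
Qed.

Lemma kostka_antitone r mu l : kostka r mu l != 0 -> antitone l.
Proof.
case: r => [|r] /=.
  by rewrite eqb0 negbK => /eqP->; apply/antitoneP => i; rewrite !row_shape0.
rewrite sum_nat_eq0 => /forallPn[m]; rewrite negb_imply => /andP[].
by case/hstrip_antitone/andP.
Qed.
End Dominance.
End DominanceOrder.

Arguments kostka : simpl never.

(** * The symmetric group acting on words *)

Section ActionOnWords.
Import GroupScope.

Section FfunAction.
Variables (n : nat) (X : finType).
Implicit Types (f g : {ffun 'I_n -> X}) (s t : 'S_n).

Definition ffact f s : {ffun 'I_n -> X} := [ffun x => f (s^-1 x)].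

Lemma ffact1 f : ffact f 1 = f.
Proof. by apply/ffunP => x; rewrite ffunE invg1 perm1. Qed.

Lemma ffactM f s t : ffact f (s * t) = ffact (ffact f s) t.
Proof. by apply/ffunP => x; rewrite !ffunE invMg permM. Qed.

Definition ffun_action := TotalAction ffact1 ffactM.

Lemma ffact_id f s : (ffact f s == f) = [forall x, f (s x) == f x].
Proof.
apply/eqP/forallP => [fs x|fs].
  by rewrite -{1}fs ffunE permK.
by apply/ffunP => x; rewrite ffunE -(eqP (fs (s^-1 x))) permKV.
Qed.

Definition content f c := #|[set x | f x == c]|.

Lemma content_tuple f c : content f c = count_mem c [tuple f i | i < n].
Proof.
by rewrite /content cardsE -sum1_card -sum1_count big_map big_enum_cond.
Qed.

Lemma content_act f s c : content (ffact f s) c = content f c.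
Proof.
rewrite /content -[RHS](card_imset _ (@perm_inj _ s)); apply: eq_card => x.
rewrite !inE ffunE; apply/idP/imsetP => [fx|[y]].
  by exists (s^-1 x); rewrite ?inE ?permKV.
by rewrite inE => fy ->; rewrite permK.
Qed.

Lemma content_transitive f g : content f =1 content g -> exists s, g = ffact f s.
Proof.
move=> fg.
have /tuple_permP[s sE] : perm_eq [tuple f i | i < n] [tuple g i | i < n].
  by apply/allP => c _ /=; rewrite -!content_tuple fg.
have fgs x : f x = g (s x).
  have /(congr1 (fun u => tnth u x)) : [tuple f i | i < n] =
    [tuple tnth [tuple g j | j < n] (s i) | i < n] by apply: val_inj.
  by rewrite !tnth_mktuple.
by exists s; apply/ffunP => x; rewrite ffunE fgs permKV.
Qed.

Lemma content_ex (c : X -> nat) : \sum_x c x = n -> exists f, content f =1 c.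
Proof.
move=> cn; pose u := flatten [seq nseq (c x) x | x <- enum X].
have su : size u == n.
  rewrite size_flatten /shape -map_comp sumnE big_map -[X in _ == X]cn.
  by rewrite big_enum /=; apply/eqP/eq_bigr => x _; rewrite size_nseq.
exists [ffun i => tnth (Tuple su) i] => x; rewrite content_tuple.
rewrite (_ : [tuple _ | i < n] = Tuple su); last first.
  by apply: eq_from_tnth => i; rewrite tnth_mktuple ffunE.
rewrite /= /u count_flatten -map_comp sumnE big_map big_enum /=.
rewrite (bigD1 x) //= count_nseq /= eqxx mul1n big1 ?addn0 // => y /negPf yx.
by rewrite count_nseq /= yx.
Qed.

Lemma sum_content f : \sum_c content f c = n.
Proof.
rewrite -[RHS]card_ord -sum1_card (partition_big f predT) //=.
by apply: eq_bigr => c _; rewrite /content cardsE sum1_card.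
Qed.
End FfunAction.
End ActionOnWords.

(** * Permutation characters on words of given content *)

Section PermutationCharacterTheory.
Import GroupScope GRing.Theory Num.Theory.

Lemma card_imset_eq (A B C : finType) (S : {set A}) (f : A -> B) (g : A -> C) :
  {in S &, forall x y, (f x == f y) = (g x == g y)} ->
  #|f @: S| = #|g @: S|.
Proof.
move=> fg.
have [->|[x0 x0S]] := set_0Vmem S; first by rewrite !imset0 !cards0.
pose h b := g (odflt x0 [pick x in S | f x == b]).
have hf x : x \in S -> h (f x) = g x.
  move=> xS; rewrite /h; case: pickP => [y /andP[yS]|/(_ x)]; last first.
    by rewrite xS eqxx.
  by rewrite fg // => /eqP.
have -> : g @: S = h @: (f @: S).
  by rewrite -imset_comp; apply: eq_in_imset => x xS /=; rewrite hf.
rewrite [RHS]card_in_imset // => _ _ /imsetP[x xS ->] /imsetP[y yS ->].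
by rewrite !hf // => /eqP; rewrite -fg // => /eqP.
Qed.

Section PermutationCharacters.
Variable n : nat.
Implicit Types (mu nu : nat -> nat) (s : 'S_n).
Notation G := [set: 'S_n]%G.
Notation to r := (ffun_action n 'I_r).

Definition has_content r mu (f : {ffun 'I_n -> 'I_r}) :=
  [forall c, content f c == mu c].

Lemma has_contentP r mu (f : {ffun 'I_n -> 'I_r}) :
  reflect (forall c, content f c = mu c) (has_content mu f).
Proof. exact: 'forall_eqP. Qed.

Lemma has_content_act r mu (f : {ffun 'I_n -> 'I_r}) s :
  has_content mu (ffact f s) = has_content mu f.
Proof. by apply: eq_forallb => c; rewrite content_act. Qed.

Definition fixcount r mu s :=
  #|[set f : {ffun 'I_n -> 'I_r} | has_content mu f && (ffact f s == f)]|.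

(** The words of content mu form a single orbit. In the sum defining the induced character, the
    group elements are gathered according to the word to which they send f; each word is reached by
    one coset of the stabilizer. *)
Lemma ind_stab r mu (f : {ffun 'I_n -> 'I_r}) s : has_content mu f ->
  ('Ind[G, 'C[f | to r]] 1 s)%R = (fixcount r mu s)%:R%R.
Proof.
move=> /has_contentP fmu; set H := 'C[f | to r]%G.
have sHG : H \subset G by apply: subsetT.
rewrite cfIndE //.
transitivity (#|H|%:R^-1 * \sum_(y in G) (ffact f (s ^ y) == f)%:R : algC)%R.
  congr (_ * _)%R; apply: eq_bigr => y _; rewrite cfun1E; congr (nat_of_bool _)%:R%R.
  by apply/astab1P/eqP.
have -> : (\sum_(y in G) (ffact f (s ^ y) == f)%:R =
           \sum_(y in G) (ffact (ffact f y^-1) s == ffact f y^-1)%:R :> algC)%R.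
  apply: eq_bigr => y _; congr (nat_of_bool _)%:R%R.
  rewrite conjgE !ffactM -(inj_eq (act_inj (to r) y^-1)) /=.
  by rewrite -[ffact (ffact _ y) _]ffactM mulgV ffact1.
rewrite (reindex_inj invg_inj) /=.
under eq_bigl do rewrite in_setT; under eq_bigr do rewrite invgK.
rewrite (partition_big (ffact f) (has_content mu)) /=; last first.
  by move=> y _; rewrite has_content_act; apply/has_contentP.
rewrite -[fixcount _ _ _]sum1dep_card natr_sum mulr_sumr [RHS]big_mkcondr /=.
apply: eq_bigr => g /has_contentP gmu.
have [a ga] : exists a, g = ffact f a.
  by apply: content_transitive => c; rewrite fmu gmu.
rewrite (eq_bigr (fun=> (ffact g s == g)%:R%R)); last by move=> i /eqP->.
rewrite sumr_const (_ : #|_| = #|H|); last first.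
  rewrite -(card_rcoset H a); apply: eq_card => y; rewrite mem_rcoset.
  transitivity (ffact f y == g); first by rewrite unfold_in.
  apply/eqP/astab1P => /= [E|E].
    by rewrite ffactM E ga -ffactM mulgV ffact1.
  by rewrite ga -{2}E -ffactM mulgKV.
rewrite mulrnAr -[LHS]mulr_natr mulrAC mulVf ?mul1r ?neq0CG //.
by case: eqP.
Qed.

(** Choosing a word exhibits the character as induced from a Young subgroup, which gives access to
    Frobenius reciprocity. If no word has content mu, the value 0 still agrees with [fixcount]. *)
Definition permchar r mu : 'CF(G) :=
  if [pick f : {ffun 'I_n -> 'I_r} | has_content mu f] is Some f
  then ('Ind[G, 'C[f | to r]] 1)%R else 0%R.

Lemma permcharE r mu s : permchar r mu s = (fixcount r mu s)%:R%R.
Proof.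
rewrite /permchar; case: pickP => [f fmu|no]; first exact: ind_stab.
rewrite cfunE /fixcount (_ : [set _ | _] = set0) ?cards0 //.
by apply/setP => f; rewrite !inE no.
Qed.

Lemma permchar_ind r mu f : has_content mu f ->
  permchar r mu = ('Ind[G, 'C[f | to r]] 1)%R.
Proof. by move=> fmu; apply/cfunP => s; rewrite permcharE (ind_stab _ fmu). Qed.

Lemma permchar_char r mu : permchar r mu \is a character.
Proof.
rewrite /permchar; case: pickP => [f _|_]; last exact: rpred0.
exact/cfInd_char/cfun1_char.
Qed.

Lemma cfdot_permchar r mu f (chi : 'CF(G)) : has_content mu f ->
  ('[permchar r mu, chi])%R =
  (#|'C[f | to r]|%:R^-1 * \sum_(s in 'C[f | to r]) (chi s)^*)%R.
Proof.
move=> fmu; rewrite (permchar_ind fmu) -Frobenius_reciprocity cfdotE.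
congr (_ * _)%R; apply: eq_bigr => s sC.
by rewrite cfun1E sC mul1r cfResE // subsetT.
Qed.

(** A pair of words is one word over the product alphabet. Orbits on such words are separated by
    their content, which is the matrix M; its margins are the contents of the two words. *)
Lemma cfdot_permchar2 r p mu nu : psum mu r = n -> psum nu p = n ->
  ('[permchar r mu, permchar p nu])%R =
  (\sum_(M : {ffun 'I_p -> {ffun 'I_r -> 'I_n.+1}} |
       is_content_matrix mu nu M) 1)%:R%R.
Proof.
move=> mun nun.
pose X : finType := ('I_r * 'I_p)%type.
pose tt := ffun_action n X.
pose f1 (h : {ffun 'I_n -> X}) : {ffun 'I_n -> 'I_r} := [ffun x => (h x).1].
pose f2 (h : {ffun 'I_n -> X}) : {ffun 'I_n -> 'I_p} := [ffun x => (h x).2].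
pose A := [set h : {ffun 'I_n -> X} | has_content mu (f1 h) && has_content nu (f2 h)].
have f1a h s : f1 (ffact h s) = ffact (f1 h) s.
  by apply/ffunP => x; rewrite !ffunE.
have f2a h s : f2 (ffact h s) = ffact (f2 h) s.
  by apply/ffunP => x; rewrite !ffunE.
have fixE s : (fixcount r mu s * fixcount p nu s)%N = #|'Fix_(A | tt)[s]|.
  rewrite /fixcount -cardsX.
  pose z (u : {ffun 'I_n -> 'I_r} * {ffun 'I_n -> 'I_p}) : {ffun 'I_n -> X} :=
    [ffun x => (u.1 x, u.2 x)].
  have z1 u : f1 (z u) = u.1 by apply/ffunP => x; rewrite !ffunE.
  have z2 u : f2 (z u) = u.2 by apply/ffunP => x; rewrite !ffunE.
  have zf h : z (f1 h, f2 h) = h.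
    by apply/ffunP => x; rewrite !ffunE; case: (h x).
  have zi : injective z.
    move=> [a b] [c d] E; have := z1 (a, b); have := z2 (a, b).
    by rewrite E z1 z2 => /= <- <-.
  rewrite -(card_imset _ zi); apply: eq_card => h; apply/imsetP/setIP.
    case=> -[a b] /setXP[]; rewrite inE => /andP[c1 /eqP e1].
    rewrite inE => /andP[c2 /eqP e2] ->.
    split; [by rewrite inE z1 z2 c1 c2 | apply/afix1P => /=].
    by rewrite -[ffact (z _) s]zf f1a f2a z1 z2 /= e1 e2.
  case; rewrite inE => /andP[c1 c2] /afix1P /= hs; exists (f1 h, f2 h) => //.
  by apply/setXP; split; rewrite inE /= ?c1 ?c2 -?f1a -?f2a hs eqxx.
pose ct (h : {ffun 'I_n -> X}) : {ffun 'I_p -> {ffun 'I_r -> 'I_n.+1}} :=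
  [ffun j => [ffun i => inord (content h (i, j))]].
have ctE h i j : ct h j i = content h (i, j) :> nat.
  rewrite !ffunE inordK // ltnS -[X in _ <= X]card_ord; exact: max_card.
have c1 h i : content (f1 h) i = \sum_j ct h j i.
  rewrite /content cardsE -sum1_card (partition_big (fun x => (h x).2) predT) //=.
  apply: eq_bigr => j _; rewrite ctE /content cardsE -sum1_card.
  by apply: eq_bigl => x; rewrite !unfold_in ffunE.
have c2 h j : content (f2 h) j = \sum_i ct h j i.
  rewrite /content cardsE -sum1_card (partition_big (fun x => (h x).1) predT) //=.
  apply: eq_bigr => i _; rewrite ctE /content cardsE -sum1_card.
  by apply: eq_bigl => x; rewrite !unfold_in ffunE andbC.
have AE h : (h \in A) = is_content_matrix mu nu (ct h).
  by rewrite inE; congr andb; apply: eq_forallb => c; rewrite (c1, c2).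
have actsA : [acts G, on A | tt].
  apply/actsP => s _ h; rewrite !inE /= f1a f2a.
  by rewrite !has_content_act.
rewrite cfdotE.
under eq_bigr do rewrite !permcharE conjC_nat -natrM fixE.
rewrite -natr_sum Frobenius_Cauchy // natrM mulrC mulfK ?neq0CG //.
congr (_%:R)%R.
rewrite (@card_imset_eq _ _ _ A (orbit tt G) ct) => [|h h' hA h'A]; last first.
  apply/eqP/eqP => [E|E].
    have : h' \in orbit tt G h by rewrite E orbit_refl.
    case/orbitP => s _ <-; apply/ffunP => j; apply/ffunP => i; apply: val_inj.
    by rewrite /= !ctE content_act.
  have [[i j]|s ->] := @content_transitive _ _ h h'.
    by rewrite -!ctE E.
  by apply/esym/orbit_act; rewrite in_setT.
rewrite sum1dep_card; apply: eq_card => M; rewrite inE; apply/imsetP/idP.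
  by case=> h hA ->; rewrite -AE.
move=> HM.
have [|h hM] := @content_ex n X (fun x => M x.2 x.1).
  rewrite -(pair_big predT predT (fun i j => M j i : nat)) /= -[RHS]mun.
  by apply: eq_bigr => i _; apply/eqP; case/andP: HM => /forallP.
have hE : ct h = M.
  apply/ffunP => j; apply/ffunP => i; apply: val_inj.
  by rewrite /= ctE hM.
by exists h; rewrite ?AE hE.
Qed.
End PermutationCharacters.
End PermutationCharacterTheory.

(** * Row and column groups of a diagram *)

Section RowsAndColumns.
Import GroupScope GRing.Theory Num.Theory.

Section Boxes.
Variables (n : nat) (R : seq nat).
Hypotheses (diagR : is_diagram R) (sizeR : sumn R = n).
Implicit Types (x y : 'I_n).

Definition box_row x : nat := reshape_index R x.
Definition box_col x : nat := reshape_offset R x.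

Lemma box_lt x : x < sumn R. Proof. by rewrite sizeR. Qed.

Lemma box_row_lt x : box_row x < size R.
Proof. exact/reshape_indexP/box_lt. Qed.

Lemma box_col_lt x : box_col x < nth 0 R (box_row x).
Proof. exact/reshape_offsetP/box_lt. Qed.

Lemma box_inj x y : box_row x = box_row y -> box_col x = box_col y -> x = y.
Proof.
move=> rxy cxy; apply: val_inj => /=.
rewrite -(reshape_indexK R x) -(reshape_indexK R y).
by rewrite -/(box_row x) -/(box_col x) rxy cxy.
Qed.

Lemma box_ex r c : c < nth 0 R r -> exists x, box_row x = r /\ box_col x = c.
Proof.
move=> cr; have xn : flatten_index R r c < n.
  rewrite -sizeR; exact: flatten_indexP.
exists (Ordinal xn).
by rewrite /box_row /box_col /= flatten_indexKl ?flatten_indexKr.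
Qed.

Lemma diagram_nth_leq i j : i <= j -> nth 0 R j <= nth 0 R i.
Proof.
move=> ij; have [jR|jR] := ltnP j (size R); last by rewrite (nth_default 0 jR).
have /andP[sR _] := diagR.
have gtr : transitive geq by move=> a b c ab bc; apply: leq_trans bc ab.
have grf : reflexive geq by move=> a; apply: leqnn.
have iR := leq_ltn_trans ij jR.
exact: (sorted_leq_nth gtr grf 0 sR i j iR jR ij).
Qed.

Lemma diagram_size_leq : size R <= sumn R.
Proof.
have /andP[_] := diagR; elim: (R) => //= a s IH.
by rewrite inE negb_or eq_sym -lt0n => /andP[a0 /IH ss]; rewrite -add1n leq_add.
Qed.

(** The word that labels each box by its row. Its content is the diagram itself and its stabilizer
    is the row group, so the sum over the row group in [Iirr_diagram] becomes a scalar product with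
    a permutation character. *)
Definition row_ffun : {ffun 'I_n -> 'I_n.+1} := [ffun x => inord (box_row x)].

Lemma row_ffunE x : row_ffun x = box_row x :> nat.
Proof.
rewrite ffunE inordK // ltnS -[X in _ <= X]sizeR.
by apply: leq_trans diagram_size_leq; exact/ltnW/box_row_lt.
Qed.

Lemma card_box_row i : #|[set x | box_row x == i]| = nth 0 R i.
Proof.
rewrite -[RHS]card_ord.
have ex (c : 'I_(nth 0 R i)) : exists x, (box_row x == i) && (box_col x == c).
  by have [x [xi xc]] := box_ex (ltn_ord c); exists x; rewrite xi xc !eqxx.
pose f c := xchoose (ex c).
have fP c : box_row (f c) = i /\ box_col (f c) = c.
  by have /andP[/eqP -> /eqP ->] := xchooseP (ex c).
have finj : injective f.
  by move=> c d E; apply: val_inj; rewrite /= -(fP c).2 -(fP d).2 E.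
rewrite -(card_imset _ finj); apply: eq_card => x; rewrite inE.
apply/eqP/imsetP => [xi|[c _ ->]]; last by case: (fP c).
have cx := box_col_lt x; rewrite xi in cx.
have [e1 e2] := fP (Ordinal cx).
by exists (Ordinal cx) => //; apply: box_inj; rewrite ?e1 ?e2.
Qed.

Lemma row_ffun_content : has_content (nth 0 R) row_ffun.
Proof.
apply/has_contentP => c; rewrite -card_box_row; apply: eq_card => x.
by rewrite !inE -(inj_eq val_inj) /= row_ffunE.
Qed.

Lemma mem_row_group s : (s \in row_group n R) = (s \in 'C[row_ffun | ffun_action n 'I_n.+1]).
Proof.
rewrite inE; apply/forallP/astab1P => /= [h|/eqP].
  apply/eqP; rewrite ffact_id; apply/forallP => x.
  by rewrite -(inj_eq val_inj) /= !row_ffunE; apply: h.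
rewrite ffact_id => /forallP h x; move: (h x).
by rewrite -(inj_eq val_inj) /= !row_ffunE.
Qed.

Definition col_injective r (f : {ffun 'I_n -> 'I_r}) :=
  [forall x, forall y, (box_col x == box_col y) && (f x == f y) ==> (x == y)].

Lemma col_injectiveP r (f : {ffun 'I_n -> 'I_r}) :
  reflect (forall x y, box_col x = box_col y -> f x = f y -> x = y) (col_injective f).
Proof.
apply: (iffP forallP) => h x.
  move=> y xy fxy; have /forallP/(_ y) := h x.
  by rewrite xy fxy !eqxx => /eqP.
by apply/forallP => y; apply/implyP => /andP[/eqP xy /eqP fxy]; apply/eqP/h.
Qed.

Lemma row_ffun_col_injective : col_injective row_ffun.
Proof.
apply/col_injectiveP => x y xy fxy; apply: box_inj => //.
by rewrite -!row_ffunE fxy.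
Qed.

(** If the column reaches row j, it contains all j boxes above that row, while at most j distinct
    letters are smaller than j; otherwise the whole column lies in the rows before j. *)
Lemma col_count_leq r (f : {ffun 'I_n -> 'I_r}) j c : col_injective f ->
  #|[set x | (box_col x == c) && (f x < j)]| <=
  #|[set x | (box_col x == c) && (box_row x < j)]|.
Proof.
move=> /col_injectiveP finj.
have [/existsP[x0 /andP[/eqP cx0 jx0]]|no] :=
    boolP [exists x, (box_col x == c) && (j <= box_row x)]; last first.
  apply/subset_leq_card/subsetP => x; rewrite !inE => /andP[xc _].
  rewrite xc ltnNge; apply: contra no => jx.
  by apply/existsP; exists x; rewrite jx xc.
apply: (@leq_trans j).
  have [->|] := set_0Vmem [set x | (box_col x == c) && (f x < j)].
    by rewrite cards0.
  case=> x1; rewrite inE => /andP[_ x1j]; case: j x1j jx0 => // j _ _.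
  pose g x : 'I_j.+1 := inord (f x).
  rewrite -[X in _ <= X]card_ord -(@card_in_imset _ _ g) ?max_card // => x y.
  rewrite !inE => /andP[/eqP xc xj] /andP[/eqP yc yj] /(congr1 val) /=.
  by rewrite !inordK // => /val_inj; apply: finj; rewrite xc yc.
have ex (i : 'I_j) : exists x, (box_row x == i) && (box_col x == c).
  have [|x [xi xc]] := @box_ex i c; last by exists x; rewrite xi xc !eqxx.
  rewrite -cx0; apply: leq_trans (box_col_lt x0) _; apply: diagram_nth_leq.
  exact: leq_trans (ltnW (ltn_ord i)) jx0.
pose g i := xchoose (ex i).
have gP i : box_row (g i) = i /\ box_col (g i) = c.
  by have /andP[/eqP -> /eqP ->] := xchooseP (ex i).
have ginj : injective g.
  by move=> i k E; apply: val_inj; rewrite /= -(gP i).1 -(gP k).1 E.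
rewrite -[X in X <= _]card_ord -(card_imset _ ginj); apply/subset_leq_card/subsetP => x.
by case/imsetP => i _ ->; have [e1 e2] := gP i; rewrite inE e1 e2 eqxx /=.
Qed.

(** [col_count_leq] summed over the columns: the left side counts the letters smaller than j, the
    right side the boxes in the first j rows. *)
Lemma col_injective_dom r mu (f : {ffun 'I_n -> 'I_r}) j :
  has_content mu f -> col_injective f -> j <= r ->
  psum mu j <= psum (nth 0 R) j.
Proof.
move=> /has_contentP fmu finj jr.
have E (g : 'I_n -> nat) : psum (fun i => #|[set x | g x == i]|) j =
    #|[set x | g x < j]|.
  elim: j {jr} => [|j IH]; first by rewrite psum0 (_ : [set _ | _] = set0) ?cards0 //;
    apply/setP => x; rewrite !inE.
  rewrite psumS IH -cardsUI (_ : _ :&: _ = set0) ?cards0 ?addn0.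
    by apply: eq_card => x; rewrite !inE ltnS [RHS]leq_eqVlt orbC.
  by apply/setP => x; rewrite !inE; case: ltngtP.
have -> : psum mu j = #|[set x | f x < j]|.
  rewrite -E; apply: eq_psum => i ij; rewrite -(fmu (Ordinal (leq_trans ij jr))).
  by apply: eq_card => x; rewrite !inE.
have -> : psum (nth 0 R) j = #|[set x | box_row x < j]|.
  by rewrite -E; apply: eq_psum => i ij; rewrite card_box_row.
have C (P : pred 'I_n) : #|[set x | P x]| =
    \sum_(c < n) #|[set x | (box_col x == c) && P x]|.
  have cl x : box_col x < n.
    apply: leq_trans (box_col_lt x) _; rewrite -[X in _ <= X]sizeR sumnE.
    rewrite (big_nth 0) big_mkord (bigD1 (Ordinal (box_row_lt x))) //=.
    exact: leq_addr.
  rewrite -sum1dep_card (partition_big (fun x => Ordinal (cl x)) predT) //=.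
  apply: eq_bigr => c _; rewrite -sum1dep_card; apply: eq_bigl => x.
  by rewrite andbC -(inj_eq val_inj).
by rewrite !C; apply: leq_sum => c _; apply: col_count_leq.
Qed.

Definition colsum (chi : 'CF([set: 'S_n])) : algC :=
  (\sum_(s in col_group n R) (-1) ^+ odd_perm s * chi s)%R.

(* Two equal letters in a column give a transposition that cancels the sum over
   the stabilizer of the word; otherwise this stabilizer is trivial. *)
Lemma colsum_permchar r mu : colsum (permchar n r mu) =
  #|[set f : {ffun 'I_n -> 'I_r} | has_content mu f && col_injective f]|%:R%R.
Proof.
rewrite /colsum -sum1dep_card natr_sum big_mkcondr /=.
transitivity (\sum_(f : {ffun 'I_n -> 'I_r} | has_content mu f)
  \sum_(s in col_group n R | ffact f s == f) (-1) ^+ odd_perm s : algC)%R.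
  rewrite (exchange_big_dep [in col_group n R]) /=; last by move=> ? ? _ /andP[].
  apply: eq_bigr => s sC; rewrite permcharE /fixcount -sum1dep_card natr_sum mulr_sumr.
  by apply: eq_big => [f|f _]; rewrite ?sC ?mulr1.
apply: eq_bigr => f _; case: ifP => [/col_injectiveP finj|/negbT].
  rewrite (big_pred1 1) ?odd_perm1 // => s; rewrite inE.
  apply/andP/eqP => [[/forallP cs]|->].
    rewrite ffact_id => /forallP fs; apply/permP => x; rewrite perm1.
    by apply: finj; apply/eqP; [apply: cs | apply: fs].
  by rewrite ffact1 eqxx; split=> //; apply/forallP => x; rewrite perm1.
case/forallPn => x /forallPn[y]; rewrite negb_imply => /andP[/andP[/eqP xy /eqP fxy] nxy].
pose t := tperm x y.
set S := (\sum_(_ | _) _)%R; have SN : S = (- S)%R.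
  rewrite {1}/S (reindex_inj (mulgI t)) /= /S -sumrN.
  have txy (g : 'I_n -> nat) z : g x = g y -> g (t z) = g z.
    by move=> gxy; rewrite /t; case: tpermP => // ->.
  apply: eq_big => [s|s _].
    rewrite !inE; congr andb.
      apply/forallP/forallP => h z.
        have := h (t z); rewrite permM tpermK => /eqP ->.
        by rewrite (txy (fun z => reshape_offset R z)).
      by rewrite permM (eqP (h _)) (txy (fun z => reshape_offset R z)).
    rewrite !ffact_id; apply/forallP/forallP => h z.
      have := h (t z); rewrite permM tpermK => /eqP ->.
      by rewrite -(inj_eq val_inj) /= (txy (fun z => f z)) ?fxy.
    by rewrite permM (eqP (h _)) -(inj_eq val_inj) /= (txy (fun z => f z)) ?fxy.
  by rewrite odd_permM odd_tperm nxy addTb signrN.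
by apply/eqP; rewrite -eqNr -SN.
Qed.

Lemma colsum_permchar_dom r mu : colsum (permchar n r mu) != 0%R ->
  forall j, j <= r -> psum mu j <= psum (nth 0 R) j.
Proof.
rewrite colsum_permchar pnatr_eq0 => /negP/negP; rewrite -lt0n => /card_gt0P[f].
by rewrite inE => /andP[fmu finj] j; apply: col_injective_dom fmu finj.
Qed.

Lemma colsum_permchar_neq0 : colsum (permchar n n.+1 (nth 0 R)) != 0%R.
Proof.
rewrite colsum_permchar pnatr_eq0 -lt0n; apply/card_gt0P; exists row_ffun.
by rewrite inE row_ffun_content row_ffun_col_injective.
Qed.
End Boxes.
End RowsAndColumns.

(** * Construction of the irreducible characters and Young's rule *)

Section YoungsRule.
Import GroupScope GRing.Theory Num.Theory.
Local Open Scope ring_scope.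

Section YoungRule.
Variable n : nat.
Implicit Types (mu nu : nat -> nat) (s : 'S_n) (l k : yshape n).
Notation G := [set: 'S_n]%G.

Definition is_part l := antitone l && (ssize l == n)%N.

Definition shape_of (R : seq nat) : yshape n := mkshape n (nth 0%N R).

Lemma row_shape_of (R : seq nat) : is_diagram R -> sumn R = n ->
  row (shape_of R) =1 nth 0%N R.
Proof.
move=> dR sR i; rewrite row_mkshape // => {}i.
  have [iR|iR] := ltnP i (size R); last by rewrite (nth_default 0%N iR).
  rewrite -[leqRHS]sR sumnE (big_nth 0%N) big_mkord (bigD1 (Ordinal iR)) //=.
  exact: leq_addr.
move=> ni; apply: nth_default; apply: leq_trans (ltnW ni).
by rewrite -[leqRHS]sR; apply: diagram_size_leq.
Qed.

Lemma ssize_shape_of (R : seq nat) : is_diagram R -> sumn R = n ->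
  ssize (shape_of R) = n.
Proof.
move=> dR sR; rewrite /ssize (eq_psum (g := nth 0%N R)) => [|i _]; last first.
  exact: row_shape_of.
rewrite -[RHS](sum_content (row_ffun n R)); apply: eq_bigr => i _.
by have /has_contentP-> := row_ffun_content dR sR.
Qed.

Lemma shape_of_part (R : seq nat) : is_diagram R -> sumn R = n ->
  is_part (shape_of R).
Proof.
move=> dR sR; rewrite /is_part ssize_shape_of // eqxx andbT.
by apply/antitoneP => i; rewrite !row_shape_of // diagram_nth_leq.
Qed.

(** What the induction over shapes carries. The multiplicities determine the shape, integrality
    makes the floor in [chi] exact, and the last two clauses on column sums single the character out
    in [Iirr_diagram]. *)
Definition young_irr l (i : Iirr G) :=
  [/\ forall r mu, psum mu r = n ->
        '[permchar n r mu, 'chi_i] = (kostka r mu l)%:R,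
      forall s, 'chi_i s \in Num.int,
      forall R, is_diagram R -> sumn R = n ->
        (shape_key l < shape_key (shape_of R))%N -> colsum R 'chi_i = 0 &
      forall R, is_diagram R -> sumn R = n -> shape_of R = l ->
        colsum R 'chi_i != 0].

Lemma psum_row l : (psum (row l) n.+1 = ssize l)%N.
Proof. by []. Qed.

(** The multiplicities of one character at the contents k and l would make both mixed Kostka numbers
    nonzero, so for k and l distinct each key would be smaller than the other. *)
Lemma young_irr_inj k l i : is_part k -> is_part l ->
  young_irr k i -> young_irr l i -> k = l.
Proof.
case/andP=> ak /eqP sk /andP[al /eqP sl] [Hk _ _ _] [Hl _ _ _].
have E r mu : psum mu r = n -> kostka r mu k = kostka r mu l.
  by move=> mun; apply/eqP; rewrite -eqC_nat -Hk // -Hl.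
have kl : kostka n.+1 (row k) l != 0%N by rewrite -E // kostka_row.
have lk : kostka n.+1 (row l) k != 0%N by rewrite E // kostka_row.
have [//|h] := kostka_key (eq_leq sl) lk.
have [//|h'] := kostka_key (eq_leq sk) kl.
by have := ltn_trans h h'; rewrite ltnn.
Qed.

Lemma colsum_sum (R : seq nat) (I : finType) (P : pred I) (F : I -> 'CF(G)) :
  colsum R (\sum_(i | P i) F i) = \sum_(i | P i) colsum R (F i).
Proof.
rewrite /colsum exchange_big; apply: eq_bigr => s _.
by rewrite sum_cfunE mulr_sumr.
Qed.

Lemma colsumB (R : seq nat) (phi psi : 'CF(G)) :
  colsum R (phi - psi) = colsum R phi - colsum R psi.
Proof.
by rewrite /colsum -sumrB; apply: eq_bigr => s _; rewrite !cfunE mulrBr.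
Qed.

Lemma colsumZ (R : seq nat) (a : algC) (phi : 'CF(G)) :
  colsum R (a *: phi) = a * colsum R phi.
Proof.
by rewrite /colsum mulr_sumr; apply: eq_bigr => s _; rewrite !cfunE mulrCA.
Qed.

Lemma colsum_permchar_key (R : seq nat) l : is_diagram R -> sumn R = n ->
  ssize l = n -> colsum R (permchar n n.+1 (row l)) != 0 ->
  (shape_key (shape_of R) <= shape_key l)%N.
Proof.
move=> dR sR sl /(colsum_permchar_dom dR sR) dom.
have RE := row_shape_of dR sR.
have [||->|/ltnW] // := @dominance_key n (shape_of R) l.
  by rewrite ssize_shape_of.
by move=> j jn; rewrite [leqRHS](eq_psum (g := nth 0%N R)) ?dom // => i _; apply: RE.
Qed.

(** The difference [psi] is orthogonal to every character subtracted in it, so its norm is its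
    product with phi_l, namely the diagonal Kostka number 1. *)
Lemma young_irr_ex l : is_part l -> exists i, young_irr l i.
Proof.
have [m] := ubnP (shape_key l); elim: m l => // m IH l lm pl.
have /andP[al /eqP sl] := pl.
pose Q k := is_part k && (shape_key k < shape_key l)%N.
have [i iP] : exists i : yshape n -> Iirr G, forall k, Q k -> young_irr k (i k).
  have H k : exists i : Iirr G, Q k -> young_irr k i.
    have [/andP[pk kl]|nQ] := boolP (Q k); last by exists 0.
    have [|i ki] := IH k _ pk; first by apply: leq_trans kl _; rewrite -ltnS.
    by exists i.
  by have [i iP] := fin_all_exists H; exists i.
pose a k := (kostka n.+1 (row l) k)%:R : algC.
pose phi := permchar n n.+1 (row l).
pose psi := phi - \sum_(k | Q k) a k *: 'chi_(i k).
(* In Cauchy's sum the term of l has coefficient 1, and every other nonzero term belongs to a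
   partition of smaller key, which is exactly what [psi] subtracts. *)
have dot_psi r mu : psum mu r = n ->
    '[permchar n r mu, psi] = (kostka r mu l)%:R.
  move=> mun; rewrite cfdotBr cfdot_permchar2 // -kostka_cauchy ?mun //.
  rewrite cfdot_sumr (bigD1 l) //= kostka_row // muln1 natrD.
  apply/eqP; rewrite -addrA -subr_eq0 addrAC subrr add0r subr_eq0; apply/eqP.
  rewrite natr_sum [LHS](bigID Q) /= [X in _ + X]big1 ?addr0; last first.
    move=> k /andP[kl]; apply: contraNeq; rewrite natrM mulf_eq0 negb_or !pnatr_eq0.
    case/andP=> _ ak0; rewrite /Q /is_part (kostka_antitone ak0).
    rewrite (kostka_ssize ak0) psum_row sl eqxx /=.
    by have [E|//] := kostka_key (eq_leq sl) ak0; rewrite E eqxx in kl.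
  apply: eq_big => [k|k /andP[_ Qk]].
    rewrite andb_idl // => /andP[_]; apply: contraTneq => ->.
    by rewrite ltnn.
  by rewrite cfdotZr conjC_nat natrM mulrC; have [-> ] := iP k Qk.
have dot_chi k : Q k -> '['chi_(i k), psi] = 0.
  move=> Qk; rewrite cfdotBr cfdotC.
  have [-> // _ _ _] := iP k Qk; rewrite conjC_nat cfdot_sumr (bigD1 k) //=.
  rewrite cfdotZr cfdot_irr eqxx mulr1 conjC_nat opprD addrA subrr add0r.
  rewrite big1 ?oppr0 // => k' /andP[Qk' kk'].
  rewrite cfdotZr cfdot_irr; case: eqP => [E|_]; last by rewrite mulr0.
  case/eqP: kk'; have := iP k' Qk'; rewrite -E => H.
  have /andP[pk _] := Qk; have /andP[pk' _] := Qk'.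
  exact: (young_irr_inj pk' pk H (iP k Qk)).
have norm_psi : '[psi] = 1.
  rewrite {1}/psi cfdotBl dot_psi // kostka_row // cfdot_suml big1 ?subr0 //.
  by move=> k Qk; rewrite cfdotZl dot_chi ?mulr0.
have psiZ : psi \in 'Z[irr G].
  apply: rpredB; first exact/char_vchar/permchar_char.
  by apply: rpred_sum => k _; rewrite /a scaler_nat rpredMn ?irr_vchar.
have [b [j psiE]] := vchar_norm1P psiZ norm_psi.
have {}psiE : psi = 'chi_j.
  (* A virtual character of norm 1 is irreducible up to sign; the negative sign would give two
     characters the scalar product -1. *)
  case: b psiE => psiE; last by rewrite psiE expr0 scale1r.
  have := dot_psi n.+1 (row l) sl; rewrite kostka_row // psiE expr1 scaleN1r cfdotNr.
  have /natrP[c ->] : '[permchar n n.+1 (row l), 'chi_j] \in Num.nat.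
    by rewrite Cnat_cfdot_char ?permchar_char ?irr_char.
  move=> /eqP; rewrite eqr_oppLR -subr_eq0 opprK -natrD pnatr_eq0.
  by rewrite addn1.
exists j; rewrite /young_irr -psiE; split=> // [s|R dR sR lR|R dR sR Rl].
- rewrite /psi !cfunE rpredB // ?permcharE ?natr_int //.
  rewrite sum_cfunE rpred_sum // => k Qk; rewrite cfunE rpredM ?natr_int //.
  by have [_ ->] := iP k Qk.
- rewrite colsumB colsum_sum big1 ?subr0.
    apply/eqP; apply: contraLR lR => /colsum_permchar_key.
    by rewrite -leqNgt; apply.
  move=> k Qk; rewrite colsumZ; have [_ _ -> //] := iP k Qk; first by rewrite mulr0.
  by apply: ltn_trans lR; case/andP: Qk.
- rewrite colsumB colsum_sum big1 ?subr0.
    have := colsum_permchar_neq0 dR sR.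
    congr (_ != _); congr (colsum _ _); apply/cfunP => s; rewrite !permcharE.
    congr (_%:R); apply: eq_card => f; rewrite !inE; congr andb.
    by apply: eq_forallb => c; rewrite -Rl row_shape_of.
  move=> k Qk; rewrite colsumZ; have [_ _ -> //] := iP k Qk; first by rewrite mulr0.
  by rewrite Rl; case/andP: Qk.
Qed.

(** Both sides have the same product with each ['chi_(i l)], so their difference is orthogonal to
    the sum. By Cauchy's identity it is orthogonal to the permutation character as well, hence it
    has norm 0. *)
Lemma young_rule_ex : exists i : yshape n -> Iirr G,
  (forall l, is_part l -> young_irr l (i l)) /\
  (forall r mu, psum mu r = n -> permchar n r mu =
     \sum_(l | is_part l) (kostka r mu l)%:R *: 'chi_(i l)).
Proof.
have [i iP] : exists i : yshape n -> Iirr G, forall l, is_part l -> young_irr l (i l).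
  have H l : exists i : Iirr G, is_part l -> young_irr l i.
    have [/young_irr_ex[i li]|nQ] := boolP (is_part l); last by exists 0.
    by exists i.
  by have [i iP] := fin_all_exists H; exists i.
exists i; split=> // r mu mun.
set S := \sum_(l | _) _.
have dotS l : is_part l -> '[S, 'chi_(i l)] = (kostka r mu l)%:R.
  move=> pl; rewrite cfdot_suml (bigD1 l) //= cfdotZl cfdot_irr eqxx mulr1.
  rewrite big1 ?addr0 // => k /andP[pk kl]; rewrite cfdotZl cfdot_irr.
  case: eqP => [E|_]; last by rewrite mulr0.
  case/eqP: kl; have := iP l pl; rewrite -E => H.
  exact: (young_irr_inj pk pl (iP k pk) H).
have dotP l : is_part l -> '[permchar n r mu, 'chi_(i l)] = (kostka r mu l)%:R.
  by move=> pl; have [->] := iP l pl.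
apply/eqP; rewrite -subr_eq0 -cfnorm_eq0 cfdotBr.
have -> : '[permchar n r mu - S, S] = 0.
  rewrite {2}/S cfdot_sumr big1 // => l pl.
  by rewrite cfdotZr cfdotBl dotS // dotP // subrr mulr0.
rewrite subr0 cfdotBl cfdot_permchar2 // -kostka_cauchy ?mun // [X in _ - X]cfdot_suml.
apply/eqP/eqP; rewrite subr_eq0 natr_sum [X in X == _](bigID is_part) /=.
rewrite [X in _ + X]big1 ?addr0; last first.
  move=> l; apply: contraNeq; rewrite pnatr_eq0 muln_eq0 negb_or => /andP[_ kl].
  by rewrite /is_part (kostka_antitone kl) (kostka_ssize kl) mun eqxx.
apply/eqP/eq_bigr => l pl; rewrite cfdotZl cfdotC dotP // conjC_nat natrM //.
Qed.
End YoungRule.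
End YoungsRule.

(** * Kostka numbers count semistandard tableaux *)

Section SemistandardTableaux.
Definition colstrict (a b : seq nat) := all (fun p => p.1 < p.2) (zip a b).

(** The largest letter r has nothing strictly larger below it, so the whole lower row must lie under
    the old part a of the upper one. The length hypothesis ensures that [zip] reaches the end of the
    lower row. *)
Lemma colstrict_cat r a b p q : all (gtn r) a -> all (gtn r) b ->
  size b + q <= size a + p ->
  colstrict (a ++ nseq p r) (b ++ nseq q r) =
  colstrict a b && (size b + q <= size a).
Proof.
elim: a b q => [|x a IH] b q /=.
  case: b => [|y b] _ /=; last first.
    move=> /andP[yr _]; rewrite addSn; case: p => // p _ /=.
    by rewrite /colstrict /= ltnNge (ltnW yr).
  by case: q => //= q _; case: p => // p _; rewrite /colstrict /= ltnn.
case/andP=> xr ar; case: b => [|y b] /=.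
  case: q => [|q] _ //= qp; rewrite /colstrict /= xr /=.
  by rewrite [LHS](IH [::] q ar) //; case: (a).
case/andP=> yr br s; rewrite /colstrict /= -!/(colstrict _ _) IH //.
by rewrite -andbA addSn ltnS.
Qed.

Lemma sorted_split_max r (a : seq nat) : sorted leq a -> all (gtn r.+1) a ->
  a = [seq x <- a | x < r] ++ nseq (size a - size [seq x <- a | x < r]) r.
Proof.
elim: a => //= x a IH xa /andP[xr ar]; have sa := path_sorted xa.
case: ltnP => rx /=; first by rewrite subSS -IH.
have {}xr : x = r by apply/eqP; rewrite eqn_leq rx -ltnS xr.
have {}ar : all (pred1 r) a.
  apply/allP => y ya; have := allP ar _ ya; rewrite /= ltnS eqn_leq => -> /=; rewrite -xr.
  by move/(order_path_min leq_trans)/allP: xa; apply.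
have -> : [seq y <- a | y < r] = [::].
  apply/eqP; rewrite -size_eq0 size_filter -leqn0 leqNgt -has_count -all_predC.
  by apply: sub_all ar => y /eqP-> /=; rewrite ltnn.
by rewrite subn0 /= xr; congr cons; apply/all_pred1P.
Qed.

Section Tableaux.
Variable n : nat.
Implicit Types (mu : nat -> nat) (l k : yshape n) (T : seq (seq nat)).

Definition add_max r l T := mkseq (fun i =>
  nth [::] T i ++ nseq (row l i - size (nth [::] T i)) r) n.+1.

(** The recursion copies that of [kostka], so the two counts agree at once. Tableaux are padded with
    empty rows to [n.+1] rows, like the shapes. *)
Fixpoint tableaux r mu l : seq (seq (seq nat)) :=
  if r is r'.+1 then
    [seq add_max r' l T | k <- enum [pred k | hstrip (mu r') l k],
                          T <- tableaux r' mu k]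
  else if l == shape0 n then [:: nseq n.+1 [::]] else [::].

Lemma size_tableaux r mu l : size (tableaux r mu l) = kostka r mu l.
Proof.
elim: r l => [|r IH] l /=; first by rewrite /kostka; case: ifP.
rewrite size_allpairs_dep sumnE big_map big_enum.
by apply: eq_bigr => k _; apply: IH.
Qed.

Definition is_tableau r mu l T :=
  [/\ size T = n.+1 /\ antitone l,
      forall i, size (nth [::] T i) = row l i,
      forall i, sorted leq (nth [::] T i),
      forall i, colstrict (nth [::] T i) (nth [::] T i.+1) &
      (forall i, all (gtn r) (nth [::] T i)) /\
      (forall c, c < r -> count_mem c (flatten T) = mu c)].

Lemma count_flatten_psum T c : size T = n.+1 ->
  count_mem c (flatten T) = psum (fun i => count_mem c (nth [::] T i)) n.+1.
Proof.
move=> sT; rewrite count_flatten sumnE big_map (big_nth [::]) sT.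
by rewrite big_mkord.
Qed.

Lemma nth_add_max r l T i : size T = n.+1 ->
  nth [::] (add_max r l T) i =
  nth [::] T i ++ nseq (row l i - size (nth [::] T i)) r.
Proof.
move=> sT; have [ni|ni] := ltnP i n.+1; first by rewrite nth_mkseq.
by rewrite nth_default ?size_mkseq // nth_default ?sT // row_out.
Qed.

Lemma is_tableau_add_max r mu l k T : hstrip (mu r) l k ->
  is_tableau r mu k T -> is_tableau r.+1 mu l (add_max r l T).
Proof.
move=> hs [[sT ak] szT soT csT [ltT ctT]].
have /hstripP[kl lk slk] := hs; have /andP[al _] := hstrip_antitone hs.
have E := fun i => nth_add_max r l i sT.
have sE i : size (nth [::] (add_max r l T) i) = row l i.
  by rewrite E size_cat size_nseq szT subnKC.
split=> //; first by rewrite size_mkseq.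
- move=> i; rewrite E (sorted_pairwise leq_trans) pairwise_cat.
  rewrite -(sorted_pairwise leq_trans) soT /=; apply/andP; split.
    apply/allrelP => x y xT; rewrite mem_nseq => /andP[_ /eqP->].
    by apply/ltnW; apply: (allP (ltT i)).
  rewrite -(sorted_pairwise leq_trans); case: (_ - _) => //= m.
  by elim: m => //= m; rewrite leqnn.
- move=> i; rewrite !E colstrict_cat // ?csT ?szT ?subnKC //=.
  by move/antitoneP: al; apply.
- split=> [i|c].
    rewrite E all_cat; apply/andP; split; last by rewrite all_nseq /= ltnSn orbT.
    by apply: sub_all (ltT i) => x /= /ltnW.
  have sA : size (add_max r l T) = n.+1 by rewrite size_mkseq.
  rewrite ltnS leq_eqVlt count_flatten_psum // => /orP[/eqP->|cr].
    rewrite (eq_psum (g := fun i => row l i - row k i)).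
      apply/eqP; rewrite -(eqn_add2l (ssize k)) -slk addnC /ssize -psumD.
      by apply/eqP/eq_psum => i _; rewrite subnK.
    move=> i _; rewrite E count_cat count_nseq /= eqxx mul1n szT.
    rewrite (_ : count_mem r _ = 0) //; apply/count_memPn/negP => /(allP (ltT i)).
    by rewrite /= ltnn.
  rewrite -ctT // count_flatten_psum //; apply: eq_psum => i _.
  by rewrite E count_cat count_nseq /= (gtn_eqF cr) mul0n addn0.
Qed.

Definition restrict r T := [seq [seq x <- a | x < r] | a <- T].

Lemma nth_restrict r T i :
  nth [::] (restrict r T) i = [seq x <- nth [::] T i | x < r].
Proof.
have [iT|iT] := ltnP i (size T); first by rewrite (nth_map [::]).
by rewrite !nth_default ?size_map.
Qed.

Definition tableau_shape T : yshape n := mkshape n (fun i => size (nth [::] T i)).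

Lemma is_tableau_shape r mu l T : is_tableau r mu l T -> tableau_shape T = l.
Proof.
case=> [[sT _] szT _ _ _]; apply: shapeP => i; rewrite -szT row_mkshape // => {}i.
  rewrite szT; have [ni|ni] := leqP i n; last by rewrite row_out.
  by rewrite (row_ord l (Ordinal (ni : i < n.+1))) -ltnS.
by move=> ni; rewrite szT row_out.
Qed.

Lemma restrict_add_max r mu l k T : is_tableau r mu k T ->
  restrict r (add_max r l T) = T.
Proof.
case=> [[sT _] szT _ _ [ltT _]]; apply: (@eq_from_nth _ [::]).
  by rewrite size_map size_mkseq sT.
move=> i _; rewrite nth_restrict nth_add_max // filter_cat.
rewrite (all_filterP (ltT i)) (_ : [seq x <- nseq _ _ | _] = [::]) ?cats0 //.
by elim: (_ - _) => //= m ->; rewrite ltnn.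
Qed.

(** By [colstrict_cat], column strictness of T splits into that of its restriction and the
    interlacing that makes the removed boxes a horizontal strip. *)
Lemma is_tableau_restrict r mu l T : is_tableau r.+1 mu l T ->
  let k := tableau_shape (restrict r T) in
  [/\ is_tableau r mu k (restrict r T), hstrip (mu r) l k &
      T = add_max r l (restrict r T)].
Proof.
move=> [[sT al] szT soT csT [ltT ctT]] k.
have sR : size (restrict r T) = n.+1 by rewrite size_map.
have E i : nth [::] T i = [seq x <- nth [::] T i | x < r] ++
    nseq (row l i - size [seq x <- nth [::] T i | x < r]) r.
  by rewrite -szT; apply: sorted_split_max.
have kl' i : size [seq x <- nth [::] T i | x < r] <= row l i.
  by rewrite -szT size_filter count_size.
have kE i : row k i = size [seq x <- nth [::] T i | x < r].
  rewrite -nth_restrict row_mkshape // => {}i; rewrite nth_restrict.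
    apply: leq_trans (kl' i) _; have [ni|ni] := leqP i n; last by rewrite row_out.
    by rewrite (row_ord l (Ordinal (ni : i < n.+1))) -ltnS.
  by move=> ni; apply/eqP; rewrite -leqn0; apply: leq_trans (kl' i) _; rewrite row_out.
have ltR i : all (gtn r) [seq x <- nth [::] T i | x < r].
  by apply: filter_all.
have TE : T = add_max r l (restrict r T).
  apply: (@eq_from_nth _ [::]); rewrite ?size_mkseq // => i _.
  by rewrite nth_add_max // nth_restrict -E.
have cs i : colstrict [seq x <- nth [::] T i | x < r] [seq x <- nth [::] T i.+1 | x < r]
    && (row l i.+1 <= row k i).
  have := csT i; rewrite {1}(E i) {1}(E i.+1) colstrict_cat // ?subnKC ?kE //.
  by move/antitoneP: al; apply.
have hs : hstrip (mu r) l k.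
  apply/hstripP; split=> [i|i|]; first by rewrite kE.
    by case/andP: (cs i).
  rewrite -ctT // count_flatten_psum // /ssize -psumD; apply: eq_psum => i _.
  rewrite [in RHS]E kE count_cat count_nseq /= eqxx mul1n.
  rewrite (_ : count_mem r _ = 0) ?subnKC //.
  apply/count_memPn/negP => /(allP (ltR i)).
  by rewrite /= ltnn.
split=> //; split.
- by split=> //; case/andP: (hstrip_antitone hs).
- by move=> i; rewrite nth_restrict kE.
- by move=> i; rewrite nth_restrict; apply: (sorted_filter leq_trans).
- by move=> i; rewrite !nth_restrict; case/andP: (cs i).
- split=> [i|c cr]; first by rewrite nth_restrict.
  rewrite -ctT 1?ltnW // !count_flatten_psum //; apply: eq_psum => i _.
  rewrite nth_restrict count_filter; apply: eq_count => x /=.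
  by case: eqP => // ->.
Qed.

Lemma tableauxP r mu l T : T \in tableaux r mu l <-> is_tableau r mu l T.
Proof.
elim: r l T => [|r IH] l T.
  split=> /=.
    case: eqP => // ->; rewrite inE => /eqP->.
    have N i : nth [::] ([::] :: nseq n ([::] : seq nat)) i = [::].
      by case: i => //= i; rewrite nth_nseq; case: ifP.
    split.
    + by split; [rewrite /= size_nseq | apply/antitoneP => i; rewrite !row_shape0].
    + by move=> i; rewrite N row_shape0.
    + by move=> i; rewrite N.
    + by move=> i; rewrite !N.
    + by split=> // i; rewrite N.
  case=> [[sT _] szT _ _ [ltT _]].
  have N i : nth [::] T i = [::].
    by have := ltT i; case: (nth _ _ _).
  rewrite (_ : l = shape0 n) ?eqxx ?inE; last first.
    by apply: shapeP => i; rewrite row_shape0 -szT N.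
  apply/eqP/(@eq_from_nth _ [::]); rewrite ?sT /= ?size_nseq // => i _.
  by rewrite N; case: i => //= i; rewrite nth_nseq; case: ifP.
split=> /=.
  case/allpairsPdep => k [T' [kl T'k ->]]; rewrite mem_enum in kl.
  by apply: is_tableau_add_max kl _; apply/IH.
move=> /is_tableau_restrict[kT hs TE]; apply/allpairsPdep.
exists (tableau_shape (restrict r T)), (restrict r T).
by split; rewrite ?mem_enum //; apply/IH.
Qed.

Lemma tableaux_uniq r mu l : uniq (tableaux r mu l).
Proof.
elim: r l => [|r IH] l /=; first by case: ifP.
apply: allpairs_uniq_dep; rewrite ?enum_uniq // => -[k T] [k' T'] /=.
case/allpairsPdep => x [y [_ /tableauxP yx E]].
case/allpairsPdep => x' [y' [_ /tableauxP yx' E']] /= EE.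
have kx : k = x := congr1 tag E; have kx' : k' = x' := congr1 tag E'.
have Ty : T = y := congr1 (fun u : {_ : yshape n & seq (seq nat)} => tagged u) E.
have Ty' : T' = y' := congr1 (fun u : {_ : yshape n & seq (seq nat)} => tagged u) E'.
move: EE; rewrite Ty Ty' kx kx' => /(congr1 (restrict r)).
rewrite (restrict_add_max _ yx) (restrict_add_max _ yx') => yy.
by rewrite -(is_tableau_shape yx) -(is_tableau_shape yx') yy.
Qed.
End Tableaux.

Section SSYT.
Variable n : nat.

Definition has_weight r (mu : nat -> nat) (T : seq (seq nat)) :=
  all (gtn r) (flatten T) && all (fun c => count_mem c (flatten T) == mu c) (iota 0 r).

(** Cutting off the padding yields the format of [ssyt], where the list of rows is exactly as long
    as R. *)
Definition ssyt_list r mu (R : seq nat) :=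
  [seq take (size R) T | T <- tableaux r mu (shape_of n R)].

Lemma size_ssyt_list r mu R : size (ssyt_list r mu R) = kostka r mu (shape_of n R).
Proof. by rewrite size_map size_tableaux. Qed.

Variable R : seq nat.
Hypotheses (dR : is_diagram R) (sR : sumn R = n).

Lemma diagram_size_leqn : size R <= n.+1.
Proof. by apply: leqW; rewrite -[leqRHS]sR; apply: diagram_size_leq dR. Qed.

Lemma take_padding r mu T : is_tableau r mu (shape_of n R) T ->
  T = take (size R) T ++ nseq (n.+1 - size R) [::].
Proof.
case=> [[sT _] szT _ _ _]; rewrite -[LHS](cat_take_drop (size R)); congr (_ ++ _).
apply: (@eq_from_nth _ [::]); first by rewrite size_drop sT size_nseq.
move=> i _; rewrite nth_drop nth_nseq if_same; apply/size0nil.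
by rewrite szT row_shape_of // nth_default // leq_addr.
Qed.

Lemma flatten_padding (T : seq (seq nat)) m : flatten (T ++ nseq m [::]) = flatten T.
Proof. by rewrite flatten_cat; elim: m => [|m IH]; rewrite ?cats0. Qed.

Lemma ssyt_list_uniq r mu : uniq (ssyt_list r mu R).
Proof.
rewrite map_inj_in_uniq ?tableaux_uniq // => T T' /tableauxP tT /tableauxP tT' E.
by rewrite (take_padding tT) (take_padding tT') E.
Qed.

Lemma mem_ssyt_list r mu T :
  (T \in ssyt_list r mu R) = ssyt R T && has_weight r mu T.
Proof.
have Rn := diagram_size_leqn.
apply/mapP/andP => [[T' /tableauxP tT' ->]|[/and3P[/eqP sT soT csT] /andP[ltT ctT]]].
  have pad := take_padding tT'; case: tT' => [[sT' _] szT soT csT [ltT ctT]].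
  have nt i : i < size R -> nth [::] (take (size R) T') i = nth [::] T' i.
    by move=> iR; rewrite nth_take.
  have st : size (take (size R) T') = size R by rewrite size_takel ?sT'.
  have ft : flatten (take (size R) T') = flatten T'.
    by rewrite [in RHS]pad flatten_padding.
  split.
    apply/and3P; split.
    - apply/eqP/(@eq_from_nth _ 0); rewrite size_map st // => i iR.
      by rewrite (nth_map [::]) ?st // nt // szT row_shape_of.
    - by apply/(all_nthP [::]) => i; rewrite st => iR; rewrite nt.
    - apply/(sortedP [::]) => i; rewrite st => iR; rewrite !nt // ?(ltnW iR) //.
      exact: csT.
  rewrite /has_weight ft; apply/andP; split; last first.
    by apply/allP => c; rewrite mem_iota /= add0n => /ctT ->.
  apply/allP => c /flattenP[a /(nthP [::])[i _ <-]]; exact/allP.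
have sT' : size T = size R by rewrite -sT size_map.
have nt i : nth [::] (T ++ nseq (n.+1 - size R) [::]) i = nth [::] T i.
  rewrite nth_cat; case: ltnP => // iT; rewrite nth_nseq if_same.
  by rewrite nth_default.
exists (T ++ nseq (n.+1 - size R) [::]); last by rewrite -sT' take_size_cat.
apply/tableauxP; split.
- rewrite size_cat size_nseq sT' subnKC //; split=> //.
  by case/andP: (shape_of_part dR sR).
- move=> i; rewrite nt row_shape_of //; have [iT|iT] := ltnP i (size T).
    by rewrite -sT (nth_map [::]).
  by rewrite !nth_default -?sT'.
- move=> i; rewrite nt; have [iT|iT] := ltnP i (size T).
    by apply: (allP soT); rewrite mem_nth.
  by rewrite nth_default.
- move=> i; rewrite !nt; have [iT|iT] := ltnP i.+1 (size T).
    by move/(sortedP [::]): csT; apply.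
  by rewrite [X in colstrict _ X]nth_default // /colstrict; case: (nth _ _ _).
- split=> [i|c cr]; last first.
    rewrite flatten_padding; apply/eqP; apply: (allP ctT).
    by rewrite mem_iota.
  rewrite nt; have [iT|iT] := ltnP i (size T); last by rewrite nth_default.
  apply/allP => x xi; apply: (allP ltT); apply/flattenP.
  by exists (nth [::] T i) => //; rewrite mem_nth.
Qed.
End SSYT.
End SemistandardTableaux.

From mathcomp Require Import finmap monalg.
From mathcomp Require Import boolp classical_sets functions cardinality fsbigop.

(** * Identification of the characters labelled by diagrams *)

Section DiagramCharacters.
Import GRing.Theory Num.Theory.
Local Open Scope ring_scope.

Section IrrDiagram.
Variable n : nat.
Implicit Types (mu nu : nat -> nat) (s : 'S_n) (l k : yshape n).
Notation G := [set: 'S_n]%G.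

(** By Frobenius reciprocity the two numbers agree up to complex conjugation and the order of the
    row group. *)
Lemma row_group_sum (R : seq nat) (chi : 'CF(G)) : is_diagram R -> sumn R = n ->
  (\sum_(s in row_group n R) chi s != 0) =
  ('[permchar n n.+1 (nth 0%N R), chi] != 0).
Proof.
move=> dR sR; rewrite (cfdot_permchar _ (row_ffun_content dR sR)).
rewrite mulf_eq0 invr_eq0 (negPf (neq0CG _)) /= -rmorph_sum fmorph_eq0.
by congr (_ != _); apply: eq_bigl => s; rewrite mem_row_group.
Qed.

Lemma kostka_shape_of r (R : seq nat) l : is_diagram R -> sumn R = n ->
  kostka r (row (shape_of n R)) l = kostka r (nth 0%N R) l.
Proof. by move=> dR sR; apply: eq_kostka => i _; apply: row_shape_of. Qed.

Lemma psum_diagram (R : seq nat) : is_diagram R -> sumn R = n ->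
  psum (nth 0%N R) n.+1 = n.
Proof.
move=> dR sR; rewrite -[RHS](ssize_shape_of dR sR).
by apply: eq_psum => i _; rewrite row_shape_of.
Qed.

(** Any candidate is a constituent of phi_R, hence belongs to a shape l that is either R or of
    smaller key. In the second case its column sum for R vanishes by the third clause of
    [young_irr]. *)
Lemma Iirr_diagramE (R : seq nat) (i : yshape n -> Iirr G) :
  is_diagram R -> sumn R = n ->
  (forall l, is_part l -> young_irr l (i l)) ->
  (forall r mu, psum mu r = n -> permchar n r mu =
     \sum_(l | is_part l) (kostka r mu l)%:R *: 'chi_(i l)) ->
  Iirr_diagram n R = i (shape_of n R).
Proof.
move=> dR sR iP young; have mR := psum_diagram dR sR.
have pR := shape_of_part dR sR.
rewrite /Iirr_diagram; case: pickP => [j|/(_ (i (shape_of n R)))] /=; last first.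
  have [dot _ _ col] := iP _ pR.
  rewrite row_group_sum // dot // -(kostka_shape_of _ _ dR sR) kostka_row.
    by rewrite oner_neq0 (col R dR sR).
  by case/andP: pR.
rewrite row_group_sum // young // cfdot_suml => /andP[].
move=> sn0; have /existsP[l /andP[pl]] :
    [exists l, is_part l && (((kostka n.+1 (nth 0%N R) l)%:R : algC) *
                             '['chi_(i l), 'chi_j] != 0)].
  apply: contraNT sn0 => /existsPn no; apply/eqP/big1 => l pl; rewrite cfdotZl.
  by have := no l; rewrite pl /= negbK => /eqP.
rewrite mulf_eq0 negb_or pnatr_eq0 cfdot_irr pnatr_eq0 eqb0 negbK.
case/andP=> kl /eqP <-; rewrite -(kostka_shape_of _ _ dR sR) in kl.
have [_ _ col0 _] := iP l pl; rewrite -[X in X != 0]/(colsum R 'chi_(i l)).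
have [->//|/col0-> //] := kostka_key (eq_leq (ssize_shape_of dR sR)) kl.
by rewrite eqxx.
Qed.

(** In a decreasing sequence the zeros come last, so dropping them shifts no other entry. *)
Lemma filter_nonzero_nth (u : seq nat) i : sorted geq u ->
  nth 0%N [seq x <- u | x != 0%N] i = nth 0%N u i.
Proof.
elim: u i => //= a u IH i pu; case: eqP => [a0|_] /=; last first.
  by case: i => //= i; apply: IH (path_sorted pu).
have u0 : all (pred1 0%N) u.
  have gtr : transitive geq by move=> x y z xy yz; apply: leq_trans yz xy.
  have := order_path_min gtr pu; rewrite a0; apply: sub_all => x.
  by rewrite /= leqn0.
have -> : [seq x <- u | x != 0%N] = [::].
  by apply/eqP; rewrite -size_eq0 size_filter -leqn0 leqNgt -has_count -all_predC;
     apply: sub_all u0 => x /= /eqP->.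
rewrite nth_nil a0; case: i => //= i; have [iu|iu] := ltnP i (size u).
  by move/all_nthP: u0 => /(_ 0%N i iu)/eqP.
by rewrite nth_default.
Qed.

Definition diag_seq l := [seq x <- map (row l) (iota 0 n.+1) | x != 0%N].

Lemma diag_seqP l : is_part l ->
  [/\ is_diagram (diag_seq l), sumn (diag_seq l) = n & shape_of n (diag_seq l) = l].
Proof.
case/andP=> al /eqP sl.
have su : sorted geq (map (row l) (iota 0 n.+1)).
  apply/(sortedP 0%N) => i; rewrite size_map size_iota => ni.
  rewrite !(nth_map 0%N) ?size_iota ?(ltnW ni) // !nth_iota // ?(ltnW ni) //.
  by move/antitoneP: al; apply.
have dl : is_diagram (diag_seq l).
  rewrite /is_diagram mem_filter eqxx andbT sorted_filter // => x y z xy yz.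
  exact: leq_trans yz xy.
have sdl : sumn (diag_seq l) = n.
  rewrite -sl /ssize /psum sumnE big_filter big_map big_mkcond.
  have -> : iota 0 n.+1 = index_iota 0 n.+1 by rewrite /index_iota subn0.
  by rewrite big_mkord; apply: eq_bigr => i _; case: eqP.
split=> //; apply: shapeP => i; rewrite row_shape_of // filter_nonzero_nth //.
have [ni|ni] := ltnP i n.+1; last by rewrite nth_default ?size_map ?size_iota ?row_out.
by rewrite (nth_map 0%N) ?size_iota // nth_iota.
Qed.

(** Diagrams have no zero entries, so their lengths can be read off from [nth] with default 0. *)
Lemma eq_diagram_nth (u v : seq nat) : is_diagram u -> is_diagram v ->
  (forall i, nth 0%N u i = nth 0%N v i) -> u = v.
Proof.
have le (s t : seq nat) : is_diagram s -> (forall i, nth 0%N s i = nth 0%N t i) ->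
    (size s <= size t)%N.
  move=> /andP[_ s0] st; rewrite leqNgt; apply/negP => ts.
  by case/negP: s0; rewrite -(nth_default 0%N (leqnn (size t))) -st mem_nth.
move=> du dv uv; apply: (@eq_from_nth _ 0%N) => //.
by apply/eqP; rewrite eqn_leq !le.
Qed.

Lemma diag_seqK (R : seq nat) : is_diagram R -> sumn R = n ->
  diag_seq (shape_of n R) = R.
Proof.
move=> dR sR; have [d1 s1 h1] := diag_seqP (shape_of_part dR sR).
apply: eq_diagram_nth => // i.
by rewrite -(row_shape_of d1 s1) h1 row_shape_of.
Qed.

(** The empty diagram is a default value for shapes that are not partitions of n; sums over l are
    restricted to [is_part]. *)
Definition diag_of l : diagram := insubd (exist _ [::] isT) (diag_seq l).

Lemma val_diag_of l : is_part l -> val (diag_of l) = diag_seq l.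
Proof. by case/diag_seqP => dl _ _; rewrite val_insubd dl. Qed.

Lemma fsbig_diagrams (A : nmodType) (F : diagram -> A) :
  \sum_(R \in [set R | boxes R = n]%classic) F R =
  \sum_(l : yshape n | is_part l) F (diag_of l).
Proof.
pose r := [seq diag_of l | l <- enum [pred l | is_part l]].
have mr l : l \in enum [pred l | is_part l] -> is_part l by rewrite mem_enum.
have ur : uniq r.
  rewrite map_inj_in_uniq ?enum_uniq // => l k /mr pl /mr pk.
  move/(congr1 (fun R => shape_of n (val R))); rewrite !val_diag_of //.
  by have [_ _ ->] := diag_seqP pl; have [_ _ ->] := diag_seqP pk.
rewrite (fsbigE r) //=.
- transitivity (\sum_(l <- enum [pred l | is_part l]) F (diag_of l)); last first.
    by rewrite big_enum.
  rewrite big_map big_seq_cond [RHS]big_seq.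
  apply: eq_bigl => l; rewrite andb_idr // => /mr pl; apply/mem_set.
  by rewrite /= /boxes val_diag_of //; case: (diag_seqP pl).
- move=> R /mapP[l /mr pl ->]; rewrite /= /boxes val_diag_of //.
  by case: (diag_seqP pl).
- move=> R /= bR /mapP[]; exists (shape_of n (val R)).
    by rewrite mem_enum inE shape_of_part // (valP R).
  apply: val_inj; rewrite /= val_diag_of ?diag_seqK ?shape_of_part ?(valP R) //.
Qed.

(** Young's rule evaluated at s and brought back to the integers, the floors being exact because the
    character values are integers. *)
Lemma irr_diagram_fixcount r mu s : psum mu r = n ->
  (fixcount r mu s)%:Z =
  \sum_(R \in [set R : diagram | boxes R = n]%classic)
     (kostka r mu (shape_of n (val R)))%:Z *
     Num.floor ('chi_(Iirr_diagram n (val R)) s).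
Proof.
move=> mun; have [i [iP young]] := young_rule_ex n.
apply/eqP; rewrite -(eqr_int algC) fsbig_diagrams; apply/eqP.
have -> : (fixcount r mu s)%:Z%:~R = permchar n r mu s by rewrite permcharE.
rewrite young // sum_cfunE rmorph_sum; apply: eq_bigr => l pl.
have [dl sl El] := diag_seqP pl; rewrite val_diag_of // El.
rewrite (Iirr_diagramE dl sl iP young) El cfunE rmorphM /=.
have [_ /(_ s)/intrP[c ->] _ _] := iP l pl.
by rewrite floorK ?intr_int.
Qed.
End IrrDiagram.
End DiagramCharacters.

(** * Monomials, and the monoid of vectors *)

Section MonomialsAndVectors.
Import GRing.Theory.
Local Open Scope ring_scope.

Section Monomials.
Variable I : choiceType.
Implicit Types (a b m : {cmonom I}).

Lemma cm_ext a b : (forall i, a i = b i) -> a = b.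
Proof. by move=> ab; apply/eqP/cmP. Qed.

Lemma expcmnS a n : expcmn a n.+1 = mmul a (expcmn a n).
Proof. by case: n => [|n] //; rewrite [RHS]mulm1. Qed.

Lemma cmX a n i : expcmn a n i = (n * a i)%N.
Proof.
elim: n => [|n IH]; first by rewrite mul0n; apply: onecmE.
by rewrite expcmnS cmM IH mulSn.
Qed.

Lemma cm_prod T (r : seq T) (P : pred T) (F : T -> {cmonom I}) i :
  (\big[mmul/mone]_(x <- r | P x) F x) i = (\sum_(x <- r | P x) F x i)%N.
Proof.
elim/big_rec2: _ => [|x n m _ <-]; [exact: cm1 | exact: cmM].
Qed.

Lemma mdegX a n : mdeg (expcmn a n) = (n * mdeg a)%N.
Proof.
elim: n => [|n IH]; first by rewrite mul0n; apply: mdeg1.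
by rewrite expcmnS mdegM IH mulSn.
Qed.

Lemma cm_leq_mdeg m i : (m i <= mdeg m)%N.
Proof.
rewrite mdegE; case: mdomP => // im.
by rewrite (big_fsetD1 i) //= leq_addr.
Qed.
End Monomials.

Section Vectors.
Implicit Types (k : vec).

Lemma vec_bound_ex k : exists B, forall i, k i != 0%N -> (i < B)%N.
Proof.
exists (\max_(i <- finsupp k) i).+1 => i ki; rewrite ltnS.
by apply: leq_bigmax_seq => //; rewrite -cmE_neq0.
Qed.

Lemma big_vec (R : Type) (idx : R) (op : Monoid.com_law idx) k B (F : nat -> R) :
  (forall i, k i != 0%N -> (i < B)%N) -> (forall i, k i = 0%N -> F i = idx) ->
  \big[op/idx]_(i <- finsupp k) F i = \big[op/idx]_(i < B) F i.
Proof.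
move=> kB F0; rewrite -(big_mkord xpredT) [RHS](bigID [in finsupp k]) /=.
rewrite [X in op _ X]big1 ?Monoid.mulm1; last first.
  by move=> i; rewrite -cmE_neq0 negbK => /eqP/F0.
rewrite -[RHS]big_filter; apply/perm_big/uniq_perm; rewrite ?filter_uniq ?iota_uniq //.
  exact: fset_uniq.
move=> i; rewrite mem_filter mem_index_iota /= andb_idr //.
by rewrite -cmE_neq0 => /kB.
Qed.

Lemma vsize_bound k B : (forall i, k i != 0%N -> (i < B)%N) ->
  vsize k = (\sum_(i < B) i.+1 * k i)%N.
Proof. by move=> kB; apply: big_vec => // i ->; rewrite muln0. Qed.

Lemma vec_bound2 k k' : exists B, (forall i, k i != 0%N -> (i < B)%N) /\
  (forall i, k' i != 0%N -> (i < B)%N).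
Proof.
have [B kB] := vec_bound_ex k; have [B' kB'] := vec_bound_ex k'.
exists (maxn B B'); split=> i; first by move/kB => h; rewrite leq_max h.
by move/kB' => h; rewrite leq_max h orbT.
Qed.

Lemma vsizeM k k' : vsize (mmul k k') = (vsize k + vsize k')%N.
Proof.
have [B [kB kB']] := vec_bound2 k k'; rewrite !(@vsize_bound _ B) //.
  by rewrite -big_split; apply: eq_bigr => i _; rewrite cmM mulnDr.
by move=> i; rewrite cmM addn_eq0 negb_and => /orP[/kB|/kB'].
Qed.

Lemma vsize1 : vsize mone = 0%N.
Proof. by rewrite /vsize mdom1 big_seq_fset0. Qed.

Lemma vsizeU i : vsize (ucm i) = i.+1.
Proof. by rewrite /vsize mdomU big_seq_fset1 cmUU muln1. Qed.

Lemma vsizeX k n : vsize (expcmn k n) = (n * vsize k)%N.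
Proof.
elim: n => [|n IH]; first by rewrite mul0n; apply: vsize1.
by rewrite expcmnS vsizeM IH mulSn.
Qed.

Lemma vsize_prod T (r : seq T) (P : pred T) (F : T -> vec) :
  vsize (\big[mmul/mone]_(x <- r | P x) F x) = (\sum_(x <- r | P x) vsize (F x))%N.
Proof. exact/big_morph/vsize1/vsizeM. Qed.

Lemma vsize_vdil d k : (0 < d)%N -> vsize (vdil d k) = (d * vsize k)%N.
Proof.
move=> d0; rewrite vsize_prod big_distrr /=; apply: eq_bigr => i _.
by rewrite vsizeX vsizeU prednK ?muln_gt0 ?d0 // mulnC mulnA.
Qed.

Lemma mdeg_leq_vsize k : (mdeg k <= vsize k)%N.
Proof. by rewrite mdegE /vsize; apply: leq_sum => i _; rewrite leq_pmull. Qed.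

Lemma cm_leq_vsize k i : k i != 0%N -> (i < vsize k)%N.
Proof.
move=> ki; have ik : i \in finsupp k by rewrite -cmE_neq0.
rewrite /vsize (big_fsetD1 i) //=; apply: leq_trans (leq_addr _ _).
by rewrite leq_pmulr // lt0n.
Qed.

Variable R : comNzRingType.
Implicit Types (h : nat -> R).

(** The multiplicative extension of h to vectors. [Upsilon] is the instance where [h i] is the power
    sum of degree i+1. *)
Definition vprod h k : R := \prod_(i <- finsupp k) h i ^+ k i.

Lemma vprod_bound h k B : (forall i, k i != 0%N -> (i < B)%N) ->
  vprod h k = \prod_(i < B) h i ^+ k i.
Proof. by move=> kB; apply: big_vec => // i ->; rewrite expr0. Qed.

Lemma vprodM h k k' : vprod h (mmul k k') = vprod h k * vprod h k'.
Proof.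
have [B [kB kB']] := vec_bound2 k k'; rewrite !(@vprod_bound _ _ B) //.
  by rewrite -big_split; apply: eq_bigr => i _; rewrite cmM exprD.
by move=> i; rewrite cmM addn_eq0 negb_and => /orP[/kB|/kB'].
Qed.

Lemma vprod1 h : vprod h mone = 1.
Proof. by rewrite /vprod mdom1 big_seq_fset0. Qed.

Lemma vprodU h i : vprod h (ucm i) = h i.
Proof. by rewrite /vprod mdomU big_seq_fset1 cmUU expr1. Qed.

Lemma vprodX h k n : vprod h (expcmn k n) = vprod h k ^+ n.
Proof.
elim: n => [|n IH]; first by rewrite expr0; apply: vprod1.
by rewrite expcmnS vprodM IH exprS.
Qed.

Lemma vprod_big h T (r : seq T) (P : pred T) (F : T -> vec) :
  vprod h (\big[mmul/mone]_(x <- r | P x) F x) = \prod_(x <- r | P x) vprod h (F x).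
Proof. exact/big_morph/vprod1/vprodM. Qed.

Lemma vprod_vdil h d k : vprod h (vdil d k) = vprod (fun i => h (d * i.+1).-1%N) k.
Proof. by rewrite vprod_big; apply: eq_bigr => i _; rewrite vprodX vprodU. Qed.
End Vectors.

Lemma vdil_big h (k : vec) d : (vdil d k) h =
  (\sum_(i <- finsupp k) k i * ((d * i.+1).-1 == h))%N.
Proof. by rewrite cm_prod; apply: eq_bigr => i _; rewrite cmX cmU. Qed.

Lemma vdilE (k : vec) d i : (0 < d)%N -> vdil d k (d * i.+1).-1 = k i.
Proof.
move=> d0; rewrite vdil_big; have E j : ((d * j.+1).-1 == (d * i.+1).-1) = (j == i).
  apply/eqP/eqP => [|->] // /(congr1 S); rewrite !prednK ?muln_gt0 ?d0 //.
  by move/eqP; rewrite eqn_pmul2l // => /eqP[].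
have [ik|ik] := boolP (i \in finsupp k); last first.
  rewrite (eqP (_ : k i == 0%N)) ?cmE_eq0 // big1_seq // => j /andP[_ jk].
  by rewrite E; case: eqP jk => [->|_ _]; rewrite ?(negPf ik) // muln0.
rewrite (big_fsetD1 i) //= eqxx muln1 big1_seq ?addn0 // => j.
by rewrite in_fsetD1 E => /andP[_ /andP[/negPf-> _]]; rewrite muln0.
Qed.

Lemma vdil_out (k : vec) d h : (0 < d)%N ->
  (forall i, h != (d * i.+1).-1) -> vdil d k h = 0%N.
Proof.
move=> d0 hd; rewrite vdil_big big1_seq // => i _.
by rewrite eq_sym (negPf (hd i)) muln0.
Qed.

Lemma vdil_comp (k : vec) d e : (0 < d)%N -> (0 < e)%N ->
  vdil e (vdil d k) = vdil (e * d) k.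
Proof.
move=> d0 e0; apply: cm_ext => h.
have ed0 : (0 < e * d)%N by rewrite muln_gt0 e0.
have [[i hi]|no] := pselect (exists i, h = (e * d * i.+1).-1).
  rewrite hi vdilE // -[(e * d * i.+1)%N]mulnA.
  have -> : (d * i.+1)%N = (d * i.+1).-1.+1 by rewrite prednK ?muln_gt0 ?d0.
  by rewrite !vdilE.
rewrite (vdil_out _ ed0); last by move=> i; apply/eqP => hi; apply: no; exists i.
have [[i hi]|no'] := pselect (exists i, h = (e * i.+1).-1).
  rewrite hi vdilE //; apply: vdil_out => // j; apply/eqP => ij.
  apply: no; exists j; rewrite hi ij prednK ?muln_gt0 ?d0 //.
  by rewrite mulnA.
by apply: vdil_out => // i; apply/eqP => hi; apply: no'; exists i.
Qed.

Lemma vdil1 (k : vec) : vdil 1 k = k.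
Proof.
by apply: cm_ext => i; have := @vdilE k 1 i isT; rewrite mul1n.
Qed.
End MonomialsAndVectors.

(** * Permutations of prescribed cycle type *)

Section CycleTypes.
Import GroupScope.

Section Cycles.
Variables (n : nat) (ks : seq nat).
Hypotheses (ks_pos : 0 \notin ks) (size_ks : sumn ks = n).
Implicit Types x y : 'I_n.
Let len x := nth 0 ks (box_row ks x).

(* The boxes of ks, numbered in reading order, are the points; every row is
   rotated by one step. *)
Lemma rotate_ex x : exists y, (box_row ks y == box_row ks x) &&
  (box_col ks y == (box_col ks x).+1 %% len x).
Proof.
have lx : 0 < len x by apply: leq_trans (box_col_lt size_ks x).
have [y [<- <-]] := box_ex size_ks (ltn_pmod (box_col ks x).+1 lx).
by exists y; rewrite !eqxx.
Qed.

Definition rotate x := xchoose (rotate_ex x).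

Lemma rotate_row x : box_row ks (rotate x) = box_row ks x.
Proof. by have /andP[/eqP] := xchooseP (rotate_ex x). Qed.

Lemma rotate_col x : box_col ks (rotate x) = (box_col ks x).+1 %% len x.
Proof. by have /andP[_ /eqP] := xchooseP (rotate_ex x). Qed.

Lemma rotate_inj : injective rotate.
Proof.
move=> x y xy; have r : box_row ks x = box_row ks y by rewrite -(rotate_row x) -(rotate_row y) xy.
apply: (box_inj r); have /eqP := congr1 (box_col ks) xy.
rewrite !rotate_col /len -r -!(addn1 (box_col _ _)) eqn_modDr.
rewrite !modn_small ?(box_col_lt size_ks) // => [/eqP//|].
by rewrite r (box_col_lt size_ks).
Qed.

Definition rotate_perm : 'S_n := perm rotate_inj.

Lemma rotate_iter x m : box_row ks ((rotate_perm ^+ m) x) = box_row ks x /\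
  box_col ks ((rotate_perm ^+ m) x) = (box_col ks x + m) %% len x.
Proof.
elim: m => [|m [IHr IHc]].
  by rewrite expg0 perm1 addn0 modn_small // (box_col_lt size_ks).
rewrite expgSr permM permE rotate_row rotate_col IHr; split=> //.
by rewrite /len IHr -/(len x) IHc -addn1 modnDml addn1 addnS.
Qed.

Lemma porbit_rotate x :
  porbit rotate_perm x = [set y | box_row ks y == box_row ks x].
Proof.
apply/setP => y; rewrite inE; apply/porbitP/eqP => [[m ->]|yx].
  by case: (rotate_iter x m).
exists (box_col ks y + (len x - box_col ks x)).
have [r c] := rotate_iter x (box_col ks y + (len x - box_col ks x)).
apply: (@box_inj n ks); first by rewrite r.
rewrite c addnCA subnKC; last by rewrite ltnW // (box_col_lt size_ks).
by rewrite modnDr modn_small // /len -yx (box_col_lt size_ks).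
Qed.

Lemma cycle_count_rotate i : #|[set c in porbits rotate_perm | #|c| == i]| =
  count_mem i ks.
Proof.
pose f (r : 'I_(size ks)) : {set 'I_n} := [set y | box_row ks y == r].
have cf r : #|f r| = nth 0 ks r by apply: card_box_row.
have fne (r : 'I_(size ks)) : exists y : 'I_n, box_row ks y = r.
  have [|y [yr _]] := @box_ex n ks size_ks r 0; last by exists y.
  by rewrite lt0n; apply: contra ks_pos => /eqP E; rewrite -[X in X \in _]E mem_nth.
have finj : injective f.
  move=> r r' E; apply: val_inj; have [y yr] := fne r.
  by have := congr1 (fun S : {set 'I_n} => y \in S) E; rewrite !inE yr eqxx => /esym/eqP.
rewrite -sum1_count (big_nth 0) big_mkord sum1_card.
rewrite -(card_imset _ finj); apply: eq_card => c; rewrite inE.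
apply/andP/imsetP => [[/imsetP[x _ ->] ci]|[r ri ->]].
  pose r := Ordinal (box_row_lt size_ks x).
  have E : porbit rotate_perm x = f r by apply: porbit_rotate.
  by exists r; rewrite // !unfold_in /= -(cf r) -E.
rewrite cf; split; last by move: ri; rewrite unfold_in.
have [y yr] := fne r; apply/imsetP; exists y => //.
by rewrite porbit_rotate yr.
Qed.
End Cycles.

(** [chi] is evaluated at [repr (conj_class k)], which lies in the class only if the class is
    inhabited. The list [ks] contains the length i+1 exactly [k i] times. *)
Lemma conj_class_neq0 (k : vec) : exists s, s \in conj_class k.
Proof.
pose ks := flatten [seq nseq (k i) i.+1 | i <- iota 0 (vsize k)].
have size_ks : sumn ks = vsize k.
  rewrite sumn_flatten -map_comp sumnE big_map.
  have -> : iota 0 (vsize k) = index_iota 0 (vsize k) by rewrite /index_iota subn0.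
  rewrite big_mkord [RHS](@vsize_bound _ (vsize k)); last exact: cm_leq_vsize.
  by apply: eq_bigr => i _; rewrite /= sumn_nseq.
have ks_pos : 0 \notin ks.
  apply/negP => /flattenP[u /mapP[i _ ->]].
  by rewrite mem_nseq andbC.
exists (rotate_perm size_ks); rewrite inE; apply/forallP => i.
rewrite cycle_count_rotate // count_flatten -map_comp sumnE big_map.
have -> : iota 0 (vsize k) = index_iota 0 (vsize k) by rewrite /index_iota subn0.
rewrite big_mkord (bigD1 i) //= count_nseq /= eqxx mul1n big1 ?addn0 // => j ji.
by rewrite count_nseq /= eqSS (inj_eq val_inj) (negPf ji).
Qed.
End CycleTypes.

(** * Truncation of power series and Frobenius' formula *)

Section FrobeniusFormula.
Import GRing.Theory.
Local Open Scope ring_scope.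

Section Congruence.
Variables (I : choiceType) (K : fieldType).
Implicit Types (f g : fps I K) (m a b : {cmonom I}).

Lemma fps_coef0 m : coef (0 : fps I K) m = 0. Proof. by []. Qed.
Lemma fps_coefD f g m : coef (f + g) m = coef f m + coef g m. Proof. by []. Qed.
Lemma fps_coefZ c f m : coef (c *: f) m = c * coef f m. Proof. by []. Qed.
Lemma fps_coef1 m : coef (1 : fps I K) m = (m == mone)%:R. Proof. by []. Qed.

Lemma fps_coef_sum T (r : seq T) (P : pred T) (F : T -> fps I K) m :
  coef (\sum_(x <- r | P x) F x) m = \sum_(x <- r | P x) coef (F x) m.
Proof. exact: (big_morph (fun f => coef f m) (fun f g => fps_coefD f g m) (fps_coef0 m)). Qed.

Lemma coef_fps_sum (T : choiceType) (D : set T) (F : T -> fps I K) m :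
  coef (fps_sum D F) m = \sum_(x \in D) coef (F x) m.
Proof. by []. Qed.

Lemma fps_coefM f g m : coef (f * g) m =
  \sum_(p \in [set p : {cmonom I} * {cmonom I} | mmul p.1 p.2 = m]%classic)
     coef f p.1 * coef g p.2.
Proof. by []. Qed.

Lemma fps_monM a b : fps_mon K a * fps_mon K b = fps_mon K (mmul a b).
Proof.
apply: fpsP => m; rewrite fps_coefM /=; have [->|mab] := eqVneq m (mmul a b).
  rewrite (fsbigE [:: (a, b)]) //=.
  - by rewrite big_mkcond big_seq1 ifT /= ?eqxx ?mulr1 ?inE.
  - by move=> p; rewrite /= inE => /eqP->.
  - move=> [p q] /= _; rewrite inE xpair_eqE negb_and.
    by case/orP => /negPf->; rewrite ?mul0r ?mulr0.
rewrite fsbig1 // => -[p q] /= pqm.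
case: eqP => [pa|]; last by rewrite mul0r.
case: eqP => [qb|]; last by rewrite mulr0.
by rewrite -pqm pa qb eqxx in mab.
Qed.

Lemma fps_mon1 : fps_mon K (mone : {cmonom I}) = 1.
Proof. by []. Qed.

Lemma fps_mon_prod T (r : seq T) (P : pred T) (F : T -> {cmonom I}) :
  \prod_(x <- r | P x) fps_mon K (F x) = fps_mon K (\big[mmul/mone]_(x <- r | P x) F x).
Proof. by symmetry; apply: (big_morph _ (fun a b => esym (fps_monM a b)) fps_mon1). Qed.

(** The coefficients of a product on such a set depend only on those of the factors on the same set,
    so agreement there is a congruence. The instances are the monomials in few variables and those
    of small degree. *)
Definition divclosed (D : {cmonom I} -> Prop) := forall a b, D (mmul a b) -> D a /\ D b.

Definition eqon (D : {cmonom I} -> Prop) f g := forall m, D m -> coef f m = coef g m.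

Section EqOn.
Variables (D : {cmonom I} -> Prop) (HD : divclosed D).

Lemma eqonM f f' g g' : eqon D f f' -> eqon D g g' -> eqon D (f * g) (f' * g').
Proof.
move=> ff gg m Dm; rewrite !fps_coefM; apply: eq_fsbigr => p /set_mem /= pm.
by have [D1 D2] := HD (eq_ind_r D Dm pm); rewrite ff ?gg.
Qed.

Lemma eqon_prod T (r : seq T) (P : pred T) (F G : T -> fps I K) :
  (forall x, P x -> eqon D (F x) (G x)) ->
  eqon D (\prod_(x <- r | P x) F x) (\prod_(x <- r | P x) G x).
Proof.
by move=> FG; apply: (big_ind2 (eqon D)) => // f f' g g' ff gg; apply: eqonM.
Qed.

Lemma eqonX n f g : eqon D f g -> eqon D (f ^+ n) (g ^+ n).
Proof. by move=> fg; elim: n => [|n IH] //; rewrite !exprS; apply: eqonM. Qed.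

End EqOn.
End Congruence.

Section Frobenius.
Variables (L : nat) (K : fieldType) (alpha : 'I_L).
Local Notation PS := (fps ('I_L * nat)%type K).
Local Notation mon := {cmonom ('I_L * nat)%type}.
Implicit Types (m : mon).

Lemma xpowE i d v : xpow alpha i d v = (d * ((v.1 == alpha) && (v.2 == i)))%N.
Proof. by rewrite cmX cmU eq_sym -pair_eqE. Qed.

Definition few_vars r m := forall v, (r <= v.2)%N -> m v = 0%N.

Lemma few_vars_divclosed r : divclosed (few_vars r).
Proof.
move=> a b ab; split=> v /ab /eqP; rewrite cmM addn_eq0 => /andP[/eqP ea /eqP eb] //.
Qed.

Lemma few_vars_ex m : exists r, few_vars r m.
Proof.
exists (\max_(v <- finsupp m) v.2).+1 => v vm; apply/eqP; rewrite cmE_eq0.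
apply: contraTN vm => vm; rewrite -ltnNge ltnS.
exact: (leq_bigmax_seq (F := snd) v vm).
Qed.

Lemma power_sum_trunc r j : (0 < j)%N ->
  eqon (few_vars r) (power_sum K alpha j)
       (\sum_(i < r) fps_mon K (xpow alpha i j)).
Proof.
move=> j0 m mr; rewrite coef_fps_sum fps_coef_sum (fsbigE (iota 0 r)) //=.
- rewrite (_ : iota 0 r = index_iota 0 r) ?big_mkord; last first.
    by rewrite /index_iota subn0.
  by apply: eq_bigl => i; apply/mem_set.
- exact: iota_uniq.
- move=> i _; rewrite mem_iota -leqNgt /= => ri; case: eqP => // mi.
  have := mr (alpha, i) ri; rewrite mi xpowE /= !eqxx muln1 => j00.
  by rewrite j00 in j0.
Qed.

Definition monl e (u : seq nat) : mon := \big[mmul/mone]_(y <- u) xpow alpha y e.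

Lemma monlE e u v : monl e u v = ((v.1 == alpha) * (e * count_mem v.2 u))%N.
Proof.
rewrite cm_prod; elim: u => [|y u IH]; first by rewrite big_nil !muln0.
rewrite big_cons IH xpowE /= (eq_sym v.2).
case: (v.1 == alpha) => /=; last by rewrite !mul0n muln0.
by rewrite !mul1n mulnDr.
Qed.

Definition good_mon e m :=
  (forall v, v.1 != alpha -> m v = 0%N) /\ forall i, (e %| m (alpha, i))%N.

(** The condition on m is separated from the condition on u, so that summing over u gives either 0
    or the number of words of one content. *)
Lemma monl_eq e r m u : (0 < e)%N -> few_vars r m ->
  (m == monl e u) =
  `[< good_mon e m >] && (all (gtn r) u &&
     all (fun c => count_mem c u == (m (alpha, c) %/ e)%N) (iota 0 r)).
Proof.
move=> e0 mr; apply/eqP/andP => [mE|[/asboolP[m0 em] /andP[ur uc]]].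
  have cE i : count_mem i u = (m (alpha, i) %/ e)%N.
    by rewrite mE monlE eqxx mul1n mulKn.
  split; first apply/asboolP.
    split=> [v va|i]; first by rewrite mE monlE (negPf va).
    by rewrite mE monlE eqxx mul1n dvdn_mulr.
  apply/andP; split; last by apply/allP => c _; rewrite cE.
  apply/allP => y yu; rewrite /= ltnNge; apply/negP => ry.
  move: yu; rewrite -has_pred1 has_count cE.
  by rewrite (mr (alpha, y)) // div0n.
apply: cm_ext => -[beta i]; rewrite monlE /=.
have [->|ba] := eqVneq beta alpha; last by rewrite mul0n m0.
rewrite mul1n; have [ir|ri] := ltnP i r.
  have /eqP-> : count_mem i u == (m (alpha, i) %/ e)%N.
    by apply: (allP uc); rewrite mem_iota.
  by rewrite mulnC divnK.
rewrite (mr (alpha, i)) // (_ : count_mem i u = 0%N) ?muln0 //.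
by apply/count_memPn/negP => /(allP ur); rewrite /= ltnNge ri.
Qed.

Lemma coef_schur e r m (R : diagram) : (0 < e)%N -> few_vars r m ->
  coef (schur K R alpha e) m =
  if `[< good_mon e m >] then
    (kostka r (fun c => m (alpha, c) %/ e)%N (shape_of (boxes R) (val R)))%:R
  else 0.
Proof.
move=> e0 mr; pose nu c := (m (alpha, c) %/ e)%N; rewrite coef_fps_sum /=.
have E T : (m == \big[mmul/mone]_(y <- flatten T) xpow alpha y e) =
    `[< good_mon e m >] && has_weight r nu T by exact: monl_eq.
under eq_fsbigr do rewrite E.
case: asboolP => _ /=; last by rewrite fsbig1.
have dR := valP R; have sR : sumn (val R) = boxes R by [].
rewrite (fsbigE (ssyt_list (boxes R) r nu (val R))) ?ssyt_list_uniq //=.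
- rewrite -(size_ssyt_list _ r nu (val R)) -sum1_size natr_sum big_mkcond /=.
  rewrite big_seq [RHS]big_seq; apply: eq_bigr => T; rewrite mem_ssyt_list //.
  by case/andP => sT ->; rewrite ifT //; apply/mem_set.
- by move=> T /=; rewrite mem_ssyt_list // => /andP[].
- by move=> T /= sT; rewrite mem_ssyt_list // sT /= => /negPf->.
Qed.

Lemma cycle_type_count (k : vec) s i : s \in conj_class k ->
  #|[set c in porbits s | #|c| == i.+1]| = k i.
Proof.
rewrite inE => /forallP sk; have [ik|ki] := ltnP i (vsize k).
  exact/eqP/(sk (Ordinal ik)).
rewrite (_ : [set _ in _ | _] = finset.set0) ?cards0; last first.
  apply/setP => c; rewrite !inE; apply/negbTE/negP => /andP[_ /eqP ci].
  by have := max_card (mem c); rewrite card_ord ci ltnNge ki.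
by apply/esym/eqP; apply: contraTT ki => /cm_leq_vsize; rewrite -ltnNge.
Qed.

Lemma Upsilon_porbits e (k : vec) s : (0 < e)%N -> s \in conj_class k ->
  Upsilon K (vdil e k) alpha =
  \prod_(c in porbits s) power_sum K alpha (e * #|c|).
Proof.
move=> e0 sk; rewrite /Upsilon -/(vprod (fun i => power_sum K alpha i.+1) (vdil e k)).
rewrite vprod_vdil (@vprod_bound _ _ _ (vsize k).+1); last first.
  by move=> i /cm_leq_vsize/ltnW.
have c1 c : c \in porbits s -> (0 < #|c|)%N.
  by case/imsetP => x _ ->; apply/card_gt0P; exists x; apply: porbit_id.
have cn (c : {set 'I_(vsize k)}) : (#|c|.-1 < (vsize k).+1)%N.
  rewrite ltnS (leq_trans (leq_pred _)) // -[leqRHS]card_ord.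
  exact: max_card.
rewrite [RHS](partition_big (fun c : {set 'I_(vsize k)} => inord #|c|.-1 : 'I_(vsize k).+1) predT) //=.
apply: eq_bigr => i _; rewrite prednK ?muln_gt0 ?e0 // -(cycle_type_count i sk).
rewrite -[LHS]prodr_const; apply: eq_big => [c|c].
  rewrite inE; apply: andb_id2l => /c1 cc.
  by rewrite -(inj_eq val_inj) /= inordK ?cn //; case: #|c| cc.
by rewrite inE => /andP[_ /eqP->].
Qed.

(** Choosing a variable for every cycle amounts to colouring the points constantly along cycles,
    that is, to a word fixed by s. A cycle of length c carries the exponent e times c, one e for
    each of its points. *)
Lemma porbits_expand r e n (s : 'S_n) : (0 < e)%N ->
  \prod_(c in porbits s) \sum_(i < r) fps_mon K (xpow alpha i (e * #|c|)) =
  \sum_(f : {ffun 'I_n -> 'I_r} | ffact f s == f)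
     fps_mon K (monl e [seq val (f x) | x <- enum 'I_n]).
Proof.
move=> e0; rewrite big_sub bigA_distr_bigA /=.
have px x : porbit s x \in porbits s by apply: imset_f.
pose h (g : {ffun {c | c \in porbits s} -> 'I_r}) : {ffun 'I_n -> 'I_r} :=
  [ffun x => g (Sub (porbit s x) (px x))].
have repP (c : {c | c \in porbits s}) : exists x, porbit s x == val c.
  by have /imsetP[x _ ->] := valP c; exists x.
pose h' (f : {ffun 'I_n -> 'I_r}) : {ffun {c | c \in porbits s} -> 'I_r} :=
  [ffun c => f (xchoose (repP c))].
rewrite [RHS](reindex_onto h h') => [|f]; last first.
  rewrite ffact_id => /forallP fs; apply/ffunP => x; rewrite !ffunE.
  have := xchooseP (repP (Sub (porbit s x) (px x))).
  move: (xchoose _) => y /eqP; rewrite SubK => yx; have : x \in porbit s y by rewrite yx porbit_id.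
  case/porbitP => j ->; elim: j => [|j IH]; first by rewrite expg0 perm1.
  by rewrite expgSr permM (eqP (fs _)).
apply: eq_big => [g|g _].
  rewrite ffact_id; apply/esym/andP; split.
    apply/forallP => x; rewrite !ffunE; apply/eqP; congr (g _).
    have sx : s x \in porbit s x by rewrite -{1}[s]expg1 mem_porbit.
    by apply: val_inj; apply/eqP; rewrite /= eq_porbit_mem.
  apply/eqP/ffunP => c; rewrite !ffunE; congr (g _); apply: val_inj.
  by rewrite /= (eqP (xchooseP (repP c))).
rewrite fps_mon_prod; congr (fps_mon K _); rewrite /monl big_map big_enum /=.
rewrite [RHS](partition_big (fun x => Sub (porbit s x) (px x) : {c | c \in porbits s}) predT) //=.
apply: eq_bigr => c _; apply: cm_ext => v.
rewrite cm_prod xpowE (eq_bigr (fun=> xpow alpha (g c) e v)); last first.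
  by move=> x /eqP <-; rewrite ffunE.
rewrite sum_nat_const xpowE mulnA [(_ * e)%N]mulnC; congr (_ * _ * _)%N.
have /imsetP[x0 _ cx0] := valP c.
apply: eq_card => x; rewrite -[RHS]/(Sub (porbit s x) (px x) == c).
by rewrite -val_eqE /= cx0 eq_porbit_mem.
Qed.

Lemma Upsilon_schur e (k : vec) : (0 < e)%N ->
  Upsilon K (vdil e k) alpha =
  \sum_(R \in [set R : diagram | boxes R = vsize k]%classic)
     (chi R k)%:~R *: schur K R alpha e.
Proof.
move=> e0; have [s0 s0k] := conj_class_neq0 k.
pose s := fingroup.repr (conj_class k).
have sk : s \in conj_class k by apply: mem_repr s0k.
apply: fpsP => m; have [r mr] := few_vars_ex m.
rewrite (Upsilon_porbits e0 sk).
have /(_ m mr) -> : eqon (few_vars r)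
    (\prod_(c in porbits s) power_sum K alpha (e * #|c|))
    (\prod_(c in porbits s) \sum_(i < r) fps_mon K (xpow alpha i (e * #|c|))).
  apply: eqon_prod; first exact: few_vars_divclosed.
  move=> c /imsetP[x _ ->]; apply: power_sum_trunc.
  by rewrite muln_gt0 e0; apply/card_gt0P; exists x; apply: porbit_id.
rewrite porbits_expand // fps_coef_sum /= fsbig_diagrams fps_coef_sum.
under eq_bigr do rewrite (monl_eq _ e0 mr).
under [RHS]eq_bigr do rewrite fps_coefZ (coef_schur _ e0 mr).
case: asboolP => _ /=; last first.
  by rewrite !big1 // => l _; rewrite mulr0.
pose nu c := (m (alpha, c) %/ e)%N.
have wE (f : {ffun 'I_(vsize k) -> 'I_r}) :
    all (gtn r) [seq val (f x) | x <- enum 'I_(vsize k)] &&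
    all (fun c => count_mem c [seq val (f x) | x <- enum 'I_(vsize k)] == nu c)
      (iota 0 r) = has_content nu f.
  have cE (c : 'I_r) : count_mem (val c) [seq val (f x) | x <- enum 'I_(vsize k)] = content f c.
    rewrite content_tuple /= map_comp count_map; apply: eq_count => x /=.
    exact: (inj_eq val_inj).
  apply/andP/has_contentP => [[_ /allP h] c|h].
    by rewrite -cE; apply/eqP/h; rewrite mem_iota /=.
  split; first by apply/allP => _ /mapP[x _ ->]; rewrite /=.
  apply/allP => c; rewrite mem_iota add0n => /andP[_ cr].
  by rewrite -(h (Ordinal cr)) -cE.
under eq_bigr do rewrite wE.
rewrite -natr_sum -big_mkcondr /=.
rewrite (_ : (\sum_(f : {ffun _ -> _} | _) 1)%N = fixcount r nu s); last first.
  by rewrite /fixcount -sum1dep_card; apply: eq_bigl => f; rewrite andbC.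
(* Young's rule requires the content to have sum [vsize k]; for a monomial of any other degree there
   are neither words nor tableaux, and both sides are 0. *)
have [nun|nun] := eqVneq (psum nu r) (vsize k); last first.
  rewrite /fixcount (_ : [set _ | _]%SET = finset.set0) ?cards0; last first.
    apply/setP => f; rewrite !inE; apply/negbTE/negP => /andP[/has_contentP h _].
    by case/eqP: nun; rewrite -(sum_content f); apply: eq_bigr => c _; rewrite h.
  rewrite big1 // => l pl; rewrite (eqP (_ : kostka _ _ _ == 0%N)) ?mulr0 //.
  have [dl sl El] := diag_seqP pl.
  have bl : boxes (diag_of l) = vsize k by rewrite /boxes val_diag_of.
  apply: contraR nun => /kostka_ssize <-.
  by rewrite ssize_shape_of ?bl // (valP (diag_of l)).
rewrite pmulrn irr_diagram_fixcount // fsbig_diagrams rmorph_sum /=.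
apply: eq_bigr => l pl; have [dl sl El] := diag_seqP pl.
have bl : boxes (diag_of l) = vsize k by rewrite /boxes val_diag_of.
rewrite /chi bl eqxx rmorphM /= mulrC; congr (_ * _).
Qed.
End Frobenius.
End FrobeniusFormula.

(** * The substitution q -> q^d, lambda -> lambda^d as a ring morphism *)

Section DilationMorphism.
Import GRing.Theory.
Local Open Scope ring_scope.
Local Notation "x %:F" := (@FracField.tofrac _ x).

Lemma frac_repr (R : idomainType) (g : {fraction R}) :
  g = (\n_(repr g))%:F / (\d_(repr g))%:F.
Proof.
have d0 : (\d_(repr g))%:F != 0 by rewrite tofrac_eq0 denom_ratioP.
apply: (mulIf d0); rewrite divfK //.
rewrite -{1}[g]reprK; unlock FracField.tofrac.
rewrite -[LHS]FracField.pi_mul; apply/eqmodP; rewrite /= FracField.equivfE.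
by rewrite /FracField.mulf !numden_Ratio ?(oner_eq0, mulf_neq0, denom_ratioP) // !mulr1 mulrC.
Qed.

Lemma eq_div_cross (F : fieldType) (a b p q : F) : b != 0 -> q != 0 ->
  p * b = a * q -> a / b = p / q.
Proof. by move=> b0 q0 E; apply/eqP; rewrite eqr_div // E. Qed.

Lemma sub_div_cross (F : fieldType) (p q r s : F) : q != 0 -> s != 0 ->
  p / q - r / s = (p * s - r * q) / (q * s).
Proof. by move=> q0 s0; rewrite -mulNr addf_div // mulNr. Qed.

Section Dilate.
Variable C : fieldType.
Implicit Types (p q : {poly {poly C}}) (g h : ratfun C).

Lemma poly_dilD d p q : poly_dil d (p + q) = poly_dil d p + poly_dil d q.
Proof. by rewrite /poly_dil !rmorphD. Qed.

Lemma poly_dilM d p q : poly_dil d (p * q) = poly_dil d p * poly_dil d q.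
Proof. by rewrite /poly_dil !rmorphM. Qed.

Lemma poly_dil_1 d : poly_dil d (1 : {poly {poly C}}) = 1.
Proof. by rewrite /poly_dil !rmorph1. Qed.

Lemma poly_dilN d p : poly_dil d (- p) = - poly_dil d p.
Proof. by rewrite /poly_dil !rmorphN. Qed.

Lemma poly_dil_neq0 d p : (0 < d)%N -> (poly_dil d p == 0) = (p == 0).
Proof.
move=> d0; have sX (R : nzRingType) : (1 < size ('X^d : {poly R}))%N.
  by rewrite size_polyXn ltnS.
rewrite /poly_dil comp_poly_eq0 ?sX //; apply/eqP/eqP => [E|->]; last by rewrite rmorph0.
apply: (@map_inj_poly _ _ (comp_poly 'X^d)); rewrite ?E ?rmorph0 // => x y /eqP.
by rewrite -subr_eq0 -rmorphB /= comp_poly_eq0 ?sX // subr_eq0 => /eqP.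
Qed.

Lemma poly_dil_comp d e p : poly_dil e (poly_dil d p) = poly_dil (e * d) p.
Proof.
rewrite /poly_dil map_comp_poly /= -comp_polyA.
rewrite map_polyXn comp_Xn_poly -exprM; congr (_ \Po _).
rewrite -map_poly_comp /=; apply: eq_map_poly => x /=.
by rewrite -comp_polyA comp_Xn_poly -exprM.
Qed.

Lemma poly_dil1 p : poly_dil 1 p = p.
Proof.
rewrite /poly_dil expr1 comp_polyXr map_poly_id // => x _.
by rewrite expr1 comp_polyXr.
Qed.

(** [dilate] is defined on a chosen representative; cross multiplication is preserved by [poly_dil],
    whose injectivity keeps denominators nonzero, so any fraction may be used. *)
Lemma dilate_frac d p q : (0 < d)%N -> q != 0 ->
  dilate d (p%:F / q%:F : ratfun C) = (poly_dil d p)%:F / (poly_dil d q)%:F.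
Proof.
move=> d0 q0; rewrite /dilate; set g := (p%:F / q%:F : ratfun C).
set a := \n_(repr g); set b := \d_(repr g).
have b0 : b != 0 by apply: denom_ratioP.
have E : p * b = a * q.
  apply/eqP; rewrite -tofrac_eq !tofracM.
  have gE : p%:F / q%:F = a%:F / b%:F := frac_repr g.
  have qF : q%:F != 0 by rewrite tofrac_eq0.
  have bF : b%:F != 0 by rewrite tofrac_eq0.
  by rewrite -(eqr_div _ _ qF bF) gE.
have qF : (poly_dil d q)%:F != 0 by rewrite tofrac_eq0 poly_dil_neq0.
have bF : (poly_dil d b)%:F != 0 by rewrite tofrac_eq0 poly_dil_neq0.
have ED := congr1 (fun x => (poly_dil d x)%:F) E.
rewrite /= poly_dilM (poly_dilM d a q) tofracM (tofracM (poly_dil d a)) in ED.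
exact: (eq_div_cross bF qF ED).
Qed.

Lemma fracP g : exists p q, q != 0 /\ g = p%:F / q%:F.
Proof. by exists \n_(repr g), \d_(repr g); split; [apply: denom_ratioP|apply: frac_repr]. Qed.

Lemma tofrac_sub_div (p q r s : {poly {poly C}}) : q != 0 -> s != 0 ->
  p%:F / q%:F - r%:F / s%:F = (p * s - r * q)%:F / (q * s)%:F.
Proof.
move=> q0 s0; rewrite tofracB (tofracM p s) (tofracM r q) (tofracM q s).
by apply: sub_div_cross; rewrite tofrac_eq0.
Qed.

Lemma tofrac_mul_div (p q r s : {poly {poly C}}) :
  (p%:F / q%:F) * (r%:F / s%:F) = (p * r)%:F / (q * s)%:F.
Proof. by rewrite (tofracM p r) (tofracM q s) mulf_div. Qed.

Lemma dilate_zmod d : zmod_morphism (@dilate C d.+1).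
Proof.
move=> g h; have [p [q [q0 ->]]] := fracP g; have [r [s [s0 ->]]] := fracP h.
have qs0 : q * s != 0 by rewrite mulf_neq0.
rewrite tofrac_sub_div // (dilate_frac _ _ q0) // (dilate_frac _ _ s0) //.
rewrite (dilate_frac _ _ qs0) // poly_dilD poly_dilN !poly_dilM.
by rewrite tofrac_sub_div ?poly_dil_neq0.
Qed.

Lemma dilate_monoid d : monoid_morphism (@dilate C d.+1).
Proof.
split=> [|g h].
  have -> : (1 : ratfun C) = 1%:F / 1%:F by rewrite tofrac1 divr1.
  by rewrite dilate_frac ?oner_eq0 // poly_dil_1.
have [p [q [q0 ->]]] := fracP g; have [r [s [s0 ->]]] := fracP h.
have qs0 : q * s != 0 by rewrite mulf_neq0.
rewrite tofrac_mul_div (dilate_frac _ _ q0) // (dilate_frac _ _ s0) //.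
by rewrite (dilate_frac _ _ qs0) // !poly_dilM tofrac_mul_div.
Qed.

(** For d = 0 denominators could vanish. The shift of the index makes every member of the family a
    ring morphism without side condition. *)
Definition dilateS d : ratfun C -> ratfun C := dilate d.+1.

HB.instance Definition _ d := GRing.isZmodMorphism.Build (ratfun C) (ratfun C)
  (dilateS d) (@dilate_zmod d).
HB.instance Definition _ d := GRing.isMonoidMorphism.Build (ratfun C) (ratfun C)
  (dilateS d) (@dilate_monoid d).

Lemma dilate_comp d e g : (0 < d)%N -> (0 < e)%N ->
  dilate e (dilate d g) = dilate (e * d) g.
Proof.
move=> d0 e0; have [p [q [q0 ->]]] := fracP g.
rewrite !dilate_frac ?muln_gt0 ?e0 // ?poly_dil_neq0 //.
by rewrite !poly_dil_comp.
Qed.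

Lemma dilate1 g : dilate 1 g = g.
Proof. by have [p [q [q0 ->]]] := fracP g; rewrite dilate_frac // !poly_dil1. Qed.
End Dilate.
End DilationMorphism.

(** * The Moebius function *)

Section MobiusFunction.
Import GRing.Theory.
Local Open Scope ring_scope.

Lemma perm_primes_mul p d : prime p -> (0 < d)%N -> ~~ (p %| d)%N ->
  perm_eq (primes (p * d)%N) (p :: primes d).
Proof.
move=> pp d0 pd; apply: uniq_perm; first exact: primes_uniq.
  by rewrite /= primes_uniq mem_primes pp d0 (negPf pd).
by move=> q; rewrite primesM ?(prime_gt0 pp) // (primes_prime pp) !inE.
Qed.

Lemma mobius_mul p d : prime p -> (0 < d)%N -> ~~ (p %| d)%N ->
  mobius (p * d)%N = - mobius d.
Proof.
move=> pp d0 pd; have pe := perm_primes_mul pp d0 pd.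
have ld : logn p d = 0%N.
  by apply/eqP; rewrite -leqn0 leqNgt logn_gt0 mem_primes pp d0 (negPf pd).
rewrite /mobius (perm_all _ pe) (perm_size pe) /=.
rewrite lognM ?(prime_gt0 pp) // logn_prime // eqxx ld eqxx /=.
have -> : all (fun q => logn q (p * d)%N == 1)%N (primes d) =
          all (fun q => logn q d == 1)%N (primes d).
  apply: eq_in_all => q qd; rewrite lognM ?(prime_gt0 pp) //.
  have qp : prime q by move: qd; rewrite mem_primes => /andP[].
  have /negPf qnp : q != p.
    by apply: contraTneq qd => ->; rewrite mem_primes (negPf pd) !andbF.
  by rewrite logn_prime // qnp.
by case: ifP; rewrite ?oppr0 // exprS mulN1r.
Qed.

Lemma mobius_sq p d : prime p -> (0 < d)%N -> (p %| d)%N -> mobius (p * d)%N = 0.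
Proof.
move=> pp d0 pd; rewrite /mobius ifF //; apply/negbTE/allPn; exists p.
  by rewrite mem_primes pp muln_gt0 (prime_gt0 pp) d0 dvdn_mulr.
rewrite lognM ?(prime_gt0 pp) // logn_prime // eqxx.
have : (0 < logn p d)%N by rewrite logn_gt0 mem_primes pp d0 pd.
by case: (logn p d).
Qed.

(** With p the least prime factor of n and m = n/p, the divisors of n that are multiples of p are
    the p d with d dividing m. Those with p dividing d contribute 0; the others cancel the divisors
    of n prime to p. *)
Lemma sum_mobius n : (0 < n)%N ->
  \sum_(1 <= d < n.+1 | (d %| n)%N) mobius d = (n == 1%N)%:Z.
Proof.
move=> n0; have [->|n1] := eqVneq n 1%N.
  by rewrite big_mkcond big_nat1.
have pp : prime (pdiv n) by rewrite pdiv_prime //; case: n n0 n1 => [|[]].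
set p := pdiv n in pp; have pn : (p %| n)%N by apply: pdiv_dvd.
have p0 := prime_gt0 pp.
rewrite (bigID (fun d => p %| d)%N) /=.
suff -> : \sum_(1 <= d < n.+1 | (d %| n)%N && (p %| d)%N) mobius d =
    \sum_(1 <= d < n.+1 | (d %| n)%N && ~~ (p %| d)%N) - mobius d.
  by rewrite -big_split big1 //= => d _; rewrite addNr.
have [m nE] := dvdnP pn.
have m0 : (0 < m)%N by move: n0; rewrite nE muln_gt0 => /andP[].
have mn : (m <= n)%N by rewrite nE leq_pmulr.
transitivity (\sum_(1 <= d < m.+1 | (d %| m)%N) mobius (p * d)%N).
  rewrite [LHS]big_nat_cond [RHS]big_nat_cond -[LHS]big_filter -[RHS]big_filter.
  rewrite -(big_map (fun d => p * d)%N xpredT).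
  apply/perm_big/uniq_perm; rewrite ?filter_uniq ?iota_uniq //.
    rewrite map_inj_uniq ?filter_uniq ?iota_uniq // => a b /eqP.
    by rewrite eqn_pmul2l // => /eqP.
  move=> d; rewrite mem_filter mem_index_iota; apply/idP/mapP.
    case/andP=> /andP[d1 /andP[dn /dvdnP[c dE]]] _; exists c; last by rewrite mulnC.
    have c0 : (0 < c)%N by move: d1; rewrite dE; case: c {dE}.
    have cm : (c %| m)%N by move: dn; rewrite dE nE dvdn_pmul2r.
    by rewrite mem_filter mem_index_iota cm c0 ltnS dvdn_leq.
  case=> c; rewrite mem_filter mem_index_iota => /andP[/andP[c1 cm] _] ->.
  case/andP: c1 => c0 _.
  have pcn : (p * c %| n)%N by rewrite nE mulnC dvdn_pmul2r.
  by rewrite pcn dvdn_mulr //= muln_gt0 p0 c0 ltnS dvdn_leq.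
rewrite (bigID (fun d => p %| d)%N) /= big_nat_cond big1 ?add0r; last first.
  by move=> d /andP[/andP[d0 _] /andP[_ pd]]; rewrite mobius_sq.
rewrite [RHS](@big_cat_nat _ _ _ m.+1) //= [X in _ = _ + X]big_nat_cond.
rewrite [X in _ = _ + X]big_pred0 ?addr0.
  rewrite big_nat_cond [RHS]big_nat_cond; apply: eq_big => [d|d].
    apply: andb_id2l => /andP[d0 _]; apply: andb_id2r => pd.
    rewrite nE; apply/idP/idP => [dm|]; first by rewrite dvdn_mulr.
    by rewrite Gauss_dvdl // coprime_sym prime_coprime.
  by case/andP=> /andP[d0 _] /andP[_ pd]; rewrite mobius_mul.
move=> d; apply/negbTE/negP => /andP[/andP[md _] /andP[dn pd]].
have : (d %| m)%N by move: dn; rewrite nE Gauss_dvdl // coprime_sym prime_coprime.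
by move/(dvdn_leq m0); rewrite leqNgt md.
Qed.

(** Grouping the pairs by their product D leaves [H D / D] times the sum of mu over the divisors of
    D. For D at most N all factorizations of D lie in the range of summation, and beyond N the
    function vanishes. *)
Lemma mobius_inversion (K : fieldType) (H : nat -> K) N : (0 < N)%N ->
  (forall D, (N < D)%N -> H D = 0) ->
  \sum_(1 <= e < N.+1) \sum_(1 <= d < N.+1)
     (mobius d)%:~R / (e * d)%:R * H (e * d)%N = H 1%N.
Proof.
move=> N0 H0.
have E (e d : nat) : (0 < e)%N -> (0 < d)%N ->
    (mobius d)%:~R / (e * d)%:R * H (e * d)%N =
    \sum_(1 <= D < N.+1) (if D == (e * d)%N then (mobius d)%:~R / D%:R * H D else 0).
  move=> e0 d0; have [ND|DN] := ltnP N (e * d)%N.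
    rewrite H0 // mulr0 big_nat_cond big1 // => D /andP[/andP[_ DN] _].
    by case: eqP => // DE; move: DN; rewrite DE ltnS leqNgt ND.
  rewrite (bigD1_seq (e * d)%N) ?iota_uniq //=; last first.
    by rewrite mem_index_iota ltnS DN muln_gt0 e0 d0.
  by rewrite eqxx big1 ?addr0 // => D /negPf->.
transitivity (\sum_(1 <= D < N.+1) \sum_(1 <= e < N.+1) \sum_(1 <= d < N.+1)
   if D == (e * d)%N then (mobius d)%:~R / D%:R * H D else 0).
  rewrite [RHS]exchange_big /= big_nat_cond [RHS]big_nat_cond; apply: eq_bigr.
  move=> e /andP[/andP[e0 _] _]; rewrite [RHS]exchange_big /=.
  rewrite big_nat_cond [RHS]big_nat_cond.
  by apply: eq_bigr => d /andP[/andP[d0 _] _]; rewrite E.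
transitivity (\sum_(1 <= D < N.+1) (D == 1%N)%:R * (H D / D%:R)).
  rewrite big_nat_cond [RHS]big_nat_cond; apply: eq_bigr => D /andP[/andP[D0 DN] _].
  have -> : (D == 1%N)%:R = (\sum_(1 <= d < D.+1 | (d %| D)%N) mobius d)%:~R :> K.
    by rewrite sum_mobius // -pmulrn.
  rewrite exchange_big /= rmorph_sum mulr_suml /=.
  rewrite (@big_cat_nat _ _ _ D.+1) //=.
  rewrite [X in _ + X]big_nat_cond [X in _ + X]big1 ?addr0; last first.
    move=> d /andP[/andP[Dd _] _]; rewrite big_nat_cond big1 // => e.
    case/andP=> /andP[e0 _] _; case: eqP => // DE; move: Dd.
    by rewrite DE ltnNge leq_pmull.
  rewrite big_nat_cond [RHS]big_mkcond [RHS]big_nat_cond; apply: eq_bigr => d.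
  case/andP=> /andP[d0 dD] _; case: ifP => [/dvdnP[c cE]|nd]; last first.
    by rewrite big1 // => e _; case: eqP => // DE; rewrite DE dvdn_mull in nd.
  rewrite (bigD1_seq c) ?iota_uniq //=; last first.
    rewrite mem_index_iota; apply/andP; split.
      by move: D0; rewrite cE; case: (c).
    by apply: leq_ltn_trans DN; rewrite cE leq_pmulr.
  rewrite -cE eqxx big1 ?addr0 => [|e /negPf ec].
    by rewrite mulrAC mulrA.
  by rewrite cE eqn_pmul2r // eq_sym ec.
rewrite big_ltn // eqxx mul1r divr1 big_nat_cond big1 ?addr0 // => D.
by case/andP=> /andP[D1 _] _; rewrite gtn_eqF // mul0r.
Qed.
End MobiusFunction.

(** * Finite enumerations, homogeneity and degree bounds *)

Section FiniteSums.
Import GRing.Theory.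
Local Open Scope ring_scope.

Section Lists.
Variable T : choiceType.

(** Finiteness is stated through duplicate-free lists, because these replace finitely supported sums
    by ordinary ones. *)
Definition lists (r : seq T) (A : T -> Prop) := uniq r /\ forall x, x \in r <-> A x.

Lemma lists_of_inj (U : finType) (A : T -> Prop) (f : T -> U) :
  (forall x y, A x -> A y -> f x = f y -> x = y) -> exists r, lists r A.
Proof.
move=> finj; pose g u := if pselect (exists x, A x /\ f x = u) is left e
  then Some (projT1 (cid e)) else None.
exists (undup (pmap g (enum U))); split=> [|x]; first exact: undup_uniq.
rewrite mem_undup mem_pmap; split=> [/mapP[u _]|Ax].
  by rewrite /g; case: pselect => // e [->]; case: (cid e) => y [].
apply/mapP; exists (f x); first by rewrite mem_enum.
rewrite /g; case: pselect => [e|[]]; last by exists x.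
by case: (cid e) => y [Ay fxy] /=; congr Some; apply: finj.
Qed.

Lemma fsbig_fsupp (R : zmodType) (A : set T) (F : T -> R) r :
  uniq r -> (forall x, A x -> F x != 0 -> x \in r) ->
  \sum_(x \in A) F x = \sum_(x <- r | `[< A x >]) F x.
Proof.
move=> ur rA; rewrite (fsbigE [seq x <- r | `[< A x >]]) ?filter_uniq //.
- rewrite big_filter_cond; apply: eq_bigl => x; case: asboolP => //= Ax.
  exact/mem_set.
- by move=> x /=; rewrite mem_filter => /andP[/asboolP].
- move=> x Ax; rewrite mem_filter negb_and; case: asboolP => //= _ xr.
  by apply: contraNeq xr; apply: rA.
Qed.
End Lists.

Section Families.
Variables (I : finType) (T : choiceType) (r : I -> seq T).
Hypothesis ur : forall i, uniq (r i).
Let u := undup (flatten [seq r i | i <- enum I]).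

Let ru i x : x \in r i -> x \in u.
Proof.
move=> xi; rewrite mem_undup; apply/flattenP; exists (r i) => //.
by apply: map_f; rewrite mem_enum.
Qed.

(** The choice functions of a family of lists. Since T need not be finite, they are built over the
    finite type of elements of the concatenated lists. *)
Definition families : seq {ffun I -> T} :=
  [seq [ffun i => val (g i)] | g : {ffun I -> seq_sub u} <-
     enum (family (fun i => [pred y : seq_sub u | val y \in r i]))].

Lemma lists_families : lists families (fun f => forall i, f i \in r i).
Proof.
split=> [|f].
  rewrite map_inj_uniq ?enum_uniq // => g g' E; apply/ffunP => i.
  by apply: val_inj; have /ffunP/(_ i) := E; rewrite !ffunE.
split=> [/mapP[g]|fr].
  by rewrite mem_enum => /familyP gr -> i; rewrite ffunE; have := gr i; rewrite inE.
apply/mapP; exists [ffun i => SeqSub (ru (fr i))]; last first.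
  by apply/ffunP => i; rewrite !ffunE.
by rewrite mem_enum; apply/familyP => i; rewrite inE ffunE; apply: fr.
Qed.

Lemma prod_sum_families (R : comNzSemiRingType) (F : I -> T -> R) :
  \prod_i \sum_(x <- r i) F i x = \sum_(f <- families) \prod_i F i (f i).
Proof.
rewrite big_map big_enum /=.
under [RHS]eq_bigr do under eq_bigr do rewrite ffunE.
transitivity (\prod_i \sum_(y : seq_sub u | val y \in r i) F i (val y)).
  apply: eq_bigr => i _.
  transitivity (\sum_(x <- map val (enum {: seq_sub u}) | x \in r i) F i x); last first.
    by rewrite big_map big_enum_cond.
  rewrite -[RHS]big_filter; apply/perm_big/uniq_perm; rewrite ?filter_uniq //.
    by rewrite map_inj_uniq ?enum_uniq //; apply: val_inj.
  move=> x; rewrite mem_filter; apply/idP/andP => [xi|[]//]; split=> //.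
  by apply/mapP; exists (SeqSub (ru xi)); rewrite ?mem_enum.
rewrite (bigA_distr_big_dep (fun i (y : seq_sub u) => val y \in r i)). by apply: eq_bigl.
Qed.
End Families.

Lemma diagram_ext (R R' : diagram) :
  (forall i, nth 0%N (val R) i = nth 0%N (val R') i) -> R = R'.
Proof. by move=> E; apply/val_inj/eq_diagram_nth => //; apply: valP. Qed.

Lemma nth_leq_boxes (R : diagram) i : (nth 0%N (val R) i <= boxes R)%N.
Proof.
have [iR|iR] := ltnP i (size (val R)); last by rewrite nth_default.
rewrite /boxes sumnE (big_nth 0%N) big_mkord (bigD1 (Ordinal iR)) //=.
exact: leq_addr.
Qed.

Lemma diagram_list_ex N : exists r, lists r (fun R : diagram => boxes R <= N)%N.
Proof.
pose f (R : diagram) : {ffun 'I_N -> 'I_N.+1} := [ffun i : 'I_N => inord (nth 0%N (val R) i)].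
apply: (lists_of_inj (f := f)) => R R' RN R'N E; apply: diagram_ext => i.
have [iN|Ni] := ltnP i N; last first.
  have out (Q : diagram) : (boxes Q <= N)%N -> nth 0%N (val Q) i = 0%N.
    move=> QN; rewrite nth_default // (leq_trans _ Ni) // (leq_trans _ QN) //.
    exact: (diagram_size_leq (valP Q)).
  by rewrite !out.
have := congr1 (fun g : {ffun 'I_N -> 'I_N.+1} => val (g (Ordinal iN))) E.
by rewrite !ffunE /= !inordK // ltnS (leq_trans (nth_leq_boxes _ _)).
Qed.

Lemma vec_list_ex N : exists r, lists r (fun k : vec => vsize k <= N)%N.
Proof.
pose f (k : vec) : {ffun 'I_N -> 'I_N.+1} := [ffun i : 'I_N => inord (k i)].
apply: (lists_of_inj (f := f)) => k k' kN k'N E; apply: cm_ext => i.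
have [iN|Ni] := ltnP i N; last first.
  have out (q : vec) : (vsize q <= N)%N -> q i = 0%N.
    move=> qN; apply/eqP; apply: contraTT Ni => /cm_leq_vsize iq.
    by rewrite -ltnNge (leq_trans iq).
  by rewrite !out.
have := congr1 (fun g : {ffun 'I_N -> 'I_N.+1} => val (g (Ordinal iN))) E.
rewrite !ffunE /= !inordK // ltnS (leq_trans (cm_leq_mdeg _ _)) //.
  by rewrite (leq_trans (mdeg_leq_vsize _)).
by rewrite (leq_trans (mdeg_leq_vsize _)).
Qed.

Section Homogeneous.
Variables (I : choiceType) (K : fieldType).
Implicit Types (f g : fps I K).

Definition homog n f := forall m, coef f m != 0 -> mdeg m = n.

Lemma homogM n p f g : homog n f -> homog p g -> homog (n + p) (f * g).
Proof.
move=> fn gp m; rewrite fps_coefM => /eqP H.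
have [[a b] /= [ab fa gb]] : exists q : {cmonom I} * {cmonom I},
    [/\ mmul q.1 q.2 = m, coef f q.1 != 0 & coef g q.2 != 0].
  apply: contrapT => no; apply: H; rewrite fsbig1 // => q /= qm.
  apply/eqP; rewrite mulf_eq0; apply: contrapT => /negP.
  by rewrite negb_or => /andP[fq gq]; apply: no; exists q.
by rewrite -ab mdegM (fn a fa) (gp b gb).
Qed.

Lemma homog1 : homog 0 (1 : fps I K).
Proof.
move=> m; have [-> _|/negPf mm] := eqVneq m mone; first exact: mdeg1.
by rewrite fps_coef1 mm eqxx.
Qed.

Lemma homog_prod T (r : seq T) (P : pred T) (F : T -> fps I K) (n : T -> nat) :
  (forall x, P x -> homog (n x) (F x)) ->
  homog (\sum_(x <- r | P x) n x) (\prod_(x <- r | P x) F x).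
Proof.
by move=> FG; apply: (big_ind2 homog) => //; [exact: homog1 | move=> *; exact: homogM].
Qed.

Definition mindeg n f := forall m, (mdeg m < n)%N -> coef f m = 0.

Lemma mindegM n p f g : mindeg n f -> mindeg p g -> mindeg (n + p) (f * g).
Proof.
move=> fn gp m mnp; rewrite fps_coefM fsbig1 // => -[a b] /= ab.
have [an|na] := ltnP (mdeg a) n; first by rewrite fn ?mul0r.
rewrite gp ?mulr0 //; move: mnp; rewrite -ab mdegM; lia.
Qed.

Lemma mindegX n f : mindeg 1 f -> mindeg n (f ^+ n).
Proof. by move=> f1; elim: n => // n IH; rewrite exprS -add1n; apply: mindegM. Qed.

Definition deg_leq N (m : {cmonom I}) := (mdeg m <= N)%N.

Lemma deg_leq_divclosed N : divclosed (deg_leq N).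
Proof. by move=> a b; rewrite /deg_leq mdegM => ab; split; lia. Qed.

Lemma fps_scaleM c d f g : (c *: f) * (d *: g) = (c * d) *: (f * g).
Proof.
apply: fpsP => m; rewrite fps_coefZ !fps_coefM mulr_fsumr; apply: eq_fsbigr => p _.
by rewrite !fps_coefZ mulrACA.
Qed.

Lemma fps_scale_prod T (r : seq T) (P : pred T) (c : T -> K) (F : T -> fps I K) :
  \prod_(x <- r | P x) (c x *: F x) =
  (\prod_(x <- r | P x) c x) *: \prod_(x <- r | P x) F x.
Proof.
elim/big_rec3: _ => [|x a b d _ ->]; first by rewrite scale1r.
by rewrite fps_scaleM.
Qed.
End Homogeneous.
End FiniteSums.

(** * Coefficients of the free energy and of the expansion *)

Section FreeEnergyCoefficients.
Import GRing.Theory.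
Local Open Scope ring_scope.

Lemma eq_sum_supp (T : eqType) (V : nmodType) (r r' : seq T) (F : T -> V) :
  uniq r -> uniq r' -> (forall x, F x != 0 -> (x \in r) = (x \in r')) ->
  \sum_(x <- r) F x = \sum_(x <- r') F x.
Proof.
move=> ur ur' rr'; have E (s : seq T) : \sum_(x <- s) F x = \sum_(x <- s | F x != 0) F x.
  by rewrite [RHS]big_mkcond; apply: eq_bigr => x _; case: eqP => // ->.
rewrite E [RHS]E -[LHS]big_filter -[RHS]big_filter.
apply/perm_big/uniq_perm; rewrite ?filter_uniq // => x; rewrite !mem_filter.
by apply: andb_id2l; apply: rr'.
Qed.

Lemma tuple_list_ex (I : finType) (T : choiceType) (sz : T -> nat) N :
  (exists r, lists r (fun x : T => sz x <= N)%N) ->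
  exists r, lists r (fun f : {ffun I -> T} => \sum_i sz (f i) <= N)%N.
Proof.
case=> r0 [u0 m0]; have [uf mf] := lists_families (fun _ : I => r0).
exists [seq f : {ffun I -> T} <- families (fun=> r0) | (\sum_i sz (f i) <= N)%N].
split=> [|f]; first exact: filter_uniq.
rewrite mem_filter; split=> [/andP[]//|fN]; rewrite fN /=; apply/mf => i; apply/m0.
by apply: leq_trans fN; rewrite (bigD1 i) //= leq_addr.
Qed.

Section Expansion.
Variables (C : fieldType) (L : nat).
Local Notation K := (ratfun C).
Local Notation PS := (fps ('I_L * nat)%type K).
Local Notation vecs := {ffun 'I_L -> vec}.
Implicit Types (k : vecs) (R : diagrams L).

Definition tsize k := (\sum_alpha vsize (k alpha))%N.
Definition tboxes R := (\sum_alpha boxes (R alpha))%N.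
Definition upsilons e k : PS := \prod_alpha Upsilon K (vdil e (k alpha)) alpha.
Definition schurs e R : PS := \prod_alpha schur K (R alpha) alpha e.
Definition chis R k : K := \prod_alpha (chi (R alpha) (k alpha))%:~R.

Lemma chis_neq0 R k : chis R k != 0 -> forall alpha, boxes (R alpha) = vsize (k alpha).
Proof.
move=> ck alpha; apply/eqP; apply: contraNT ck => bk; apply/eqP.
by rewrite /chis (bigD1 alpha) //= /chi (negPf bk) mul0r.
Qed.

Lemma chis_tsize R k : chis R k != 0 -> tboxes R = tsize k.
Proof. by move/chis_neq0 => E; apply: eq_bigr => alpha _. Qed.

Lemma schur_homog (Q : diagram) alpha e :
  homog (e * boxes Q) (schur K Q (alpha : 'I_L) e).
Proof.
move=> m; rewrite coef_fps_sum /= => H.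
have [T sT mT] : exists2 T, ssyt (val Q) T &
    m = \big[mmul/mone]_(y <- flatten T) xpow alpha y e.
  apply: contrapT => no; case/eqP: H; apply: fsbig1 => T sT.
  by case: eqP => // mT; case: no; exists T.
rewrite mT mdeg_prod (eq_bigr (fun=> e)) => [|y _]; last first.
  by rewrite mdegX mdegU muln1.
case/and3P: sT => /eqP sQ _ _; rewrite /boxes -sQ.
rewrite big_const_seq count_predT iter_addn_0; congr (_ * _)%N.
by rewrite size_flatten.
Qed.

Lemma schurs_homog e R : homog (e * tboxes R) (schurs e R).
Proof.
rewrite /tboxes big_distrr /=; apply: homog_prod => alpha _.
exact: schur_homog.
Qed.

(** The product over the components of Frobenius' formula. The list may be larger than necessary, as
    [chis] vanishes where the numbers of boxes disagree; this lets one list serve all vectors of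
    bounded size. *)
Lemma upsilons_schurs e k r : (0 < e)%N -> uniq r ->
  (forall R, (forall alpha, boxes (R alpha) = vsize (k alpha)) -> R \in r) ->
  upsilons e k = \sum_(R <- r) chis R k *: schurs e R.
Proof.
move=> e0 ur rk; have [r0 [u0 m0]] := diagram_list_ex (tsize k).
have kle alpha : (vsize (k alpha) <= tsize k)%N.
  by rewrite /tsize (bigD1 alpha) //= leq_addr.
transitivity (\prod_alpha \sum_(Q <- r0) (chi Q (k alpha))%:~R *: schur K Q alpha e).
  apply: eq_bigr => alpha _; rewrite Upsilon_schur // (fsbig_fsupp (r := r0)) //.
    rewrite big_mkcond; apply: eq_bigr => Q _; case: asboolP => // /eqP /negPf bQ.
    by rewrite /chi bQ scale0r.
  by move=> Q /= bQ _; apply/m0; rewrite bQ.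
rewrite prod_sum_families; last by [].
have [uf mf] := lists_families (fun _ : 'I_L => r0).
rewrite (eq_bigr (fun R : diagrams L => chis R k *: schurs e R)) => [|R _]; last first.
  by rewrite fps_scale_prod.
apply: eq_sum_supp => // R RN.
have cR : chis R k != 0 by apply: contraNneq RN => ->; rewrite scale0r.
have bR := chis_neq0 cR; rewrite (rk R bR); apply/mf => alpha; apply/m0.
by rewrite bR.
Qed.

Lemma upsilons_homog e k : (0 < e)%N -> homog (e * tsize k) (upsilons e k).
Proof.
move=> e0; have [r [ur mr]] := tuple_list_ex 'I_L (diagram_list_ex (tsize k)).
rewrite (@upsilons_schurs _ _ r) //; last first.
  by move=> R bR; apply/mr; rewrite (eq_bigr (fun alpha => vsize (k alpha))).
move=> m; rewrite fps_coef_sum => H; apply/eqP; apply: contraNT H => mk.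
rewrite big1 // => R _; rewrite fps_coefZ; apply/eqP; rewrite mulf_eq0.
have [//|/chis_tsize bR /=] := eqVneq (chis R k) 0.
by apply: contraNT mk => /schurs_homog ->; rewrite bR.
Qed.

Lemma nonzero_tsize k : nonzero_vecs k = (0 < tsize k)%N.
Proof.
rewrite /nonzero_vecs /tsize !lt0n; congr (~~ _).
rewrite !sum_nat_eq0; apply: eq_forallb => alpha /=.
apply/eqP/eqP => [|k0]; first by move/mdeg_eq0I => ->; apply: vsize1.
by apply/eqP; rewrite -leqn0 -k0 mdeg_leq_vsize.
Qed.

Definition ksum m (kk : {ffun 'I_m -> vecs}) : vecs :=
  [ffun alpha => vsum (fun j => kk j alpha)].

Lemma tsize_ksum m (kk : {ffun 'I_m -> vecs}) :
  tsize (ksum kk) = (\sum_j tsize (kk j))%N.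
Proof.
rewrite /tsize exchange_big /=; apply: eq_bigr => alpha _.
by rewrite ffunE /vsum vsize_prod.
Qed.

Lemma upsilons_ksum m (kk : {ffun 'I_m -> vecs}) :
  \prod_j upsilons 1 (kk j) = upsilons 1 (ksum kk).
Proof.
rewrite /upsilons exchange_big /=; apply: eq_bigr => alpha _.
rewrite ffunE vdil1 /Upsilon -/(vprod _ _) /vsum vprod_big.
by apply: eq_bigr => j _; rewrite vdil1.
Qed.

Definition dilvecs d k : vecs := [ffun alpha => vdil d (k alpha)].

Lemma tsize_dilvecs d k : (0 < d)%N -> tsize (dilvecs d k) = (d * tsize k)%N.
Proof.
move=> d0; rewrite /tsize big_distrr /=; apply: eq_bigr => alpha _.
by rewrite ffunE vsize_vdil.
Qed.

Lemma upsilons_dilvecs e d k : (0 < e)%N -> (0 < d)%N ->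
  upsilons e (dilvecs d k) = upsilons (e * d) k.
Proof. by move=> e0 d0; apply: eq_bigr => alpha _; rewrite ffunE vdil_comp. Qed.

Lemma ne_diagrams_tboxes (R : ne_diagrams L) : (0 < tboxes (val R))%N.
Proof.
have /existsP[alpha Ra] := valP R; rewrite lt0n; apply: contra Ra => R0.
move: R0; rewrite sum_nat_eq0 => /forallP/(_ alpha)/= b0.
rewrite -size_eq0 -leqn0 -(eqP b0).
exact: (diagram_size_leq (valP (val R alpha))).
Qed.

Lemma tboxes_ne_diagrams R : (0 < tboxes R)%N ->
  [exists alpha, val (R alpha) != [::]].
Proof.
apply: contraTT => /existsPn no; rewrite -leqNgt leqn0 sum_nat_eq0.
by apply/forallP => alpha; have := no alpha; rewrite negbK /boxes => /eqP ->.
Qed.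

Lemma ne_list_ex N : exists r, lists r (fun R : ne_diagrams L => tboxes (val R) <= N)%N.
Proof.
have [r [ur mr]] := tuple_list_ex 'I_L (diagram_list_ex N).
exists (pmap insub r); split=> [|R]; first exact: pmap_sub_uniq.
by rewrite mem_pmap_sub; apply: mr.
Qed.

Variable W : diagrams L -> K.

Definition acoef k : K := W_vec W k * \prod_alpha class_weight K (k alpha).

Lemma W_vec_list k r : uniq r ->
  (forall R, (forall alpha, boxes (R alpha) = vsize (k alpha)) -> R \in r) ->
  W_vec W k = \sum_(R <- r) chis R k * W R.
Proof.
move=> ur rk; rewrite /W_vec (fsbig_fsupp (r := r)) //; last first.
  by move=> R /= bR _; apply: rk.
rewrite big_mkcond; apply: eq_bigr => R _; case: asboolP => // bR.
have [->|/chis_neq0 /bR //] := eqVneq (chis R k) 0.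
by rewrite mul0r.
Qed.

Let X : PS := partition_function W - 1.

Lemma partition_functionB1 : X =
  fps_sum [set k | nonzero_vecs k]%classic (fun k => acoef k *: upsilons 1 k).
Proof.
rewrite /X /partition_function [1 + _]addrC addrK; congr fps_sum; apply/funext => k.
rewrite fps_scale_prod scalerA; congr (_ *: _); apply: eq_bigr => alpha _.
by rewrite vdil1.
Qed.

Variable N : nat.
Variable rv : seq vecs.
Hypothesis rvP : lists rv (fun k => tsize k <= N)%N.
Let rA := [seq k <- rv | nonzero_vecs k].

Lemma rA_mem k : (k \in rA) = (0 < tsize k <= N)%N.
Proof.
rewrite mem_filter nonzero_tsize; congr andb; apply/idP/idP; by case: rvP => _ ->.
Qed.

Lemma rA_uniq : uniq rA. Proof. by rewrite filter_uniq //; case: rvP. Qed.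

Lemma X_trunc : eqon (deg_leq N) X (\sum_(k <- rA) acoef k *: upsilons 1 k).
Proof.
move=> m mN; rewrite partition_functionB1 coef_fps_sum fps_coef_sum.
rewrite (fsbig_fsupp (r := rv)); [|by case: rvP|].
  rewrite [RHS]big_filter; apply: eq_bigl => k; exact: asboolb.
move=> k _; rewrite fps_coefZ mulf_eq0 negb_or => /andP[_ uk].
case: rvP => _ ->; have := upsilons_homog (isT : (0 < 1)%N) uk.
by rewrite mul1n => <-.
Qed.

Lemma X_mindeg : mindeg 1 X.
Proof.
move=> m m0; rewrite partition_functionB1 coef_fps_sum fsbig1 // => k k0.
apply/eqP; rewrite fps_coefZ mulf_eq0; apply/orP; right.
apply: contraTT m0 => /(upsilons_homog (ltn0Sn 0)) ->.
by rewrite mul1n -leqNgt -nonzero_tsize; apply: k0.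
Qed.

Definition klist m : seq {ffun 'I_m -> vecs} := families (fun _ : 'I_m => rA).

Lemma klistP m (kk : {ffun 'I_m -> vecs}) :
  kk \in klist m <-> (forall j, (0 < tsize (kk j) <= N)%N).
Proof.
have [_ ->] := lists_families (fun _ : 'I_m => rA).
by split=> h j; have := h j; rewrite rA_mem.
Qed.

Lemma klist_uniq m : uniq (klist m).
Proof. by have [] := lists_families (fun _ : 'I_m => rA). Qed.

Definition bcoef m (kk : {ffun 'I_m -> vecs}) : K := \prod_j acoef (kk j).

Lemma X_expn m : eqon (deg_leq N) (X ^+ m)
  (\sum_(kk <- klist m) bcoef kk *: upsilons 1 (ksum kk)).
Proof.
have E : (\sum_(k <- rA) acoef k *: upsilons 1 k) ^+ m =
    \sum_(kk <- klist m) bcoef kk *: upsilons 1 (ksum kk).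
  rewrite -[m in LHS]card_ord -prodr_const prod_sum_families; last first.
    by move=> _; apply: rA_uniq.
  by apply: eq_bigr => kk _; rewrite fps_scale_prod upsilons_ksum.
rewrite -E; apply: eqonX; first exact: deg_leq_divclosed.
exact: X_trunc.
Qed.

(** Since Z - 1 has no constant term, its m-th power starts in degree m, and the logarithm
    contributes only finitely many powers in each degree. *)
Lemma coef_free_energy p : (mdeg p <= N)%N ->
  coef (free_energy W) p =
  \sum_(1 <= m < N.+1) ((-1) ^+ m.-1 / m%:R) *
     \sum_(kk <- klist m) bcoef kk * coef (upsilons 1 (ksum kk)) p.
Proof.
move=> pN; rewrite /free_energy /fps_log coef_fps_sum -/X.
rewrite (fsbig_fsupp (r := index_iota 1 N.+1)) ?iota_uniq //; last first.
  move=> m m0; rewrite fps_coefZ mulf_eq0 negb_or => /andP[_ Xm].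
  rewrite mem_index_iota (m0 : (0 < m)%N) ltnS; apply: leq_trans pN; rewrite leqNgt.
  by apply: contraNN Xm => pm; rewrite (mindegX X_mindeg).
rewrite big_nat_cond [RHS]big_nat_cond; apply: eq_big => [m|m].
  by apply: andb_id2l => /andP[m0 _]; apply/asboolP.
case/andP=> _ _; rewrite fps_coefZ (@X_expn m p pN) fps_coef_sum; congr (_ * _).
Qed.

(** Class weights and character values are constants, fixed by the dilation, so only the invariants
    W are dilated. *)
Lemma dilate_acoef d k r : (0 < d)%N -> uniq r ->
  (forall R, (forall alpha, boxes (R alpha) = vsize (k alpha)) -> R \in r) ->
  \sum_(R <- r) (\prod_alpha (class_weight K (k alpha) *
                    (chi (R alpha) (k alpha))%:~R)) * dilate d (W R) =
  dilate d (acoef k).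
Proof.
case: d => // d _ ur rk; rewrite -/(dilateS d (acoef k)).
rewrite /acoef (W_vec_list ur rk) rmorphM rmorph_sum rmorph_prod /= mulr_suml.
apply: eq_bigr => R _; rewrite rmorphM /= big_split /=.
have -> : dilateS d (chis R k) = chis R k.
  by rewrite /chis rmorph_prod; apply: eq_bigr => alpha _; rewrite rmorph_int.
have -> : \prod_i dilateS d (class_weight K (k i)) = \prod_i class_weight K (k i).
  apply: eq_bigr => alpha _; rewrite /class_weight fmorph_div /=.
  by rewrite !rmorph_nat.
by rewrite -[LHS]mulrA [LHS]mulrC.
Qed.

Definition plist m (rd : seq (diagrams L)) : seq (summation_index L m) :=
  [seq (kk, rr) | kk <- klist m, rr <- families (fun _ : 'I_m => rd)].

(** A nonzero character value of R forces equal sizes. This equation bounds d, m and all the vectors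
    by the number of boxes of R. *)
Lemma explicit_term_bound (R : ne_diagrams L) d m (x : summation_index L m) :
  (0 < d)%N -> admissible x -> explicit_term W R d x != 0 ->
  (d * \sum_j tsize (x.1 j) = tboxes (val R))%N /\ (forall j, (0 < tsize (x.1 j))%N).
Proof.
move=> d0 [nz bx]; rewrite /explicit_term mulf_eq0 negb_or => /andP[cR _].
have ch : chis (val R) (dilvecs d (ksum x.1)) != 0.
  by move: cR; congr (_ != 0); apply: eq_bigr => alpha _; rewrite !ffunE.
split; first by rewrite (chis_tsize ch) tsize_dilvecs // tsize_ksum.
by move=> j; rewrite -nonzero_tsize; apply: nz.
Qed.

Lemma explicit_term_plist (R : ne_diagrams L) rd d m (x : summation_index L m) :
  lists rd (fun R => tboxes R <= N)%N -> (tboxes (val R) <= N)%N ->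
  (0 < d)%N -> admissible x -> explicit_term W R d x != 0 -> x \in plist m rd.
Proof.
move=> [urd mrd] RN d0 adm xn0; have [bd pos] := explicit_term_bound d0 adm xn0.
have xN j : (tsize (x.1 j) <= N)%N.
  apply: leq_trans RN; rewrite -bd (bigD1 j) //=.
  by apply: leq_trans (leq_addr _ _) _; apply: leq_pmull.
apply/allpairsP; exists x; split=> /=; last by case: (x).
  by apply/klistP => j; rewrite pos xN.
have [_ ->] := lists_families (fun _ : 'I_m => rd) => j; apply/mrd.
apply: leq_trans (xN j); rewrite /tboxes (eq_bigr (fun alpha => vsize (x.1 j alpha))) //.
by move=> alpha _; case: adm.
Qed.

(** For fixed vectors the sum over the diagrams factors over j, and each factor is the dilated
    coefficient of one product of Upsilons in Z. *)
Lemma explicit_inner (R : ne_diagrams L) d m : (0 < d)%N -> (tboxes (val R) <= N)%N ->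
  \sum_(x \in [set x : summation_index L m | admissible x]%classic)
     explicit_term W R d x =
  \sum_(kk <- klist m) chis (val R) (dilvecs d (ksum kk)) * dilate d (bcoef kk).
Proof.
move=> d0 RN; have [rd rdP] := tuple_list_ex 'I_L (diagram_list_ex N).
have [urd mrd] := rdP.
have [uf mf] := lists_families (fun _ : 'I_m => rd).
rewrite (fsbig_fsupp (r := plist m rd)) /=; last 2 first.
- by rewrite allpairs_uniq ?klist_uniq // => -[? ?] [? ?].
- by move=> x adm; apply: explicit_term_plist.
transitivity (\sum_(x <- plist m rd) explicit_term W R d x).
  rewrite big_mkcond big_seq [RHS]big_seq; apply: eq_bigr => x.
  case/allpairsP => -[kk rr] /= [kkl rrl ->]; case: asboolP => // nadm.
  apply/esym/eqP; rewrite mulf_eq0 /=; apply/orP; right.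
  have [j nj] : exists j, exists alpha, boxes (rr j alpha) <> vsize (kk j alpha).
    apply: contrapT => no; apply: nadm; split=> [j|j alpha] /=.
      by rewrite nonzero_tsize; move/klistP/(_ j): kkl => /andP[].
    by apply: contrapT => bn; apply: no; exists j, alpha.
  case: nj => alpha /eqP/negPf bn; rewrite (bigD1 j) //= (bigD1 alpha) //=.
  by rewrite /chi bn mulr0 !mul0r.
rewrite big_allpairs big_seq [RHS]big_seq; apply: eq_bigr => kk kkl.
rewrite /explicit_term /= -big_distrr /=; congr (_ * _).
  by apply: eq_bigr => alpha _; rewrite !ffunE.
rewrite -(@prod_sum_families _ _ (fun _ : 'I_m => rd) (fun=> urd) _ (fun j R' =>
  (\prod_alpha (class_weight K (kk j alpha) * (chi (R' alpha) (kk j alpha))%:~R)) *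
      dilate d (W R'))).
case: d d0 => // d _; rewrite -/(dilateS d (bcoef kk)) /bcoef rmorph_prod.
apply: eq_bigr => j _; rewrite dilate_acoef // => R' bR'; apply/mrd.
rewrite (eq_bigr (fun alpha => vsize (kk j alpha))) //.
by move/klistP/(_ j): kkl => /andP[].
Qed.

Lemma klist_leq m (kk : {ffun 'I_m -> vecs}) : kk \in klist m ->
  (m <= tsize (ksum kk))%N.
Proof.
move/klistP => h; rewrite tsize_ksum -[leqLHS]card_ord -sum1_card.
by apply: leq_sum => j _; case/andP: (h j).
Qed.

Lemma explicit_fE (R : ne_diagrams L) : (tboxes (val R) <= N)%N ->
  explicit_f W R =
  \sum_(1 <= d < N.+1) \sum_(1 <= m < N.+1)
    ((-1) ^+ m.-1 * ((mobius d)%:~R / (d%:R * m%:R))) *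
    \sum_(kk <- klist m) chis (val R) (dilvecs d (ksum kk)) * dilate d (bcoef kk).
Proof.
move=> RN; rewrite /explicit_f.
pose r := [seq (d, m) | d <- index_iota 1 N.+1, m <- index_iota 1 N.+1].
rewrite (fsbig_fsupp (r := r)) /=; last 2 first.
- by rewrite allpairs_uniq ?iota_uniq // => -[? ?] [? ?].
- move=> [d m] /= [d0 m0]; rewrite mulf_eq0 negb_or => /andP[_].
  rewrite explicit_inner // => s0.
  have [kk kkl ch] : exists2 kk, kk \in klist m &
      chis (val R) (dilvecs d (ksum kk)) != 0.
    apply: contrapT => no; case/eqP: s0; rewrite big1_seq // => kk /= kkl.
    by apply/eqP; rewrite mulf_eq0; apply/orP; left;
       apply: contrapT => /negP ch; apply: no; exists kk.
  have := chis_tsize ch; rewrite tsize_dilvecs // => E.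
  have mk := klist_leq kkl; apply/allpairsP; exists (d, m); split=> //=.
    rewrite mem_index_iota d0 ltnS (leq_trans _ RN) // E leq_pmulr //.
    exact: leq_trans mk.
  rewrite mem_index_iota m0 ltnS (leq_trans _ RN) // E.
  by apply: leq_trans mk _; rewrite leq_pmull.
rewrite big_mkcond big_allpairs big_nat_cond [RHS]big_nat_cond.
apply: eq_bigr => d /andP[/andP[d0 _] _].
rewrite big_nat_cond [RHS]big_nat_cond.
apply: eq_bigr => m /andP[/andP[m0 _] _].
by rewrite ifT /=; [rewrite explicit_inner | apply/asboolP].
Qed.

(** With the right-hand side of [free_energy_expansion] as a function of f, existence is an equation
    between series and uniqueness is injectivity. *)
Definition expansion (f : ne_diagrams L -> K) : PS :=
  fps_sum [set d : nat | (0 < d)%N]%classic (fun d =>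
    fps_sum [set: ne_diagrams L]%classic (fun R : ne_diagrams L =>
      (d%:R^-1 * dilate d (f R)) *: schurs d (val R))).

Lemma coef_expansion (f : ne_diagrams L -> K) rn p :
  lists rn (fun R : ne_diagrams L => tboxes (val R) <= N)%N -> (mdeg p <= N)%N ->
  coef (expansion f) p =
  \sum_(1 <= e < N.+1) \sum_(R <- rn)
     e%:R^-1 * dilate e (f R) * coef (schurs e (val R)) p.
Proof.
move=> [un mn] pN.
have inner d : (0 < d)%N -> coef (fps_sum [set: ne_diagrams L]%classic (fun R : ne_diagrams L =>
      (d%:R^-1 * dilate d (f R)) *: schurs d (val R))) p =
    \sum_(R <- rn) d%:R^-1 * dilate d (f R) * coef (schurs d (val R)) p.
  move=> d0; rewrite coef_fps_sum (fsbig_fsupp (r := rn)) //.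
    by apply: eq_bigl => R; apply/asboolP.
  move=> R _; rewrite fps_coefZ mulf_eq0 negb_or => /andP[_ sR]; apply/mn.
  by apply: leq_trans pN; rewrite (schurs_homog sR) leq_pmull.
rewrite coef_fps_sum (fsbig_fsupp (r := index_iota 1 N.+1)) ?iota_uniq //.
  rewrite big_nat_cond [RHS]big_nat_cond; apply: eq_big => [e|e].
    by apply: andb_id2l => /andP[e0 _]; apply/asboolP.
  by case/andP=> /andP[e0 _] _; rewrite inner.
move=> e e0; have {}e0 : (0 < e)%N := e0; rewrite [X in X != 0](inner e e0) => s0.
have [R sR] : exists R : ne_diagrams L, coef (schurs e (val R)) p != 0.
  apply: contrapT => no; case/eqP: s0; rewrite big1 // => R _.
  apply/eqP; rewrite mulf_eq0; apply/orP; right.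
  by apply: contrapT => /negP sR; apply: no; exists R.
rewrite mem_index_iota e0 ltnS (leq_trans _ pN) // (schurs_homog sR).
by rewrite leq_pmulr // ne_diagrams_tboxes.
Qed.
End Expansion.
End FreeEnergyCoefficients.

(** * The explicit family satisfies the expansion *)

Section ExplicitExpansion.
Import GRing.Theory.
Local Open Scope ring_scope.

Section Existence.
Variables (C : fieldType) (L : nat) (W : diagrams L -> ratfun C).
Local Notation K := (ratfun C).
Local Notation vecs := {ffun 'I_L -> vec}.

(** Frobenius' formula read from Schur functions to Upsilons. Positivity of [tsize v] excludes the
    tuple of empty diagrams, and if [tsize v] exceeds N both sides vanish for reasons of degree. *)
Lemma sum_chis_schurs N e (v : vecs) rn p : (0 < e)%N -> (0 < tsize v)%N ->
  lists rn (fun R : ne_diagrams L => tboxes (val R) <= N)%N -> (mdeg p <= N)%N ->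
  \sum_(R <- rn) chis C (val R) v * coef (schurs C e (val R)) p =
  coef (upsilons C e v) p.
Proof.
move=> e0 v0 [un mn] pN; have [vN|Nv] := leqP (tsize v) N; last first.
  rewrite big1_seq => [|R /= /mn RN].
    apply/esym/eqP; apply: contraTT pN => /(upsilons_homog e0) ->.
    by rewrite -ltnNge (leq_trans Nv) // leq_pmull.
  apply/eqP; rewrite mulf_eq0; apply/orP; left.
  by apply: contraTT Nv => /chis_tsize <-; rewrite -leqNgt.
rewrite (@upsilons_schurs _ _ _ _ (map val rn)) //.
- by rewrite fps_coef_sum big_map; apply: eq_bigr => R _; rewrite fps_coefZ.
- by rewrite map_inj_uniq //; apply: val_inj.
move=> R bR; have tR : tboxes R = tsize v by apply: eq_bigr.
have neR : [exists alpha, val (R alpha) != [::]].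
  by apply: tboxes_ne_diagrams; rewrite tR.
by apply/mapP; exists (exist _ R neR : ne_diagrams L) => //; apply/mn; rewrite /= tR.
Qed.

Lemma free_energy_explicit : free_energy W = expansion (explicit_f W).
Proof.
(* The successor makes N positive even for the constant monomial, as [mobius_inversion] requires. *)
apply: fpsP => p; pose N := (mdeg p).+1.
have pN : (mdeg p <= N)%N by apply: leqnSn.
have [rv rvP] := tuple_list_ex 'I_L (vec_list_ex N).
have [rn rnP] := @ne_list_ex L N.
rewrite (coef_free_energy W rvP pN) (coef_expansion _ rnP pN).
(* The contribution of [kk] with q, lambda and all variables raised to the power D. The indices e of
   the expansion and d of the explicit formula enter it only through D = e d. *)
pose H m (kk : {ffun 'I_m -> vecs}) D : K :=
  dilate D (bcoef W kk) * coef (upsilons C D (ksum kk)) p.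
transitivity (\sum_(1 <= e < N.+1) \sum_(1 <= d < N.+1) \sum_(1 <= m < N.+1)
   \sum_(kk <- klist rv m) ((-1) ^+ m.-1 / m%:R) *
     ((mobius d)%:~R / (e * d)%:R * H m kk (e * d)%N)); last first.
  rewrite big_nat_cond [RHS]big_nat_cond; apply: eq_bigr => e /andP[/andP[e0 _] _].
  have kpos d m kk : (0 < d)%N -> (0 < m)%N -> kk \in klist rv m ->
      (0 < tsize (dilvecs d (ksum kk)))%N.
    move=> d0 m0 /(klist_leq rvP) mk; rewrite tsize_dilvecs // muln_gt0 d0.
    exact: leq_trans mk.
  transitivity (\sum_(R <- rn) \sum_(1 <= d < N.+1) \sum_(1 <= m < N.+1)
     \sum_(kk <- klist rv m) (e%:R^-1 *
       ((-1) ^+ m.-1 * ((mobius d)%:~R / (d%:R * m%:R))) *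
        dilate (e * d) (bcoef W kk)) *
       (chis C (val R) (dilvecs d (ksum kk)) * coef (schurs C e (val R)) p)).
    rewrite [RHS]exchange_big /= big_nat_cond [RHS]big_nat_cond.
    apply: eq_bigr => d /andP[/andP[d0 _] _]; rewrite [RHS]exchange_big /=.
    rewrite big_nat_cond [RHS]big_nat_cond; apply: eq_bigr => m /andP[/andP[m0 _] _].
    rewrite [RHS]exchange_big /= big_seq [RHS]big_seq; apply: eq_bigr => kk kkl.
    rewrite -[RHS]mulr_sumr (sum_chis_schurs e0 (kpos _ _ _ d0 m0 kkl) rnP pN).
    rewrite upsilons_dilvecs // /H natrM !invfM.
    set a := (-1) ^+ _; set b := (mobius d)%:~R; set x := dilate _ _.
    set u := coef _ _; set ei := e%:R^-1; set di := d%:R^-1; set mi := m%:R^-1.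
    ring.
  rewrite big_seq [RHS]big_seq; apply: eq_bigr => R Rr.
  have RN : (tboxes (val R) <= N)%N by apply/(proj2 rnP).
  rewrite (explicit_fE W rvP RN) -(prednK e0) -/(dilateS _ _) rmorph_sum mulr_sumr mulr_suml.
  rewrite big_nat_cond [RHS]big_nat_cond; apply: eq_bigr => d /andP[/andP[d0 _] _].
  rewrite rmorph_sum mulr_sumr mulr_suml.
  rewrite big_nat_cond [RHS]big_nat_cond; apply: eq_bigr => m /andP[/andP[m0 _] _].
  rewrite rmorphM rmorph_sum !mulr_sumr mulr_suml; apply: eq_bigr => kk _.
  rewrite rmorphM /=.
  have -> : dilateS e.-1 (dilate d (bcoef W kk)) = dilate (e * d) (bcoef W kk).
    by rewrite /dilateS prednK // dilate_comp.
  have -> : dilateS e.-1 (chis C (val R) (dilvecs d (ksum kk))) =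
      chis C (val R) (dilvecs d (ksum kk)).
    by rewrite /chis rmorph_prod; apply: eq_bigr => alpha _; rewrite rmorph_int.
  have -> : dilateS e.-1 ((-1) ^+ m.-1 * ((mobius d)%:~R / (d%:R * m%:R))) =
      (-1) ^+ m.-1 * ((mobius d)%:~R / (d%:R * m%:R)) :> K.
    by rewrite rmorphM rmorphXn rmorphN1 fmorph_div rmorphM !rmorph_nat rmorph_int.
  rewrite prednK //.
  set c := (-1) ^+ _ * _; set x := dilate _ _; set y := chis _ _ _.
  set z := coef _ _; set ei := e%:R^-1; ring.
under [RHS]eq_bigr do rewrite exchange_big /=.
rewrite [RHS]exchange_big /= big_nat_cond [RHS]big_nat_cond.
apply: eq_bigr => m /andP[/andP[m0 _] _].
under [RHS]eq_bigr do rewrite exchange_big /=.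
rewrite [RHS]exchange_big /= mulr_sumr big_seq [RHS]big_seq; apply: eq_bigr => kk kkl.
under [RHS]eq_bigr do rewrite -mulr_sumr.
rewrite -[RHS]mulr_sumr; congr (_ * _).
(* For D > N the dilated product of Upsilons is homogeneous of degree at least D, hence has no term
   at p. *)
rewrite (@mobius_inversion _ (H m kk)) ?/H ?dilate1 // => D ND.
have D0 : (0 < D)%N by apply: leq_trans ND.
apply/eqP; rewrite mulf_eq0; apply/orP; right.
apply: contraTT pN => /(upsilons_homog D0) ->.
rewrite -ltnNge (leq_trans ND) // leq_pmulr //.
exact: leq_trans (klist_leq rvP kkl).
Qed.
End Existence.
End ExplicitExpansion.

(** * Uniqueness of the expansion, and finiteness *)

Section UniqueExpansion.
Import GRing.Theory.
Local Open Scope ring_scope.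

Definition diagram_key (Q : diagram) : nat := shape_key (shape_of (boxes Q) (val Q)).

Lemma psum_diagram_leq (Q : diagram) r : (boxes Q < r)%N ->
  psum (nth 0%N (val Q)) r = boxes Q.
Proof.
move=> br; have dQ := valP Q.
rewrite -[RHS](@psum_diagram (boxes Q) (val Q)) //; apply: psum_const0 => // i bi.
by apply: nth_default; apply: leq_trans (ltnW bi); apply: diagram_size_leq dQ.
Qed.

Lemma kostka_diagram_triangular (Q Q' : diagram) r : (boxes Q < r)%N ->
  kostka r (nth 0%N (val Q)) (shape_of (boxes Q') (val Q')) != 0%N ->
  boxes Q' = boxes Q /\ (Q' = Q \/ (diagram_key Q' < diagram_key Q)%N).
Proof.
move=> br kn; have dQ := valP Q; have dQ' := valP Q'.
have bb : boxes Q' = boxes Q.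
  by have := kostka_ssize kn; rewrite ssize_shape_of // psum_diagram_leq.
split=> //; rewrite /diagram_key; move: kn; rewrite bb => kn.
have [_ dom] := kostka_dom kn.
have [||E|] := @dominance_key (boxes Q) (shape_of (boxes Q) (val Q')) (shape_of (boxes Q) (val Q)).
- by rewrite ssize_shape_of // -bb.
- move=> j jn; apply: leq_trans (dom j (leq_trans jn br)).
  by apply: leq_psum => i _; rewrite row_shape_of.
- left; apply: diagram_ext => i.
  by rewrite -(row_shape_of dQ (erefl (boxes Q))) -E row_shape_of // -bb.
by right.
Qed.

Lemma kostka_diagram_diag (Q : diagram) r : (boxes Q < r)%N ->
  kostka r (nth 0%N (val Q)) (shape_of (boxes Q) (val Q)) = 1%N.
Proof.
move=> br; have dQ := valP Q; apply: kostka_diag => i.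
  exact: (diagram_nth_leq dQ (leqnSn i)).
rewrite row_shape_of //; case: ltnP => // ri; apply: nth_default.
apply: leq_trans (ltnW (leq_trans br ri)); exact: diagram_size_leq dQ.
Qed.

Section Uniqueness.
Variables (C : fieldType) (L : nat).
Local Notation K := (ratfun C).
Local Notation PS := (fps ('I_L * nat)%type K).
Local Notation mon := {cmonom ('I_L * nat)%type}.

Definition supported (alpha : 'I_L) (m : mon) := forall v, v.1 != alpha -> m v = 0%N.

(** The variables of distinct components are disjoint, so the product monomial has only one
    factorization compatible with the supports. The second conclusion is what the induction on s
    needs for the remaining factors. *)
Lemma coef_prod_supported (s : seq 'I_L) (F : 'I_L -> PS) (m : 'I_L -> mon) :
  uniq s -> (forall alpha, supported alpha (m alpha)) ->
  (forall alpha p, coef (F alpha) p != 0 -> supported alpha p) ->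
  coef (\prod_(alpha <- s) F alpha) (\big[mmul/mone]_(alpha <- s) m alpha) =
  \prod_(alpha <- s) coef (F alpha) (m alpha) /\
  (forall p, coef (\prod_(alpha <- s) F alpha) p != 0 ->
     forall v, v.1 \notin s -> p v = 0%N).
Proof.
move=> us ms Fs; elim: s us => [|a s IH] /=.
  rewrite !big_nil fps_coef1 eqxx; split=> // p.
  by rewrite fps_coef1; case: (eqVneq p mone) => [-> _ v _|_]; rewrite ?eqxx // cm1.
case/andP=> as_ us; have [IH1 IH2] := IH us; split; last first.
  move=> p; rewrite big_cons fps_coefM => H v.
  rewrite inE negb_or => /andP[va vs].
  have [[p1 p2] /= [E c1 c2]] : exists q : mon * mon,
      [/\ mmul q.1 q.2 = p, coef (F a) q.1 != 0 &
          coef (\prod_(alpha <- s) F alpha) q.2 != 0].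
    apply: contrapT => no; case/eqP: H; apply: fsbig1 => q /= qp.
    apply/eqP; rewrite mulf_eq0; apply: contrapT => /negP.
    rewrite negb_or => /andP[h1 h2]; apply: no; exists q; exact: (And3 qp h1 h2).
  by rewrite -E cmM (Fs a p1 c1) // (IH2 p2 c2).
rewrite !big_cons fps_coefM -IH1.
set M := \big[mmul/mone]_(alpha <- s) m alpha.
have Ma v : v.1 = a -> M v = 0%N.
  move=> va; rewrite /M cm_prod big1_seq // => b /= bs.
  by apply: ms; rewrite va; apply: contraNneq as_ => ->.
rewrite (fsbigE [:: (m a, M)]) //=.
- by rewrite big_mkcond big_seq1 ifT //; apply/mem_set.
- by move=> q; rewrite /= inE => /eqP ->.
move=> [p1 p2] /= E; rewrite inE => ne.
apply/eqP; rewrite mulf_eq0; apply: contraNT ne; rewrite negb_or => /andP[c1 c2].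
have p1E : p1 = m a.
  apply: cm_ext => v; have [va|va] := eqVneq v.1 a; last by rewrite (Fs a p1 c1) // ms.
  have := congr1 (fun q : mon => q v) E; rewrite /= !cmM Ma // addn0.
  by rewrite (IH2 p2 c2) ?addn0 // va.
have p2E : p2 = M.
  apply: cm_ext => v; have := congr1 (fun q : mon => q v) E.
  by rewrite /= !cmM p1E => /eqP; rewrite eqn_add2l => /eqP.
by rewrite p1E p2E.
Qed.

(** The dominant monomial of the Schur function of Q, with the length of row i as the exponent of
    variable i. *)
Definition diagram_mon (alpha : 'I_L) (Q : diagram) : mon :=
  \big[mmul/mone]_(i < boxes Q) expcmn (ucm (alpha, val i)) (nth 0%N (val Q) i).

Lemma diagram_monE alpha Q v :
  diagram_mon alpha Q v = ((v.1 == alpha) * nth 0%N (val Q) v.2)%N.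
Proof.
rewrite cm_prod; have [iQ|Qi] := ltnP v.2 (boxes Q).
  rewrite (bigD1 (Ordinal iQ)) //= big1 ?addn0; last first.
    move=> i; rewrite cmX cmU -val_eqE -pair_eqE /= => /negPf->.
    by rewrite andbF muln0.
  by rewrite cmX cmU -pair_eqE /= eqxx andbT eq_sym mulnC.
rewrite nth_default ?muln0.
  rewrite big1 // => i _; rewrite cmX cmU -pair_eqE /= ltn_eqF ?andbF ?muln0 //.
  exact: leq_trans (ltn_ord i) Qi.
by apply: leq_trans Qi; apply: diagram_size_leq (valP Q).
Qed.

Lemma schur_supported (Q : diagram) alpha p :
  coef (schur K Q alpha 1) p != 0 -> supported alpha p.
Proof.
have [r pr] := few_vars_ex p; rewrite (@coef_schur L K alpha 1 r p Q isT pr).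
by case: asboolP => [[]|_]; rewrite ?eqxx.
Qed.

Lemma coef_schur_diagram_mon (Q Q' : diagram) alpha r : (boxes Q < r)%N ->
  coef (schur K Q' alpha 1) (diagram_mon alpha Q) =
  (kostka r (nth 0%N (val Q)) (shape_of (boxes Q') (val Q')))%:R.
Proof.
move=> br; have few : few_vars r (diagram_mon alpha Q).
  move=> v rv; rewrite diagram_monE nth_default ?muln0 //.
  apply: leq_trans (ltnW (leq_trans br rv)); exact: diagram_size_leq (valP Q).
rewrite (@coef_schur L K alpha 1 r _ Q' isT few) ifT.
  by congr (_%:R); apply: eq_kostka => i _; rewrite diagram_monE eqxx mul1n divn1.
by apply/asboolP; split=> [v /negPf va|i]; rewrite ?dvd1n // diagram_monE va.
Qed.

Definition diagrams_mon (R : diagrams L) : mon :=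
  \big[mmul/mone]_alpha diagram_mon alpha (R alpha).

Lemma coef_schurs_mon (R R' : diagrams L) :
  coef (schurs C 1 R') (diagrams_mon R) =
  \prod_alpha (kostka (tboxes R).+1 (nth 0%N (val (R alpha)))
     (shape_of (boxes (R' alpha)) (val (R' alpha))))%:R.
Proof.
have [|||-> _] := @coef_prod_supported (index_enum 'I_L)
    (fun alpha => schur K (R' alpha) alpha 1) (fun alpha => diagram_mon alpha (R alpha)).
- exact: index_enum_uniq.
- by move=> alpha v /negPf va; rewrite diagram_monE va.
- by move=> alpha p; apply: schur_supported.
apply: eq_bigr => alpha _; apply: coef_schur_diagram_mon.
by rewrite ltnS /tboxes (bigD1 alpha) //= leq_addr.
Qed.

Definition diagrams_key (R : diagrams L) : nat := \sum_alpha diagram_key (R alpha).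

Lemma schurs_mon_triangular (R R' : diagrams L) :
  coef (schurs C 1 R') (diagrams_mon R) != 0 ->
  tboxes R' = tboxes R /\ (R' = R \/ (diagrams_key R' < diagrams_key R)%N).
Proof.
rewrite coef_schurs_mon => /eqP H.
have kn alpha : kostka (tboxes R).+1 (nth 0%N (val (R alpha)))
     (shape_of (boxes (R' alpha)) (val (R' alpha))) != 0%N.
  by apply: contra_notN H => /eqP k0; rewrite (bigD1 alpha) //= k0 mul0r.
have br alpha : (boxes (R alpha) < (tboxes R).+1)%N.
  by rewrite ltnS /tboxes (bigD1 alpha) //= leq_addr.
have tri alpha := kostka_diagram_triangular (br alpha) (kn alpha).
split; first by apply: eq_bigr => alpha _; case: (tri alpha).
have [E|ne] := eqVneq R' R; [by left|right].
have [a Ra] : exists a, R' a != R a.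
  apply: contrapT => no; case/eqP: ne; apply/ffunP => a; apply/eqP.
  by apply: contrapT => /negP Ra; apply: no; exists a.
rewrite /diagrams_key (bigD1 a) // [leqRHS](bigD1 a) //= -addSn leq_add //.
  by case: (tri a) => _ [E|//]; rewrite E eqxx in Ra.
apply: leq_sum => alpha _; case: (tri alpha) => _ [->//|]; exact: ltnW.
Qed.

Lemma coef_schurs_mon_diag (R : diagrams L) :
  coef (schurs C 1 R) (diagrams_mon R) = 1.
Proof.
rewrite coef_schurs_mon big1 // => alpha _; rewrite kostka_diagram_diag //.
by rewrite ltnS /tboxes (bigD1 alpha) //= leq_addr.
Qed.

(** Two nested inductions, on the number of boxes and on the key, are needed. In the coefficient at
    the dominant monomial of R, the terms with e > 1 involve fewer boxes, and those with e = 1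
    involve, besides R, tuples with as many boxes and smaller key. *)
Lemma expansion_inj (f g : ne_diagrams L -> K) :
  expansion f = expansion g -> f = g.
Proof.
move=> fg; apply/funext => R.
have [n] := ubnP (tboxes (val R)); elim: n => [|n IHn] in R *.
  by move=> H; rewrite ltn0 in H.
rewrite ltnS => Rn; have [k] := ubnP (diagrams_key (val R)).
elim: k => [|k IHk] in R Rn *; first by move=> H; rewrite ltn0 in H.
rewrite ltnS => Rk; pose p := diagrams_mon (val R); pose N := tboxes (val R).
have s1 : coef (schurs C 1 (val R)) p != 0.
  by rewrite coef_schurs_mon_diag; apply: oner_neq0.
have pE : mdeg p = N by rewrite (schurs_homog s1) mul1n.
have pN : (mdeg p <= N)%N by rewrite pE.
have [rn rnP] := @ne_list_ex L N; have [un mn] := rnP.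
have N0 : (0 < N)%N by apply: ne_diagrams_tboxes.
(* The coefficients of the Schur functions are abstracted to a function S known only through the
   four properties that the comparison uses. *)
have : exists S : nat -> ne_diagrams L -> K, [/\ S 1%N R = 1,
    forall e R', S e R' != 0 -> N = (e * tboxes (val R'))%N,
    forall R', S 1%N R' != 0 -> tboxes (val R') = tboxes (val R) /\
      (val R' = val R \/ (diagrams_key (val R') < diagrams_key (val R))%N) &
    forall h, coef (expansion h) p = \sum_(1 <= e < N.+1) \sum_(R' <- rn)
      e%:R^-1 * dilate e (h R') * S e R'].
  exists (fun e R' => coef (schurs C e (val R')) p); split.
  - exact: coef_schurs_mon_diag.
  - by move=> e R' /schurs_homog; rewrite pE.
  - by move=> R'; apply: schurs_mon_triangular.
  - by move=> h; apply: coef_expansion rnP pN.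
case=> S [S1 Sdeg Stri Scoef].
pose T (h : ne_diagrams L -> K) e (R' : ne_diagrams L) : K :=
  e%:R^-1 * dilate e (h R') * S e R'.
have Tlow e R' : (1 < e)%N -> T f e R' = T g e R'.
  move=> e1; rewrite /T; have [->|s0] := eqVneq (S e R') 0; first by rewrite !mulr0.
  have -> // : f R' = g R'.
  apply: IHn; apply: leq_trans Rn; rewrite -/N (Sdeg e R' s0).
  by rewrite -[ltnLHS]mul1n ltn_pmul2r ?ne_diagrams_tboxes.
have T1 R' : R' != R -> T f 1 R' = T g 1 R'.
  move=> R'R; rewrite /T; have [->|s0] := eqVneq (S 1%N R') 0; first by rewrite !mulr0.
  have [bb] := Stri R' s0; case=> [/val_inj E|kk]; first by rewrite E eqxx in R'R.
  have -> // : f R' = g R'.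
  by apply: IHk; [rewrite bb | apply: leq_trans kk Rk].
have Rrn : R \in rn by apply/mn.
have : coef (expansion f) p = coef (expansion g) p by rewrite fg.
rewrite !Scoef [LHS]big_ltn // [RHS]big_ltn // (bigD1_seq R) //= [in RHS](bigD1_seq R) //=.
have -> : \sum_(2 <= e < N.+1) \sum_(R' <- rn) e%:R^-1 * dilate e (f R') * S e R' =
          \sum_(2 <= e < N.+1) \sum_(R' <- rn) e%:R^-1 * dilate e (g R') * S e R'.
  rewrite big_nat_cond [RHS]big_nat_cond; apply: eq_bigr => e /andP[/andP[e1 _] _].
  by apply: eq_bigr => R' _; apply: Tlow.
have -> : \sum_(R' <- rn | R' != R) 1%:R^-1 * dilate 1 (f R') * S 1%N R' =
    \sum_(R' <- rn | R' != R) 1%:R^-1 * dilate 1 (g R') * S 1%N R'.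
  by apply: eq_bigr => R'; apply: T1.
by move/addIr/addIr; rewrite !dilate1 S1 !mulr1 invr1 !mul1r.
Qed.
End Uniqueness.

Section Finiteness.
Variables (C : fieldType) (L : nat) (W : diagrams L -> ratfun C).

(** By [explicit_term_bound], d and m are at most the number of boxes of R, and then the families
    lie in the list [plist]. *)
Lemma finite_explicit_support (R : ne_diagrams L) :
  finite_set (explicit_support W R).
Proof.
pose N := tboxes (val R).
have [rv rvP] := tuple_list_ex 'I_L (vec_list_ex N).
have [rd rdP] := tuple_list_ex 'I_L (diagram_list_ex N).
pose P (p : nat * nat) := plist rv p.2 rd.
pose r : seq {p : nat * nat & summation_index L p.2} :=
  [seq existT (fun p : nat * nat => summation_index L p.2) p x
     | p <- [seq (d, m) | d <- iota 1 N, m <- iota 1 N], x <- P p].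
apply: (sub_finite_set (B := [set` r])) => //.
move=> [[d m] x] /= [d0 m0 adm xn0]; apply/allpairsPdep.
have [bd pos] := explicit_term_bound d0 adm xn0.
have mN : (m <= \sum_j tsize (x.1 j))%N.
  by rewrite -[leqLHS]card_ord -sum1_card; apply: leq_sum => j _.
exists (d, m), x; split=> //.
  apply/allpairsP; exists (d, m); split=> //=; rewrite mem_iota add1n ltnS.
    rewrite d0 /N -bd leq_pmulr //; exact: leq_trans mN.
  by rewrite m0 /N -bd (leq_trans mN) // leq_pmull.
exact: (explicit_term_plist rvP rdP (leqnn _) d0 adm xn0).
Qed.
End Finiteness.
End UniqueExpansion.

Theorem mainTheorem1 (C : numClosedFieldType) (L : nat) (hL : 0 < L)
    (K : link L) (W : diagrams L -> ratfun C)
    (hW : is_quantum_invariant K W) :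
  [/\ exists! f : ne_diagrams L -> ratfun C, free_energy_expansion W f,
      free_energy_expansion W (explicit_f W) &
      forall R : ne_diagrams L, finite_set (explicit_support W R)].
Proof.
have E : free_energy_expansion W (explicit_f W) by apply: free_energy_explicit.
split=> //; last exact: finite_explicit_support.
exists (explicit_f W); split=> // g Eg.
by apply: expansion_inj; rewrite -free_energy_explicit; apply: Eg.
Qed.
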